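(* Let $\kappa:S^2_+\to\mathbb{R}$ be a smooth function. The graph of the map $f_\kappa:S^2_+\to S^2_-$, $$f_\kappa(\mathbf{x}):=\left(\frac{\kappa(\mathbf{x})}{\sqrt{2+2\kappa(\mathbf{x})^2}},\,0,\,\frac{1}{\sqrt{2+2\kappa(\mathbf{x})^2}}\right),$$ seen as a submanifold of the Grassmannian $\widetilde{G}_2(\mathbb{R}^4)$, engenders a circular path geometry if and only if $\kappa$ is odd and satisfies $\|\nabla\kappa\|<1+\kappa^2$. Moreover, every circular path geometry can be obtained this way.
   Context: Identify $\mathbb{R}^4$ with the quaternions with orthonormal basis $\mathbf{1},\mathbf{i},\mathbf{j},\mathbf{k}$, $S^3$ with the unit quaternions, and $S^2$ with the purely imaginary unit quaternions. Let $\pi:S^3\to S^2$, $\pi(\mathbf{q})=\mathbf{q}\,\mathbf{i}\,\bar{\mathbf{q}}$, be the Hopf fibration. Let $\widetilde{G}_2(\mathbb{R}^4)$ be the Grassmannian of oriented two-planes in $\mathbb{R}^4$. Consider the basis of $\Lambda^2\mathbb{R}^4$ $$\mathbf{v}_1=\tfrac12(\mathbf{1}\wedge\mathbf{i}-\mathbf{j}\wedge\mathbf{k}),\quad \mathbf{v}_2=\tfrac12(\mathbf{1}\wedge\mathbf{j}+\mathbf{i}\wedge\mathbf{k}),\quad \mathbf{v}_3=\tfrac12(\mathbf{1}\wedge\mathbf{k}-\mathbf{i}\wedge\mathbf{j}),$$ $$\mathbf{v}_4=\tfrac12(\mathbf{1}\wedge\mathbf{i}+\mathbf{j}\wedge\mathbf{k}),\quad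 \mathbf{v}_5=\tfrac12(\mathbf{1}\wedge\mathbf{j}-\mathbf{i}\wedge\mathbf{k}),\quad \mathbf{v}_6=\tfrac12(\mathbf{1}\wedge\mathbf{k}+\mathbf{i}\wedge\mathbf{j}),$$ with associated coordinates $(x_1,\dots,x_6)$. An oriented two-plane with positively oriented orthonormal basis $(a,b)$ is identified with the bivector $\frac{1}{\sqrt2}\,a\wedge b$; in the coordinates above this identifies $\widetilde{G}_2(\mathbb{R}^4)$ with the product $S^2_-\times S^2_+$ of two-spheres of radius $1/\sqrt2$, where $$S^2_-=\{(x_1,x_2,x_3,0,0,0):x_1^2+x_2^2+x_3^2=1/2\},\qquad S^2_+=\{(0,0,0,x_4,x_5,x_6):x_4^2+x_5^2+x_6^2=1/2\}.$$ Points of $S^2_-$ are written with their coordinates $(x_1,x_2,x_3)$, and the graph of $f_\kappa$ is $\{(f_\kappa(\mathbf{x}),\mathbf{x}):\mathbf{x}\in S^2_+\}\subset S^2_-\times S^2_+$. The function $\kappa$ is odd if $\kappa(-\mathbf{x})=-\kappa(\mathbf{x})$. A submanifold $\Sigma\subset\widetilde{G}_2(\mathbb{R}^4)$ engenders the family of circles $\{\pi(L\cap S^3):L\in\Sigma\}$ on $S^2$. A path geometry on a surface $M$ is a smooth Legendrian foliation of its space of contact elements $PT^*M$ (the bundle of tangent lines, with its canonical contact structure) whose leaves are transverse to the canonical projection $\pi_1:PT^*M\to M$; the projections of the leaves to $M$ are called paths. Thus for each tangent line there is a unique path tangent to it. A circular path geometry is a path geometry on $S^2$ all of whose paths are (round,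 not necessarily great) circles; $\Sigma$ engenders a circular path geometry if the family it engenders is the family of paths of one.
   Formalization: The norm of ∇κ is taken for the round metric of curvature one on S²₊ (rescaled to unit radius), not the metric induced from radius 1/√2, for which the ''only if'' fails, e.g. for κ = 0.9√2·x₆. *)

(* Defs.v *)
From HB Require Import structures.
From mathcomp Require Import all_boot all_order all_algebra.
From mathcomp Require Import all_classical all_reals all_analysis.

Set Implicit Arguments.
Unset Strict Implicit.
Unset Printing Implicit Defensive.
Import Order.TTheory GRing.Theory Num.Theory.
Import numFieldNormedType.Exports.

Local Open Scope classical_set_scope.
Local Open Scope ring_scope.

(** Smooth maps.  Manifolds are subsets of normed spaces; "smooth on a subset"
    means "locally the restriction of a smooth map defined on an open set". *)

Definition iter_derive (R : realType) (V W : normedModType R)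
    (f : V -> W) (s : seq V) : V -> W :=
  foldr (fun v g => 'D_v g) f s.

Definition smooth_open (R : realType) (V W : normedModType R)
    (U : set V) (f : V -> W) : Prop :=
  forall (s : seq V) (x : V), U x -> differentiable (iter_derive f s) x.

Definition smooth (R : realType) (V W : normedModType R)
    (A : set V) (f : V -> W) : Prop :=
  forall x, A x -> exists (U : set V) (g : V -> W),
    [/\ open U, U x, smooth_open U g & forall y, A y -> U y -> f y = g y].

Definition smooth_curve (R : realType) (V : normedModType R)
    (N : set V) (c : R -> V) : Prop :=
  @smooth_open R R^o V setT c /\ forall t, N (c t).

Definition tangent_space (R : realType) (V : normedModType R)
    (N : set V) (x : V) : set V :=
  [set w | exists c : R -> V, [/\ smooth_curve N c, c 0 = x & derive1 c 0 = w]].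

(** One-dimensional foliations of N, given by their tangent line field D; in
    dimension one every smooth line field is integrable.  The leaf through x
    is the set of points joined to x by a smooth curve tangent to D, i.e. the
    maximal connected integral curve through x. *)

Definition smooth_line_field (R : realType) (V : normedModType R)
    (N : set V) (D : V -> set V) : Prop :=
  (forall x, N x -> D x `<=` tangent_space N x) /\
  (forall x, N x -> exists (U : set V) (X : V -> V),
    [/\ open U, U x, smooth_open U X &
        forall y, N y -> U y ->
          X y != 0 /\ D y = [set w | exists a : R, w = a *: X y]]).

Definition leaf (R : realType) (V : normedModType R)
    (N : set V) (D : V -> set V) (x : V) : set V :=
  [set y | exists c : R -> V,
    [/\ smooth_curve N c, (forall t, D (c t) (derive1 c t)), c 0 = x & c 1 = y]].

Definition dot (R : realType) (n : nat) (u v : 'rV[R]_n) : R :=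
  \sum_(i < n) u 0 i * v 0 i.

(** Contact elements of a surface M in R^(n+1): a tangent line is encoded by
    the orthogonal projector v^T v onto it, v being either of its two unit
    vectors; the line is { w | w *m l = w }. *)

Definition contact_elements (R : realType) (n : nat) (M : set 'rV[R]_n.+1) :
    set ('rV[R]_n.+1 * 'M[R]_n.+1) :=
  [set e | M e.1 /\ exists v : 'rV[R]_n.+1,
    [/\ tangent_space M e.1 v, dot v v = 1 & e.2 = v^T *m v]].

Definition contact_plane (R : realType) (n : nat) (M : set 'rV[R]_n.+1)
    (e : 'rV[R]_n.+1 * 'M[R]_n.+1) : set ('rV[R]_n.+1 * 'M[R]_n.+1) :=
  [set w | tangent_space (contact_elements M) e w /\ w.1 *m e.2 = w.1].

(** The contact manifold is three-dimensional, so a Legendrian foliation is a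
    line field contained in the contact planes.  Transversality to the
    projection e |-> e.1 means that no nonzero tangent vector of a leaf is
    tangent to a fibre. *)

Definition path_geometry (R : realType) (n : nat) (M : set 'rV[R]_n.+1)
    (D : 'rV[R]_n.+1 * 'M[R]_n.+1 -> set ('rV[R]_n.+1 * 'M[R]_n.+1)) : Prop :=
  [/\ smooth_line_field (contact_elements M) D,
      (forall e, contact_elements M e -> D e `<=` contact_plane M e) &
      (forall e w, contact_elements M e -> D e w -> w.1 = 0 -> w = 0)].

Definition paths (R : realType) (n : nat) (M : set 'rV[R]_n.+1)
    (D : 'rV[R]_n.+1 * 'M[R]_n.+1 -> set ('rV[R]_n.+1 * 'M[R]_n.+1)) :
    set (set 'rV[R]_n.+1) :=
  [set P | exists2 e, contact_elements M e &
    P = fst @` leaf (contact_elements M) D e].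

(** Quaternions, in coordinates with respect to 1, i, j, k. *)

Definition quat (R : realType) (a b c d : R) : 'rV[R]_4 :=
  \row_(i < 4) nth 0 [:: a; b; c; d] i.

Definition qmul (R : realType) (p q : 'rV[R]_4) : 'rV[R]_4 :=
  quat
    (p 0 0 * q 0 0 - p 0 1 * q 0 1 - p 0 2 * q 0 2 - p 0 3 * q 0 3)
    (p 0 0 * q 0 1 + p 0 1 * q 0 0 + p 0 2 * q 0 3 - p 0 3 * q 0 2)
    (p 0 0 * q 0 2 - p 0 1 * q 0 3 + p 0 2 * q 0 0 + p 0 3 * q 0 1)
    (p 0 0 * q 0 3 + p 0 1 * q 0 2 - p 0 2 * q 0 1 + p 0 3 * q 0 0).

Definition qconj (R : realType) (q : 'rV[R]_4) : 'rV[R]_4 :=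
  quat (q 0 0) (- q 0 1) (- q 0 2) (- q 0 3).

Definition q1 (R : realType) : 'rV[R]_4 := quat 1 0 0 0.
Definition qi (R : realType) : 'rV[R]_4 := quat 0 1 0 0.
Definition qj (R : realType) : 'rV[R]_4 := quat 0 0 1 0.
Definition qk (R : realType) : 'rV[R]_4 := quat 0 0 0 1.

Definition S3 (R : realType) : set 'rV[R]_4 := [set q | dot q q = 1].

Definition S2 (R : realType) : set 'rV[R]_4 :=
  [set q | dot q q = 1 /\ q 0 0 = 0].

Definition hopf (R : realType) (q : 'rV[R]_4) : 'rV[R]_4 :=
  qmul (qmul q (qi R)) (qconj q).

Definition is_circle (R : realType) (C : set 'rV[R]_4) : Prop :=
  exists (u : 'rV[R]_4) (h : R),
    [/\ S2 u, -1 < h < 1 & C = [set y | S2 y /\ dot y u = h]].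

Definition circular_path_geometry (R : realType)
    (D : 'rV[R]_4 * 'M[R]_4 -> set ('rV[R]_4 * 'M[R]_4)) : Prop :=
  path_geometry (@S2 R) D /\ (forall C, paths (@S2 R) D C -> is_circle C).

(** Bivectors of R^4 are skew-symmetric matrices; an oriented plane with
    positive orthonormal basis (a, b) is the bivector (sqrt 2)^-1 a /\ b. *)

Definition wedge (R : realType) (a b : 'rV[R]_4) : 'M[R]_4 :=
  a^T *m b - b^T *m a.

Definition v1 (R : realType) : 'M[R]_4 :=
  2^-1 *: (wedge (q1 R) (qi R) - wedge (qj R) (qk R)).
Definition v2 (R : realType) : 'M[R]_4 :=
  2^-1 *: (wedge (q1 R) (qj R) + wedge (qi R) (qk R)).
Definition v3 (R : realType) : 'M[R]_4 :=
  2^-1 *: (wedge (q1 R) (qk R) - wedge (qi R) (qj R)).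
Definition v4 (R : realType) : 'M[R]_4 :=
  2^-1 *: (wedge (q1 R) (qi R) + wedge (qj R) (qk R)).
Definition v5 (R : realType) : 'M[R]_4 :=
  2^-1 *: (wedge (q1 R) (qj R) - wedge (qi R) (qk R)).
Definition v6 (R : realType) : 'M[R]_4 :=
  2^-1 *: (wedge (q1 R) (qk R) + wedge (qi R) (qj R)).

Definition bivector (R : realType) (y x : 'rV[R]_3) : 'M[R]_4 :=
  y 0 0 *: v1 R + y 0 1 *: v2 R + y 0 2 *: v3 R
  + x 0 0 *: v4 R + x 0 1 *: v5 R + x 0 2 *: v6 R.

Definition orthonormal_pair (R : realType) (a b : 'rV[R]_4) : Prop :=
  [/\ dot a a = 1, dot b b = 1 & dot a b = 0].

Definition plane (R : realType) (a b : 'rV[R]_4) : set 'rV[R]_4 :=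
  [set q | exists s t : R, q = s *: a + t *: b].

Definition engendered_family (R : realType) (Sigma : set 'M[R]_4) :
    set (set 'rV[R]_4) :=
  [set C | exists a b : 'rV[R]_4,
    [/\ orthonormal_pair a b,
        Sigma ((Num.sqrt 2)^-1 *: wedge a b) &
        C = @hopf R @` (plane a b `&` @S3 R)]].

Definition engenders_circular_path_geometry (R : realType)
    (Sigma : set 'M[R]_4) : Prop :=
  exists D : 'rV[R]_4 * 'M[R]_4 -> set ('rV[R]_4 * 'M[R]_4),
    circular_path_geometry D /\ paths (@S2 R) D = engendered_family Sigma.

(** The points of S2plus are the coordinates (x4, x5, x6). *)

Definition S2plus (R : realType) : set 'rV[R]_3 := [set x | dot x x = 2^-1].

Definition f_kappa (R : realType) (kappa : 'rV[R]_3 -> R) (x : 'rV[R]_3) :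
    'rV[R]_3 :=
  \row_(i < 3) nth 0
    [:: kappa x / Num.sqrt (2 + 2 * kappa x ^+ 2);
        0;
        1 / Num.sqrt (2 + 2 * kappa x ^+ 2)] i.

Definition graph_f_kappa (R : realType) (kappa : 'rV[R]_3 -> R) :
    set 'M[R]_4 :=
  [set w | exists2 x, S2plus x & w = bivector (f_kappa kappa x) x].

(** Gradients on S2plus are taken for the round metric of curvature one, that
    is, the metric for which x |-> sqrt 2 *: x is an isometry onto the unit
    sphere; hence the factor 2.  For the metric induced by the coordinates
    (x4, x5, x6), of curvature two, the norm of the gradient would be sqrt 2
    times larger. *)

Definition round_metric (R : realType) (v w : 'rV[R]_3) : R := 2 * dot v w.

Definition is_gradient (R : realType) (kappa : 'rV[R]_3 -> R)
    (x g : 'rV[R]_3) : Prop :=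
  tangent_space (@S2plus R) x g /\
  forall c : R -> 'rV[R]_3, smooth_curve (@S2plus R) c -> c 0 = x ->
    round_metric g (derive1 c 0) = derive1 (kappa \o c : R -> R^o) 0.

Definition gradient (R : realType) (kappa : 'rV[R]_3 -> R) (x : 'rV[R]_3) :
    'rV[R]_3 :=
  xget 0 [set g | is_gradient kappa x g].

Definition gradient_norm (R : realType) (kappa : 'rV[R]_3 -> R)
    (x : 'rV[R]_3) : R :=
  Num.sqrt (round_metric (gradient kappa x) (gradient kappa x)).

Definition smooth_function (R : realType) (kappa : 'rV[R]_3 -> R) : Prop :=
  @smooth R 'rV[R]_3 R^o (@S2plus R) kappa.

Definition odd_function (R : realType) (kappa : 'rV[R]_3 -> R) : Prop :=
  forall x, S2plus x -> kappa (- x) = - kappa x.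

Definition gradient_bound (R : realType) (kappa : 'rV[R]_3 -> R) : Prop :=
  forall x, S2plus x -> gradient_norm kappa x < 1 + kappa x ^+ 2.

(* Main.v *)
Require Import Defs.
From HB Require Import structures.
From mathcomp Require Import all_boot all_order all_algebra.
From mathcomp Require Import ring lra.
From mathcomp Require Import all_classical all_reals all_analysis.

Set Implicit Arguments.
Unset Strict Implicit.
Unset Printing Implicit Defensive.
Import Order.TTheory GRing.Theory Num.Theory.
Import numFieldNormedType.Exports.

Local Open Scope classical_set_scope.
Local Open Scope ring_scope.

(** A round circle on the unit sphere of R^3, given an orientation, is the same
    thing as a pair (U, k) with <U, U> = 1 + k^2: its points are the unit
    vectors y with <U, y> = k, it is traversed in the direction U x y, and k is
    its geodesic curvature.  The pair (- U, - k) is the reversed circle, and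
    the circle of curvature k tangent to v at p has U = k p + p x v
    ([centre]).  The Hopf image of the plane spanned by a and b is the circle
    about the imaginary part of b conj(a) whose height is read off from the
    imaginary part of conj(a) b ([hopf_circle]); hence the graph of f_kappa
    engenders the circles which have, for every unit vector u, centre u and
    geodesic curvature kappa(u) ([engendered_graph]).

    Given a circular path geometry, let k(p, v) be the geodesic curvature of
    the path tangent to v at p.  It is smooth, odd in v, and constant along
    each path ([smooth_leaf_curv], [leaf_curvN], [path_of_frame]).  In terms of
    the Lorentz product <U, U'> - k k', an equality <U, U'> - k k' = 1 says
    that two oriented circles touch with the same direction; two different
    paths never do, since only one path is tangent to a given contact element.
    When the base point of the second path lies on the first one,
    Cauchy-Schwarz gives <U, U'> - k k' <= 1; otherwise the second path is
    turned around its base point until it is reversed, and the product never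
    crosses 1 on the way.  So <U, U'> - k k' <= 1 for any two paths
    ([family_spacelike]).  It follows that two paths with the same centre
    coincide, and an intermediate value argument provides one for every centre:
    kappa(u) is the curvature of the path with centre u ([centred_curv_root]).
    The infinitesimal form of the inequality ([arc_curvature_derive]) shows
    both that this root is nondegenerate, so that kappa is smooth by the
    implicit function theorem ([root_smooth]), and that the gradient bound is
    strict ([kappa_bound]).

    Conversely, extend kappa to be constant on rays.  The member of the family
    tangent to v at p has the curvature r for which
    kappa (r p + p x v) = r.  Such an r exists by the intermediate value
    theorem, and the gradient bound says that atan r - atan kappa(r p + p x v)
    is strictly increasing in r, so r is unique and depends smoothly on the
    frame ([slope_root], [smooth_slope]).  By oddness, reversing v changes the
    sign of r, so the accelerations of these circles define a line field on
    contact elements ([spray_path_geometry]).  Along an integral curve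
    U' = r' p, and differentiating kappa(U) = r gives r' = r' d kappa(p) with
    d kappa(p) < 1, hence U' = 0: the leaves are the lifts of the circles
    ([spray_path]).

    Finally an odd kappa is determined on the sphere by its family of circles
    ([kappa_unique]), which turns the second half into the remaining
    implication of the first. *)

(** * Differentiability in epsilon form *)

Section Differentiability.
Variable R : realType.
Implicit Types V W : normedModType R.

Lemma is_diff_eps V W (f : V -> W) (df : {linear V -> W}) (x : V) :
  continuous df ->
  (forall e, 0 < e ->
     \forall h \near (0 : V), `|f (h + x) - f x - df h| <= e * `|h|) ->
  is_diff x f df.
Proof.
move=> dfc H.
have E : f \o shift x = cst (f x) + df +o_ (0 : V) id.
  apply/eqaddoP => e e0; apply: filterS (H e e0) => h.
  by rewrite !fctE /= opprD addrA.
have D := diff_unique dfc E.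
apply: DiffDef => //; apply/diff_locallyP; split.
  by rewrite D.
by rewrite D.
Qed.

Lemma diff_eps V W (f : V -> W) (x : V) : differentiable f x ->
  forall e, 0 < e ->
     \forall h \near (0 : V), `|f (h + x) - f x - 'd f x h| <= e * `|h|.
Proof.
move=> /diff_locally /eqaddoP H e e0; apply: filterS (H e e0) => h.
by rewrite !fctE /= opprD addrA.
Qed.

Lemma near_eq_is_diff V W (f g : V -> W) (x : V) (df : {linear V -> W}) :
  (\near x, f x = g x) -> is_diff x f df -> is_diff x g df.
Proof.
move=> fg [fd fE].
have dfc : continuous df by rewrite -fE; exact: diff_continuous.
apply: is_diff_eps => // e e0.
have H := diff_eps fd e0.
have fg0 : \forall h \near (0 : V), f (h + x) = g (h + x).
  by move: fg; rewrite (near_shift 0 x) /=; apply: filterS => h; rewrite subr0.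
apply: filterS2 H fg0 => h.
by rewrite fE -(nbhs_singleton fg) => + <-.
Qed.

Lemma eq_on_differentiable V W (U : set V) (f g : V -> W) (x : V) :
  open U -> U x -> (forall y, U y -> f y = g y) ->
  differentiable f x -> differentiable g x.
Proof.
move=> oU Ux fg df.
have : is_diff x g ('d f x).
  apply: near_eq_is_diff (differentiableP df).
  by apply: filterS fg _; exact: open_nbhs_nbhs.
by case.
Qed.

Lemma eq_on_derive V W (U : set V) (f g : V -> W) (x v : V) :
  open U -> U x -> (forall y, U y -> f y = g y) -> 'D_v f x = 'D_v g x.
Proof.
move=> oU Ux fg; apply: near_eq_derive.
by apply: filterS fg _; exact: open_nbhs_nbhs.
Qed.

Lemma derive_comp V W W' (f : V -> W) (g : W -> W') (x v : V) :
  differentiable f x -> differentiable g (f x) ->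
  'D_v (g \o f) x = 'D_('D_v f x) g (f x).
Proof.
move=> df dg; rewrite !deriveE //; last exact: differentiable_comp.
by rewrite diff_comp.
Qed.

End Differentiability.

(** * Classes of functions closed under differentiation *)

Section SmoothClass.
Variable R : realType.
Implicit Types V W : normedModType R.

(** A finite coordinate system: the functionals [l i] read the coordinates along
    the vectors [e i]. *)
Definition coordinates W (I : finType) (e : I -> W) (l : I -> {linear W -> R^o}) :=
  (forall i, continuous (l i)) /\ (forall w, w = \sum_i l i w *: e i).

(** Coinduction for smoothness: all iterated derivatives of f stay in P. *)
Lemma smooth_coind V W (U : set V) (P : set (V -> W)) : open U ->
  (forall f, P f -> forall x, U x -> differentiable f x) ->
  (forall f v, P f -> P ('D_v f)) ->
  forall f, P f -> smooth_open U f.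
Proof.
move=> oU Pd PD f Pf s; suff : P (iter_derive f s) by move=> /Pd.
by elim: s => //= v s; exact: PD.
Qed.

Lemma smooth_open_diff V W (U : set V) (f : V -> W) x :
  smooth_open U f -> U x -> differentiable f x.
Proof. by move=> /(_ [::] x). Qed.

Lemma smooth_open_derive V W (U : set V) (f : V -> W) v :
  smooth_open U f -> smooth_open U ('D_v f).
Proof. by move=> fs s x Ux; have := fs (rcons s v) x Ux; rewrite /iter_derive foldr_rcons. Qed.

Lemma smooth_open_sub V W (U U' : set V) (f : V -> W) :
  U' `<=` U -> smooth_open U f -> smooth_open U' f.
Proof. by move=> UU fs s x /UU; exact: fs. Qed.

(** The functions built on U from the generators G.  The composition rule asks
    only the coordinates of the inner map to lie in the class, which is what
    its derivative, a sum of coordinate derivatives times partial derivatives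
    of g, needs.  The last rule is there because a formula for a derivative
    holds on U only. *)
Inductive smooth_class V (U : set V) (G : set (V -> R^o)) : (V -> R^o) -> Prop :=
| sc_gen f : G f -> smooth_class U G f
| sc_cst (a : R^o) : smooth_class U G (fun=> a)
| sc_add f g : smooth_class U G f -> smooth_class U G g ->
    smooth_class U G (fun x => f x + g x)
| sc_mul f g : smooth_class U G f -> smooth_class U G g ->
    smooth_class U G (fun x => f x * g x : R^o)
| sc_inv f : smooth_class U G f -> (forall x, U x -> f x != 0) ->
    smooth_class U G (fun x => (f x)^-1 : R^o)
| sc_sqrt f : smooth_class U G f -> (forall x, U x -> 0 < f x) ->
    smooth_class U G (fun x => Num.sqrt (f x) : R^o)
| sc_cos f : smooth_class U G f -> smooth_class U G (fun x => cos (f x) : R^o)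
| sc_sin f : smooth_class U G f -> smooth_class U G (fun x => sin (f x) : R^o)
| sc_comp W (I : finType) (e : I -> W) (l : I -> {linear W -> R^o})
    (O : set W) (g : W -> R^o) (f : V -> W) :
    coordinates e l -> open O -> smooth_open O g ->
    (forall x, U x -> O (f x)) ->
    (forall i, smooth_class U G (l i \o f)) -> smooth_class U G (g \o f)
| sc_ext f g : smooth_class U G f -> (forall x, U x -> f x = g x) ->
    smooth_class U G g.

Lemma differentiable_bigsum V W (I : finType) (f : I -> V -> W) (x : V) :
  (forall i, differentiable (f i) x) ->
  differentiable (fun y => \sum_i f i y) x.
Proof.
move=> fd; have -> : (fun y => \sum_i f i y) = \sum_(i < #|I|) f (enum_val i).
  by apply/funext => y; rewrite fct_sumE (reindex_onto _ _ (fun i _ => enum_rankK i)) /=;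
     apply: eq_bigl => i; rewrite enum_valK eqxx.
exact: differentiable_sum.
Qed.

Lemma derive_linear V W W' (l : {linear W -> W'}) (f : V -> W) (x v : V) :
  continuous l -> differentiable f x -> 'D_v (l \o f) x = l ('D_v f x).
Proof.
move=> lc fd; have ld : differentiable l (f x) by exact: linear_differentiable.
by rewrite derive_comp // deriveE // diff_lin.
Qed.

Lemma coordinates_differentiable V W (I : finType) (e : I -> W)
    (l : I -> {linear W -> R^o}) (f : V -> W) x :
  coordinates e l -> (forall i, differentiable (l i \o f) x) ->
  differentiable f x.
Proof.
move=> [lc fE] fd.
have -> : f = fun y => \sum_i (l i \o f) y *: e i by apply/funext => y; exact: fE.
by apply: differentiable_bigsum => i; exact: differentiableZl.
Qed.

Lemma is_diff_derive V (f : V -> R^o) (df : V -> R^o) x :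
  is_diff x f df -> differentiable f x /\ forall v, 'D_v f x = df v.
Proof. by move=> [fd <-]; split=> // v; rewrite deriveE. Qed.

Lemma derive_comp1 V (f : V -> R^o) (g : R -> R) (x v : V) (d : R) :
  differentiable f x -> is_derive (f x : R) 1 g d ->
  differentiable (fun y => g (f y) : R^o) x /\
  'D_v (fun y => g (f y) : R^o) x = 'D_v f x * d.
Proof.
move=> fd gd.
have gdf : differentiable (g : R^o -> R^o) (f x).
  by apply/derivable1_diffP; case: gd.
split; first exact: (differentiable_comp fd gdf).
rewrite [LHS](derive_comp v fd gdf) deriveE //.
rewrite -[X in 'd _ _ X]mulr1 -[X in 'd _ _ X]/('D_v f x *: (1 : R^o)) linearZ.
rewrite -deriveE //; case: gd => _ <-.
by [].
Qed.

Section closure.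
Variables (V : normedModType R) (U : set V) (G : set (V -> R^o)).
Hypothesis oU : open U.
Hypothesis Gd : forall f, G f -> forall x, U x -> differentiable f x.
Hypothesis GD : forall f v, G f -> smooth_class U G ('D_v f).

(** If the derivatives of the generators stay in the class, so do those of all
    its members; see [root_smooth] for generators that are not smooth a
    priori. *)
Lemma smooth_class_derive f : smooth_class U G f ->
  (forall x, U x -> differentiable f x) /\
  (forall v, smooth_class U G ('D_v f)).
Proof.
elim=> {f}.
- by move=> f Gf; split; [exact: Gd | move=> v; exact: GD].
- move=> a; split=> [x _|v]; first exact: differentiable_cst.
  apply: (sc_ext (sc_cst _ _ 0)) => x Ux.
  by rewrite (_ : (fun=> a) = cst a) // derive_cst.
- move=> f g _ [fd fD] _ [gd gD]; split=> [x Ux|v].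
    exact: (differentiableD (fd _ Ux) (gd _ Ux)).
  apply: (sc_ext (sc_add (fD v) (gD v))) => x Ux.
  by rewrite [RHS](deriveD (f := f) (g := g)) //; apply/diff_derivable; auto.
- move=> f g sf [fd fD] sg [gd gD]; split=> [x Ux|v].
    exact: (differentiableM (fd _ Ux) (gd _ Ux)).
  apply: (sc_ext (sc_add (sc_mul sf (gD v)) (sc_mul sg (fD v)))) => x Ux.
  by rewrite [RHS](deriveM (f := f) (g := g)) //; apply/diff_derivable; auto.
- move=> f sf [fd fD] f0; split=> [x Ux|v].
    exact: (differentiableV (fd _ Ux) (f0 _ Ux)).
  have sv := sc_inv sf f0.
  apply: (sc_ext (sc_mul (sc_mul (sc_cst _ _ (-1)) (sc_mul sv sv)) (fD v))) => x Ux.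
  rewrite [RHS](deriveV (f := f)) ?f0 //; last exact/diff_derivable/fd.
  by rewrite /GRing.scale /= mulN1r -expr2 exprVn.
- move=> f sf [fd fD] f0.
  have H x v (Ux : U x) := derive_comp1 v (fd _ Ux) (is_derive1_sqrt (f0 _ Ux)).
  split=> [x Ux|v]; first by case: (H _ 0 Ux).
  have ss := sc_sqrt sf f0.
  have ss2 : smooth_class U G (fun x => (2 * Num.sqrt (f x))^-1 : R^o).
    apply: sc_inv; first exact: sc_mul (sc_cst _ _ 2) ss.
    by move=> x Ux; rewrite gt_eqF // mulr_gt0 // sqrtr_gt0 f0.
  apply: (sc_ext (sc_mul (fD v) ss2)) => x Ux.
  by case: (H _ v Ux) => _ ->.
- move=> f sf [fd fD].
  have H x v (Ux : U x) := derive_comp1 v (fd _ Ux) (is_derive_cos (f x)).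
  split=> [x Ux|v]; first by case: (H _ 0 Ux).
  apply: (sc_ext (sc_mul (fD v) (sc_mul (sc_cst _ _ (-1)) (sc_sin sf)))) => x Ux.
  by case: (H _ v Ux) => _ ->; rewrite mulN1r.
- move=> f sf [fd fD].
  have H x v (Ux : U x) := derive_comp1 v (fd _ Ux) (is_derive_sin (f x)).
  split=> [x Ux|v]; first by case: (H _ 0 Ux).
  apply: (sc_ext (sc_mul (fD v) (sc_cos sf))) => x Ux.
  by case: (H _ v Ux) => _ ->.
- move=> W I e l O g f [lc wE] oO gs fO slf IH.
  have fd x : U x -> differentiable f x.
    move=> Ux; apply: (@coordinates_differentiable _ _ _ e l) => // i.
    by case: (IH i) => + _; exact.
  have gd x : U x -> differentiable g (f x).
    by move=> Ux; exact: smooth_open_diff gs (fO _ Ux).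
  split=> [x Ux|v]; first exact: differentiable_comp (fd _ Ux) (gd _ Ux).
  have H i : smooth_class U G (fun x => 'D_v (l i \o f) x * ('D_(e i) g \o f) x : R^o).
    apply: sc_mul; first by case: (IH i).
    by apply: (@sc_comp _ U G W I e l O ('D_(e i) g) f) => //; exact: smooth_open_derive.
  have Hs (s : seq I) : smooth_class U G
      (fun x => \sum_(i <- s) ('D_v (l i \o f) x * ('D_(e i) g \o f) x) : R^o).
    elim: s => [|i s IHs].
      by apply: (sc_ext (sc_cst _ _ 0)) => x Ux; rewrite big_nil.
    by apply: (sc_ext (sc_add (H i) IHs)) => x Ux; rewrite big_cons.
  apply: (sc_ext (Hs (index_enum I))) => x Ux.
  have fx := fd _ Ux; have gx := gd _ Ux.
  rewrite (derive_comp v fx gx) [RHS](deriveE _ gx).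
  rewrite [in RHS](wE ('D_v f x)) linear_sum /=; apply: eq_bigr => i _.
  by rewrite linearZ /= -(deriveE _ gx) derive_linear.
- move=> f g sf [fd fD] fg; split=> [x Ux|v].
    exact: eq_on_differentiable oU Ux fg (fd _ Ux).
  apply: (sc_ext (fD v)) => x Ux; exact: eq_on_derive oU Ux fg.
Qed.

Lemma smooth_class_smooth f : smooth_class U G f -> smooth_open U f.
Proof.
apply: smooth_coind => // {f}f; first by move=> /smooth_class_derive[].
by move=> v /smooth_class_derive[].
Qed.

End closure.

End SmoothClass.

(** * Calculus of smooth maps *)

(** Finite dimension, as the existence of coordinates, is what the chain rule for
    smooth maps uses. *)
Class findim (R : realType) (W : normedModType R) : Prop :=
  findimP : exists (I : finType) (e : I -> W) (l : I -> {linear W -> R^o}),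
    coordinates e l.

Section Smooth.
Variable R : realType.
Implicit Types V W : normedModType R.

#[global] Instance findim_real : findim (R^o : normedModType R).
Proof.
exists unit, (fun=> 1), (fun=> idfun); split.
  by move=> _ x; exact: cvg_id.
by move=> w; rewrite big_const card_unit /= addr0 /GRing.scale /= mulr1.
Qed.

#[global] Instance findim_mx m n : findim ('M[R]_(m, n) : normedModType R).
Proof.
have lin (ij : 'I_m * 'I_n) : linear (fun A : 'M[R]_(m, n) => A ij.1 ij.2 : R^o).
  by move=> a A B; rewrite !mxE.
pose l ij : {linear 'M[R]_(m, n) -> R^o} :=
  HB.pack (fun A : 'M[R]_(m, n) => A ij.1 ij.2 : R^o)
    (GRing.isLinear.Build _ _ _ _ _ (lin ij)).
exists ('I_m * 'I_n)%type, (fun ij => delta_mx ij.1 ij.2), l; split.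
  by move=> ij A; exact: coord_continuous.
move=> A; rewrite {1}(matrix_sum_delta A) pair_bigA /=.
by apply: eq_bigr => -[i j] _.
Qed.

#[global] Instance findim_prod V W : findim V -> findim W ->
  findim ((V * W)%type : normedModType R).
Proof.
move=> [I [e [l [lc lE]]]] [J [f [k [kc kE]]]].
have lin1 i : linear (fun z : V * W => l i z.1).
  by move=> a x y /=; rewrite linearP.
have lin2 i : linear (fun z : V * W => k i z.2).
  by move=> a x y /=; rewrite linearP.
pose L (s : I + J) : {linear (V * W)%type -> R^o} := match s with
  | inl i => HB.pack (fun z : V * W => l i z.1)
               (GRing.isLinear.Build _ _ _ _ _ (lin1 i))
  | inr i => HB.pack (fun z : V * W => k i z.2)
               (GRing.isLinear.Build _ _ _ _ _ (lin2 i)) end.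
exists (I + J)%type, (fun s => match s with inl i => (e i, 0) | inr j => (0, f j) end), L.
split.
  by move=> [i|i] z /=; apply: continuous_comp; [exact: cvg_fst|exact: lc|exact: cvg_snd|exact: kc].
move=> [x y]; rewrite big_sumType /=.
rewrite [X in X + _](_ : _ = (x, 0)); last first.
  rewrite {2}(lE x); elim/big_rec2: _ => //= i z1 z2 _ ->.
  by apply: injective_projections; rewrite /= ?scaler0 ?addr0.
rewrite [X in _ + X](_ : _ = (0, y)); last first.
  rewrite {2}(kE y); elim/big_rec2: _ => //= i z1 z2 _ ->.
  by apply: injective_projections; rewrite /= ?scaler0 ?addr0.
by apply: injective_projections; rewrite /= ?add0r ?addr0.
Qed.

Section real_valued.
Variables (V : normedModType R) (U : set V).
Hypothesis oU : open U.

Lemma smooth_class_open (f : V -> R^o) :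
  smooth_class U [set g | smooth_open U g] f -> smooth_open U f.
Proof.
apply: smooth_class_smooth => // {}f.
  by move=> fs x Ux; exact: smooth_open_diff fs Ux.
by move=> v fs; apply: sc_gen; exact: smooth_open_derive.
Qed.

Lemma smooth_eq W (f g : V -> W) : smooth_open U f ->
  (forall x, U x -> f x = g x) -> smooth_open U g.
Proof.
move=> fs fg.
apply: (@smooth_coind _ _ _ _
  [set g | exists2 f, smooth_open U f & forall x, U x -> f x = g x]).
- by [].
- move=> h [k ks kh] x Ux; apply: (eq_on_differentiable oU Ux kh).
  exact: smooth_open_diff ks Ux.
- move=> h v [k ks kh]; exists ('D_v k); first exact: smooth_open_derive.
  by move=> x Ux; exact: eq_on_derive oU Ux kh.
- by exists f.
Qed.

Lemma smoothM (f g : V -> R^o) : smooth_open U f -> smooth_open U g ->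
  smooth_open U (fun x => f x * g x : R^o).
Proof. by move=> fs gs; apply: smooth_class_open; apply: sc_mul; exact: sc_gen. Qed.

Lemma smoothV (f : V -> R^o) : smooth_open U f -> (forall x, U x -> f x != 0) ->
  smooth_open U (fun x => (f x)^-1 : R^o).
Proof. by move=> fs f0; apply: smooth_class_open; apply: sc_inv => //; exact: sc_gen. Qed.

Lemma smooth_sqrt (f : V -> R^o) : smooth_open U f -> (forall x, U x -> 0 < f x) ->
  smooth_open U (fun x => Num.sqrt (f x) : R^o).
Proof. by move=> fs f0; apply: smooth_class_open; apply: sc_sqrt => //; exact: sc_gen. Qed.

Lemma smooth_cos (f : V -> R^o) : smooth_open U f ->
  smooth_open U (fun x => cos (f x) : R^o).
Proof. by move=> fs; apply: smooth_class_open; apply: sc_cos; exact: sc_gen. Qed.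

Lemma smooth_sin (f : V -> R^o) : smooth_open U f ->
  smooth_open U (fun x => sin (f x) : R^o).
Proof. by move=> fs; apply: smooth_class_open; apply: sc_sin; exact: sc_gen. Qed.

Lemma smooth_linear W W' (l : {linear W -> W'}) (f : V -> W) :
  continuous l -> smooth_open U f -> smooth_open U (l \o f).
Proof.
move=> lc fs.
apply: (@smooth_coind _ _ _ _
  [set g | exists2 f, smooth_open U f & forall x, U x -> l (f x) = g x]).
- by [].
- move=> h [k ks kh] x Ux; apply: (eq_on_differentiable oU Ux kh).
  apply: (@differentiable_comp _ _ _ _ k l); first exact: smooth_open_diff ks Ux.
  exact: linear_differentiable.
- move=> h v [k ks kh]; exists ('D_v k); first exact: smooth_open_derive.
  move=> x Ux; rewrite -(eq_on_derive v oU Ux kh).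
  by rewrite (@derive_linear _ _ _ _ l k) //; exact: smooth_open_diff ks Ux.
- by exists f.
Qed.

End real_valued.

Section vector_valued.
Variables (V : normedModType R) (U : set V).
Hypothesis oU : open U.

Lemma smooth_coordinates W (I : finType) (e : I -> W) (l : I -> {linear W -> R^o})
    (f : V -> W) : coordinates e l ->
  (forall i, smooth_open U (l i \o f)) -> smooth_open U f.
Proof.
move=> [lc lE] fs.
pose P := [set g : V -> W | forall i, smooth_open U (l i \o g)].
apply: (@smooth_coind _ _ _ _ P) => //.
- move=> h hs x Ux; apply: (@coordinates_differentiable _ _ _ _ e l) => // i.
  exact: smooth_open_diff (hs i) Ux.
- move=> h v hs i /=.
  apply: (smooth_eq oU (smooth_open_derive v (hs i))) => x Ux.
  rewrite derive_linear //.
  apply: (@coordinates_differentiable _ _ _ _ e l) => // j.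
  exact: smooth_open_diff (hs j) Ux.
Qed.

Lemma smooth_comp W W' {Wf : findim W} {Wf' : findim W'} (O : set W)
    (g : W -> W') (f : V -> W) :
  open O -> smooth_open O g -> smooth_open U f -> (forall x, U x -> O (f x)) ->
  smooth_open U (g \o f).
Proof.
move: Wf Wf' => [I [e [l el]]] [J [e' [k ek]]] oO gs fs fO.
apply: (smooth_coordinates ek) => j.
apply: (smooth_class_open oU).
apply: (@sc_comp _ _ U _ W I e l O (k j \o g) f) => //.
  by apply: smooth_linear => //; case: ek.
move=> i; apply: sc_gen; apply: smooth_linear => //.
by case: el.
Qed.

Lemma smooth_cst W (a : W) : smooth_open U (fun=> a).
Proof.
apply: (@smooth_coind _ _ _ U [set g | exists a : W, forall x, U x -> a = g x]) => //.
- move=> h [b bh] x Ux; apply: (eq_on_differentiable oU Ux bh).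
  exact: differentiable_cst.
- move=> h v [b bh]; exists 0 => x Ux; rewrite -(eq_on_derive v oU Ux bh).
  by rewrite (_ : (fun=> b) = cst b) // derive_cst.
- by exists a.
Qed.

Lemma smooth_id : smooth_open U (id : V -> V).
Proof.
apply: (@smooth_coind _ _ _ U [set g | (forall x, U x -> x = g x) \/
   exists a : V, forall x, U x -> a = g x]) => //; last by left.
- move=> h [hE|[b bh]] x Ux; first exact: (eq_on_differentiable (f := id) oU Ux hE).
  apply: (eq_on_differentiable oU Ux bh); exact: differentiable_cst.
- move=> h v [hE|[b bh]]; right.
    exists v => x Ux; rewrite -(eq_on_derive (f := id) v oU Ux hE).
    by rewrite derive_id.
  exists 0 => x Ux; rewrite -(eq_on_derive v oU Ux bh).
  by rewrite (_ : (fun=> b) = cst b) // derive_cst.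
Qed.

Lemma smoothD W (f g : V -> W) :
  smooth_open U f -> smooth_open U g -> smooth_open U (fun x => f x + g x).
Proof.
move=> fs gs.
apply: (@smooth_coind _ _ _ U [set h | exists f g, [/\ smooth_open U f,
   smooth_open U g & forall x, U x -> f x + g x = h x]]) => //.
- move=> h [k [q [ks qs kh]]] x Ux; apply: (eq_on_differentiable oU Ux kh).
  by apply: (differentiableD (f := k) (g := q));
    [exact: smooth_open_diff ks Ux|exact: smooth_open_diff qs Ux].
- move=> h v [k [q [ks qs kh]]]; exists ('D_v k), ('D_v q).
  split; try exact: smooth_open_derive.
  move=> x Ux; rewrite -(eq_on_derive v oU Ux kh) [RHS](deriveD (f := k) (g := q)) //.
    by apply/diff_derivable; exact: smooth_open_diff ks Ux.
  by apply/diff_derivable; exact: smooth_open_diff qs Ux.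
- by exists f, g.
Qed.

Lemma smoothZ W {Wf : findim W} (a : V -> R^o) (f : V -> W) :
  smooth_open U a -> smooth_open U f -> smooth_open U (fun x => a x *: f x).
Proof.
move=> as_ fs; case: Wf => I [e [l el]].
apply: (smooth_coordinates el) => i.
apply: (@smooth_eq _ _ oU _ (fun x => a x * (l i \o f) x)); last first.
  by move=> x _ /=; rewrite linearZ.
by apply: smoothM => //; apply: smooth_linear => //; case: el.
Qed.

Lemma smoothN W (f : V -> W) : smooth_open U f -> smooth_open U (fun x => - f x).
Proof.
by move=> fs; apply: (@smooth_linear _ _ oU _ _ -%R) => // x; exact: opp_continuous.
Qed.

Lemma smoothB W (f g : V -> W) :
  smooth_open U f -> smooth_open U g -> smooth_open U (fun x => f x - g x).
Proof. by move=> fs gs; apply: smoothD => //; exact: smoothN. Qed.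

Lemma smooth_fst W W' (f : V -> W * W') : smooth_open U f ->
  smooth_open U (fun x => (f x).1).
Proof.
by move=> fs; apply: (@smooth_linear _ _ oU _ _ fst) => // x; exact: cvg_fst.
Qed.

Lemma smooth_snd W W' (f : V -> W * W') : smooth_open U f ->
  smooth_open U (fun x => (f x).2).
Proof.
by move=> fs; apply: (@smooth_linear _ _ oU _ _ snd) => // x; exact: cvg_snd.
Qed.

Lemma smooth_pair W W' (f : V -> W) (g : V -> W') :
  smooth_open U f -> smooth_open U g -> smooth_open U (fun x => (f x, g x)).
Proof.
move=> fs gs.
have lin1 : linear (fun w : W => (w, 0 : W')).
  by move=> a x y; apply: injective_projections; rewrite /= ?scaler0 ?addr0.
have lin2 : linear (fun w : W' => (0 : W, w)).
  by move=> a x y; apply: injective_projections; rewrite /= ?scaler0 ?addr0.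
pose l1 : {linear W -> (W * W')%type} :=
  HB.pack (fun w : W => (w, 0 : W')) (GRing.isLinear.Build _ _ _ _ _ lin1).
pose l2 : {linear W' -> (W * W')%type} :=
  HB.pack (fun w : W' => (0 : W, w)) (GRing.isLinear.Build _ _ _ _ _ lin2).
have s1 : smooth_open U (l1 \o f).
  by apply: smooth_linear => // x; apply: cvg_pair => //; exact: cvg_cst.
have s2 : smooth_open U (l2 \o g).
  by apply: smooth_linear => // x; apply: cvg_pair => //; exact: cvg_cst.
apply: (smooth_eq oU (smoothD s1 s2)) => x _ /=.
by apply: injective_projections; rewrite /= ?add0r ?addr0.
Qed.

Lemma smooth_entry m n (f : V -> 'M[R]_(m, n)) i j :
  smooth_open U f -> smooth_open U (fun x => f x i j : R^o).
Proof.
move=> fs; have lin : linear (fun A : 'M[R]_(m, n) => A i j : R^o).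
  by move=> a A B; rewrite !mxE.
pose l : {linear 'M[R]_(m, n) -> R^o} :=
  HB.pack (fun A : 'M[R]_(m, n) => A i j : R^o) (GRing.isLinear.Build _ _ _ _ _ lin).
by apply: (@smooth_linear _ _ oU _ _ l) => // A; exact: coord_continuous.
Qed.

Lemma smooth_mx m n (f : V -> 'M[R]_(m, n)) :
  (forall i j, smooth_open U (fun x => f x i j : R^o)) -> smooth_open U f.
Proof.
move=> fs.
apply: (@smooth_eq _ _ oU _
  (fun x => \sum_(ij : 'I_m * 'I_n) f x ij.1 ij.2 *: delta_mx ij.1 ij.2)); last first.
  by move=> x _; rewrite [RHS]matrix_sum_delta pair_bigA.
elim: (index_enum _) => [|ij s IHs].
  by apply: (smooth_eq oU (smooth_cst 0)) => x _; rewrite big_nil.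
apply: (smooth_eq oU (smoothD (smoothZ (fs ij.1 ij.2) (smooth_cst (delta_mx ij.1 ij.2))) IHs)).
by move=> x _; rewrite big_cons.
Qed.

Lemma smooth_local W (f : V -> W) :
  (forall x, U x -> exists (O : set V) (g : V -> W),
     [/\ open O, O x, smooth_open O g & forall y, O y -> U y -> f y = g y]) ->
  smooth_open U f.
Proof.
move=> H s x Ux; have [Q [g [oO Ox gs fg]]] := H x Ux.
have oOU : open (Q `&` U) := openI oO oU.
suff sf : smooth_open (Q `&` U) f; first by apply: sf.
apply: (@smooth_eq _ _ oOU _ g) => [|y [Oy Uy]]; last by rewrite fg.
by apply: smooth_open_sub gs => y [].
Qed.

End vector_valued.

End Smooth.

(** * The implicit function theorem for a unique root *)

Lemma continuous_pairl (R : realType) (V W : normedModType R) (x : V) (r : W) :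
  {for x, continuous (fun y : V => (y, r))}.
Proof.
apply: differentiable_continuous; apply: differentiable_pair.
  exact: (@ex_diff _ _ _ _ _ _ _ (is_diff_id x)).
exact: differentiable_cst.
Qed.

Lemma continuous_pairr (R : realType) (V W : normedModType R) (y : W) (r : V) :
  {for r, continuous (fun s : V => (y, s))}.
Proof.
apply: differentiable_continuous; apply: differentiable_pair.
  exact: differentiable_cst.
exact: (@ex_diff _ _ _ _ _ _ _ (is_diff_id r)).
Qed.

Lemma derive_snd (R : realType) (V : normedModType R) (F : V * R^o -> R^o) (x : V) (r : R) :
  'D_(0, 1) F (x, r) = 'D_1 (fun s : R => F (x, s) : R) r.
Proof.
have E : (fun h : R => h^-1 *: ((F \o shift (x, r : R^o)) (h *: (0, 1)) - F (x, r))) =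
  (fun h => h^-1 *: (((fun s : R => F (x, s) : R) \o shift r) (h *: 1) - F (x, r))).
  apply/funext => h /=; congr (_ *: (F _ - _)).
  by apply: injective_projections; rewrite /= ?scaler0 ?add0r.
by rewrite /derive E.
Qed.

Lemma open_cylinder (R : realType) (V W : normedModType R) (U : set V) :
  open U -> open [set z : V * W | U z.1].
Proof. by move=> oU; apply: (@open_comp _ _ fst) => // z _; exact: cvg_fst. Qed.

Section ImplicitRoot.
Variables (R : realType) (V : normedModType R) (U : set V).
Variables (F : V * R^o -> R^o) (k : V -> R^o).
Hypothesis oU : open U.
Hypothesis FS : smooth_open [set z : V * R^o | U z.1] F.
Hypothesis Fk : forall x r, U x -> F (x, r) = 0 <-> r = k x.
Hypothesis Fk' : forall x, U x -> 'D_(0, 1) F (x, k x) != 0.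

Let Fd z : U z.1 -> differentiable F z.
Proof. by move=> Uz; exact: smooth_open_diff FS Uz. Qed.

Let Fk0 x : U x -> F (x, k x) = 0.
Proof. by move=> Ux; apply/Fk. Qed.

Let F_lin x (Ux : U x) (h : V) (s : R^o) :
  'd F (x, k x) (h, s) = 'd F (x, k x) (h, 0) + s * 'D_(0, 1) F (x, k x).
Proof.
rewrite deriveE; last exact: Fd.
rewrite -[s * _]/(s *: _) -linearZ -raddfD; congr ('d F _ _).
apply: injective_projections; rewrite /= ?scaler0 ?addr0 ?add0r //.
by rewrite /GRing.scale /= mulr1.
Qed.

(** Since the derivative in the last variable is not 0, F changes sign across the
    root; by continuity the signs persist at nearby parameters and trap the
    root there. *)
Lemma root_signs x (e : R) : U x -> 0 < e ->
  exists2 t, 0 < t < e & F (x, k x + t) * F (x, k x - t) < 0.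
Proof.
move=> Ux e0; set d := 'D_(0, 1) F (x, k x).
have d0 : 0 < `|d| / 2 by rewrite divr_gt0 // normr_gt0 Fk'.
have Fdx : differentiable F (x, k x) by exact: Fd.
have /nbhs_normP[r /= r0 rF] := diff_eps Fdx d0.
pose t := Num.min (e / 2) (r / 2).
have t0 : 0 < t by rewrite lt_min !divr_gt0.
have te : t < e by rewrite gt_min; apply/orP; left; lra.
have tr : t < r by rewrite gt_min; apply/orP; right; lra.
exists t; first by rewrite t0.
have H (s : R) : `|s| < r -> `|F (x, k x + s) - s * d| <= `|d| / 2 * `|s|.
  move=> sr; have ns : `|((0 : V), (s : R^o))| = `|s|.
    by rewrite prod_normE /= normr0; apply/max_idPr.
  have := rF (0, s); rewrite /= sub0r normrN ns => /(_ sr).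
  rewrite (_ : (0, s) + (x, k x) = (x, k x + s)); last first.
    by apply: injective_projections; rewrite /= ?add0r // addrC.
  rewrite Fk0 // subr0 F_lin // (_ : (0, 0) = 0) // raddf0 add0r; exact.
have Hp := H t; have Hm := H (- t).
rewrite normrN (gtr0_norm t0) in Hp Hm.
have {Hp} := Hp tr; have {Hm} := Hm tr; rewrite !ler_norml.
set a := F _; set b := F _ => /andP[b1 b2] /andP[a1 a2].
have := Fk' Ux; rewrite -/d => dn0.
case: (ltgtP d 0) dn0 => // dd _.
  rewrite (ltr0_norm dd) in a1 a2 b1 b2.
  have td : t * d < 0 by rewrite pmulr_rlt0.
  rewrite nmulr_rlt0; nra.
rewrite (gtr0_norm dd) in a1 a2 b1 b2.
have td : 0 < t * d by rewrite pmulr_rgt0.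
rewrite pmulr_rlt0; nra.
Qed.

Let F_continuous x r : U x -> {for x, continuous (fun y => F (y, r))}.
Proof.
move=> Ux.
have c2 : {for (x, r), continuous F}.
  by apply: differentiable_continuous; apply: Fd.
have c1 : {for x, continuous (fun y : V => (y, r))} := @continuous_pairl _ _ _ _ _.
exact: (@continuous_comp _ _ _ (fun y : V => (y, r)) F x c1 c2).
Qed.

Lemma root_continuous x : U x -> {for x, continuous k}.
Proof.
move=> Ux; apply/cvgrPdist_lt => e e0.
have [t /andP[t0 te] Ft] := root_signs Ux e0.
have Uy : \forall y \near x, U y by exact: open_nbhs_nbhs.
have cF := @continuousM R V (fun y => F (y, k x + t)) (fun y => F (y, k x - t)) x
            (@F_continuous x _ Ux) (@F_continuous x _ Ux).
have Fy : \forall y \near x, F (y, k x + t) * F (y, k x - t) < 0.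
  exact: (@cvgr_lt _ _ _ _ _ _ cF _ Ft).
apply: filterS2 Uy Fy => y {}Uy {}Fy.
have ab : k x - t <= k x + t by lra.
have Fc : {within `[k x - t, k x + t], continuous (fun r : R => F (y, r) : R)}.
  apply: continuous_subspaceT => r.
  have c2 : {for (y, r : R^o), continuous F}.
    by apply: differentiable_continuous; apply: Fd.
  have c1 : {for (r : R^o), continuous (fun r : R^o => (y, r))} := @continuous_pairr _ _ _ _ _.
  exact: (@continuous_comp _ _ _ (fun r : R^o => (y, r)) F r c1 c2).
(* The zero of F (y, -) found between the two signs is k y by uniqueness. *)
have [|c] := IVT ab Fc (v := 0).
  by move: Fy; rewrite ge_min le_max; case: (ltP (F (y, k x - t)) 0) => A Fy;
    case: (ltP (F (y, k x + t)) 0) => B //=; rewrite ?(ltW A) ?(ltW B) ?A ?B ?orbT //; nra.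
rewrite in_itv /= => /andP[c1 c2] /Fk -/(_ Uy) <-.
by rewrite ltr_norml; lra.
Qed.

Let dk x : V -> R^o := fun h => - 'd F (x, k x) (h, 0) / 'D_(0, 1) F (x, k x).

Let dk_linear x : linear (dk x).
Proof.
move=> a h1 h2; rewrite /dk.
rewrite (_ : (a *: h1 + h2, 0) = a *: (h1, 0) + (h2, 0)); last first.
  by apply: injective_projections; rewrite /= ?scaler0 ?addr0.
rewrite linearP opprD mulrDl; congr (_ + _).
by rewrite /GRing.scale /= -mulrN mulrA.
Qed.

Let dkl x : {linear V -> R^o} :=
  HB.pack (dk x) (GRing.isLinear.Build _ _ _ _ _ (@dk_linear x)).

Let dk_continuous x : U x -> continuous (dkl x).
Proof.
move=> Ux h; apply: cvgM; last exact: cvg_cst.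
apply: cvgN.
have dc : continuous ('d F (x, k x)) by apply: diff_continuous; exact: Fd.
have c1 : {for h, continuous (fun y : V => (y, 0 : R^o))} := @continuous_pairl _ _ _ _ _.
exact: (@continuous_comp _ _ _ (fun y : V => (y, 0 : R^o)) ('d F (x, k x)) h c1 (dc _)).
Qed.

(** Write D for the increment of k along h and L for the candidate differential.
    Differentiability of F at the root gives |D - L h| <= eta (|h| + |D|), and a
    bound C for L turns this into |D| <= 2 (C + 1) |h|, after which eta is
    chosen to beat e. *)
Lemma root_is_diff x : U x -> is_diff x k (dkl x).
Proof.
move=> Ux; apply: is_diff_eps; first exact: dk_continuous.
move=> e e0.
have [C C0 dkC] := linear_lipschitz (dk_continuous Ux).
set d := 'D_(0, 1) F (x, k x).
have d0 : d != 0 := Fk' Ux.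
have C3 : 0 < 2 * C + 3 by lra.
pose eta := Num.min 2^-1 (e / (2 * C + 3)).
have eta0 : 0 < eta by rewrite lt_min invr_gt0 ltr0n divr_gt0.
have eta1 : eta <= 2^-1 by rewrite ge_min lexx.
have eta2 : eta * (2 * C + 3) <= e by rewrite -ler_pdivlMr // ge_min lexx orbT.
have ed0 : 0 < eta * `|d| by rewrite mulr_gt0 // normr_gt0.
have /nbhs_normP[r /= r0 rF] := diff_eps (Fd (z := (x, k x)) Ux) ed0.
have kc := root_continuous Ux.
have kh : \forall h \near (0 : V), `|k (h + x) - k x| < r.
  have : \forall y \near x, `|k x - k y| < r.
    by move/cvgrPdist_lt: kc => /(_ r r0).
  rewrite (near_shift 0 x) /=; apply: filterS => h.
  by rewrite subr0 distrC.
have Uh : \forall h \near (0 : V), U (h + x).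
  have : \forall y \near x, U y by exact: open_nbhs_nbhs.
  by rewrite (near_shift 0 x) /=; apply: filterS => h; rewrite subr0.
have hr : \forall h \near (0 : V), `|h| < r.
  by apply/nbhs_normP; exists r => //= h; rewrite /= sub0r normrN.
near=> h.
have khr : `|k (h + x) - k x| < r by near: h.
have Uhx : U (h + x) by near: h.
have hr' : `|h| < r by near: h.
set D := k (h + x) - k x in khr *.
have nmax : `|(h, D : R^o)| <= `|h| + `|D|.
  by rewrite prod_normE /= ge_max lerDl lerDr !normr_ge0.
have := rF (h, D); rewrite /= sub0r normrN.
rewrite prod_normE /= gt_max hr' khr => /(_ isT).
rewrite (_ : (h, D) + (x, k x) = (h + x, k (h + x))); last first.
  by apply: injective_projections; rewrite /= ?subrK.
rewrite !Fk0 // subr0 sub0r normrN F_lin // -/d.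
have -> : 'd F (x, k x) (h, 0) = - (dk x h * d).
  by rewrite /dk divfK // opprK.
rewrite addrC -mulrBl normrM => H.
have {H} H : `|D - dk x h| <= eta * (`|h| + `|D|).
  rewrite -(ler_pM2r (_ : 0 < `|d|)) ?normr_gt0 //.
  apply: le_trans H _; rewrite mulrAC ler_pM2r ?normr_gt0 //.
  by rewrite ler_pM2l // -[leLHS]prod_normE.
have {}dkC : `|dk x h| <= C * `|h| := dkC h.
have H2 : `|D| <= `|D - dk x h| + `|dk x h|.
  by rewrite -{1}(subrK (dk x h) D) ler_normD.
have h0 : 0 <= `|h| by exact: normr_ge0.
have D0 : 0 <= `|D| by exact: normr_ge0.
change (`|D - dk x h| <= e * `|h|).
have H3 : `|D| <= 2 * (C + 1) * `|h| by nra.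
apply: le_trans H _; apply: le_trans (_ : eta * (2 * C + 3) * `|h| <= _); nra.
Unshelve. all: by end_near. Qed.

(** The derivative of k is a rational expression in derivatives of F at (x, k x).
    So the class generated by k and the smooth functions is closed under
    differentiation. *)
Lemma root_smooth {Vf : findim V} : smooth_open U k.
Proof.
have kd x (Ux : U x) := is_diff_derive (root_is_diff Ux).
apply: (@smooth_class_smooth _ _ U [set g | g = k \/ smooth_open U g]) => //.
- move=> f [-> x Ux|fs x Ux]; first by case: (kd x Ux).
  exact: smooth_open_diff fs Ux.
- move=> f v [->|fs]; last by apply: sc_gen; right; exact: smooth_open_derive.
  have [I [e [l el]]] := findim_prod Vf (@findim_real R).
  have oUR : open [set z : V * R^o | U z.1] by exact: open_cylinder.
  have S w : smooth_class U [set g | g = k \/ smooth_open U g]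
               ((fun z => 'D_w F z) \o (fun x => (x, k x))).
    apply: (sc_comp el oUR) => //; first exact: smooth_open_derive.
    move=> i.
    have -> : l i \o (fun x => (x, k x)) = fun x => l i (x, 0) + k x * l i (0, 1).
      apply/funext => x /=; rewrite -[k x * _]/(k x *: _) -linearZ -raddfD.
      congr (l i _); apply: injective_projections; rewrite /= ?scaler0 ?addr0 ?add0r //.
      by rewrite /GRing.scale /= mulr1.
    apply: sc_add; last by apply: sc_mul; [apply: sc_gen; left|exact: sc_cst].
    apply: sc_gen; right.
    apply: (@smooth_linear _ _ _ oU _ _ (l i) (fun x => (x, 0))); first by case: el.
    apply: smooth_pair => //; [exact: smooth_id|exact: smooth_cst].
  apply: (sc_ext (sc_mul (sc_mul (sc_cst _ _ (-1)) (S (v, 0))) (sc_inv (S (0, 1)) Fk'))).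
  move=> x Ux; have [_ ->] := kd x Ux.
  by rewrite /= /dk mulN1r deriveE //; exact: Fd.
- by apply: sc_gen; left.
Qed.

End ImplicitRoot.

(** * Dot and cross products *)

Section Dot.
Variables (R : realType) (n : nat).
Implicit Types u v w : 'rV[R]_n.

Lemma dotC u v : dot u v = dot v u.
Proof. by apply: eq_bigr => i _; rewrite mulrC. Qed.

Lemma dotDl u v w : dot (u + v) w = dot u w + dot v w.
Proof. by rewrite -big_split; apply: eq_bigr => i _; rewrite mxE mulrDl. Qed.

Lemma dotDr u v w : dot u (v + w) = dot u v + dot u w.
Proof. by rewrite !(dotC u) dotDl. Qed.

Lemma dotZl (a : R) u v : dot (a *: u) v = a * dot u v.
Proof. by rewrite mulr_sumr; apply: eq_bigr => i _; rewrite mxE mulrA. Qed.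

Lemma dotZr (a : R) u v : dot u (a *: v) = a * dot u v.
Proof. by rewrite dotC dotZl dotC. Qed.

Lemma dotNl u v : dot (- u) v = - dot u v.
Proof. by rewrite -scaleN1r dotZl mulN1r. Qed.

Lemma dotNr u v : dot u (- v) = - dot u v.
Proof. by rewrite dotC dotNl dotC. Qed.

Lemma dot0l v : dot 0 v = 0.
Proof. by rewrite -(scale0r 0) dotZl mul0r. Qed.

Lemma dot0r v : dot v 0 = 0.
Proof. by rewrite dotC dot0l. Qed.

Lemma dot_ge0 u : 0 <= dot u u.
Proof. by apply: sumr_ge0 => i _; rewrite -expr2 sqr_ge0. Qed.

Lemma dot_eq0 u : dot u u = 0 -> u = 0.
Proof.
move=> H; apply/rowP => i; rewrite mxE.
have /(_ i isT) : forall i : 'I_n, xpredT i -> u 0 i * u 0 i = 0.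
  by apply: psumr_eq0P => // j _; rewrite -expr2 sqr_ge0.
by move/eqP; rewrite mulf_eq0 orbb => /eqP.
Qed.

Lemma dot_gt0 u : u != 0 -> 0 < dot u u.
Proof.
by move=> u0; rewrite lt_neqAle dot_ge0 andbT eq_sym; apply: contra_neq u0; exact: dot_eq0.
Qed.

Lemma dot_gt0E u : (0 < dot u u) = (u != 0).
Proof.
by apply/idP/idP; [apply: contraTneq => ->; rewrite dot0l ltxx|exact: dot_gt0].
Qed.

Definition dotE := (dotDl, dotDr, dotZl, dotZr, dotNl, dotNr, dot0l, dot0r).

Lemma unit_collinear (x y : 'rV[R]_n) : dot x x = 1 -> dot y y = 1 ->
  dot x y ^+ 2 = 1 -> y = x \/ y = - x.
Proof.
move=> xx yy /eqP; rewrite -(expr1n _ 2) eqf_sqr => /orP[] /eqP xy; [left|right]; apply/eqP.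
  rewrite -subr_eq0; apply/eqP/dot_eq0.
  by rewrite !dotDl !dotDr !dotNl !dotNr xx yy (dotC y) xy; ring.
rewrite -addr_eq0; apply/eqP/dot_eq0.
by rewrite !dotDl !dotDr xx yy (dotC y) xy; ring.
Qed.

Lemma smooth_dot (V : normedModType R) (U : set V) (f g : V -> 'rV[R]_n) :
  open U -> smooth_open U f -> smooth_open U g ->
  smooth_open U (fun x => dot (f x) (g x) : R^o).
Proof.
move=> oU fs gs; rewrite /dot.
elim: (index_enum _) => [|i s IH].
  by apply: (smooth_eq oU (smooth_cst oU 0)) => x _; rewrite big_nil.
have H := smoothM oU (smooth_entry oU 0 i fs) (smooth_entry oU 0 i gs).
apply: (smooth_eq oU (smoothD oU H IH)).
by move=> x _; rewrite big_cons.
Qed.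

End Dot.

Section R3.
Variable R : realType.
Implicit Types a b c d p v x y : 'rV[R]_3.

Definition vec3 (a b c : R) : 'rV[R]_3 := \row_(i < 3) nth 0 [:: a; b; c] i.

Lemma ord3P (P : 'I_3 -> Prop) : P 0 -> P 1 -> P 2 -> forall i, P i.
Proof.
move=> P0 P1 P2 [[|[|[|i]]] i3] //.
- by rewrite (_ : Ordinal i3 = 0) //; exact: val_inj.
- by rewrite (_ : Ordinal i3 = 1) //; exact: val_inj.
- by rewrite (_ : Ordinal i3 = 2) //; exact: val_inj.
Qed.

Lemma row3P x y : x 0 0 = y 0 0 -> x 0 1 = y 0 1 -> x 0 2 = y 0 2 -> x = y.
Proof. by move=> *; apply/rowP; exact: ord3P. Qed.

Lemma dot3 x y : dot x y = x 0 0 * y 0 0 + x 0 1 * y 0 1 + x 0 2 * y 0 2.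
Proof.
rewrite /dot !big_ord_recl big_ord0 addr0 addrA.
by congr (_ + x 0 _ * y 0 _ + x 0 _ * y 0 _); exact: val_inj.
Qed.

Lemma vec3E (a b c : R) :
  (vec3 a b c 0 0 = a) * (vec3 a b c 0 1 = b) * (vec3 a b c 0 2 = c).
Proof. by rewrite !mxE. Qed.

Definition cross a b : 'rV[R]_3 :=
  vec3 (a 0 1 * b 0 2 - a 0 2 * b 0 1) (a 0 2 * b 0 0 - a 0 0 * b 0 2)
       (a 0 0 * b 0 1 - a 0 1 * b 0 0).

Ltac r3 := apply: row3P; rewrite ?(mxE, vec3E, dot3) /=; rewrite ?(mxE, vec3E) /=; ring.
Ltac s3 := rewrite ?dot3 ?mxE /=; rewrite ?(mxE, vec3E) /=; ring.

Lemma crossC a b : cross a b = - cross b a. Proof. r3. Qed.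
Lemma crossDl a b c : cross (a + b) c = cross a c + cross b c. Proof. r3. Qed.
Lemma crossDr a b c : cross a (b + c) = cross a b + cross a c. Proof. r3. Qed.
Lemma crossZl (r : R) a b : cross (r *: a) b = r *: cross a b. Proof. r3. Qed.
Lemma crossZr (r : R) a b : cross a (r *: b) = r *: cross a b. Proof. r3. Qed.
Lemma crossNl a b : cross (- a) b = - cross a b. Proof. r3. Qed.
Lemma crossNr a b : cross a (- b) = - cross a b. Proof. r3. Qed.
Lemma cross0l a : cross 0 a = 0. Proof. r3. Qed.
Lemma cross0r a : cross a 0 = 0. Proof. r3. Qed.
Lemma crossvv a : cross a a = 0. Proof. r3. Qed.
Lemma cross_cross a b c : cross a (cross b c) = dot a c *: b - dot a b *: c.
Proof. r3. Qed.
Lemma crossl_cross a b c : cross (cross a b) c = dot a c *: b - dot b c *: a.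
Proof. r3. Qed.
Lemma dot_crossl a b : dot a (cross a b) = 0. Proof. s3. Qed.
Lemma dot_crossr a b : dot b (cross a b) = 0. Proof. s3. Qed.
Lemma dot_cross_cross a b c d :
  dot (cross a b) (cross c d) = dot a c * dot b d - dot a d * dot b c.
Proof. s3. Qed.

Definition crossE := (crossDl, crossDr, crossZl, crossZr, crossNl, crossNr, crossvv).

Lemma smooth_cross (V : normedModType R) (U : set V) (f g : V -> 'rV[R]_3) :
  open U -> smooth_open U f -> smooth_open U g ->
  smooth_open U (fun z => cross (f z) (g z)).
Proof.
move=> oU fs gs; have H i j : smooth_open U (fun z => f z 0 i * g z 0 j - f z 0 j * g z 0 i : R^o).
  by apply: (smoothB oU); apply: (smoothM oU); exact: smooth_entry.
apply: (smooth_mx oU) => i; rewrite (ord1 i); apply: ord3P.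
- by apply: (smooth_eq oU (H 1 2)) => z _; rewrite vec3E.
- by apply: (smooth_eq oU (H 2 0)) => z _; rewrite vec3E.
- by apply: (smooth_eq oU (H 0 1)) => z _; rewrite vec3E.
Qed.

End R3.

(** * Rules for directional derivatives *)

Section DeriveVec.
Variables (R : realType) (V : normedModType R).
Implicit Types (x v : V).

Lemma is_derive_mxP m n (M : V -> 'M[R]_(m, n)) x v (dM : 'M[R]_(m, n)) :
  is_derive x v M dM <->
  forall i j, is_derive x v (fun y => M y i j : R) (dM i j).
Proof.
split=> [[Md <-] i j|H].
  have Mij := (derivable_mxP M x v).1 Md.
  apply: DeriveDef; first exact: Mij.
  by rewrite derive_mx // mxE.
have Md : derivable M x v by apply/derivable_mxP => i j; case: (H i j).
apply: DeriveDef => //; rewrite derive_mx //; apply/matrixP => i j; rewrite mxE.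
by case: (H i j).
Qed.

Lemma is_derive_scale m n (a : V -> R) (f : V -> 'M[R]_(m, n)) x v da df :
  is_derive x v a da -> is_derive x v f df ->
  is_derive x v (fun y => a y *: f y) (da *: f x + a x *: df).
Proof.
move=> ad /is_derive_mxP fd; apply/is_derive_mxP => i j.
have -> : (fun y => (a y *: f y) i j) = a * (fun y => f y i j).
  by apply/funext => y; rewrite mxE.
have fij := fd i j; apply: is_derive_eq.
by rewrite !mxE addrC [f x i j *: _]mulrC.
Qed.

Lemma is_derive_add (W : normedModType R) (f g : V -> W) x v df dg :
  is_derive x v f df -> is_derive x v g dg ->
  is_derive x v (fun y => f y + g y) (df + dg).
Proof. by move=> fd gd; exact: is_deriveD. Qed.

Lemma is_derive_sub (W : normedModType R) (f g : V -> W) x v df dg :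
  is_derive x v f df -> is_derive x v g dg ->
  is_derive x v (fun y => f y - g y) (df - dg).
Proof. by move=> fd gd; exact: is_deriveB. Qed.

Lemma is_derive_mul (f g : V -> R) x v df dg :
  is_derive x v f df -> is_derive x v g dg ->
  is_derive x v (fun y => f y * g y) (df * g x + f x * dg).
Proof.
move=> fd gd; have := is_deriveM fd gd => H; apply: (is_derive_eq H).
by rewrite /GRing.scale /= addrC [g x * _]mulrC.
Qed.

Lemma is_derive_const (W : normedModType R) (a : W) x v :
  is_derive x v (fun=> a) 0.
Proof. exact: is_derive_cst. Qed.

Lemma is_derive_fun (W : normedModType R) (f g : V -> W) x v df dg :
  is_derive x v f df -> f =1 g -> df = dg -> is_derive x v g dg.
Proof. by move=> fd /funext <- <-. Qed.

Lemma is_derive_mulmx m n p (f : V -> 'M[R]_(m, n)) (g : V -> 'M[R]_(n, p)) x v df dg :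
  is_derive x v f df -> is_derive x v g dg ->
  is_derive x v (fun y => f y *m g y) (df *m g x + f x *m dg).
Proof.
move=> /is_derive_mxP fd /is_derive_mxP gd; apply/is_derive_mxP => i j.
have H k : is_derive x v (fun y => f y i k * g y k j)
    (df i k * g x k j + f x i k * dg k j) := is_derive_mul (fd i k) (gd k j).
have := is_derive_sum H => {}H.
apply: (is_derive_fun H).
  by move=> y; rewrite fct_sumE mxE.
by rewrite !mxE -big_split.
Qed.

Lemma is_derive_trmx m n (f : V -> 'M[R]_(m, n)) x v df :
  is_derive x v f df -> is_derive x v (fun y => (f y)^T) df^T.
Proof.
move=> /is_derive_mxP fd; apply/is_derive_mxP => i j.
by apply: (is_derive_fun (fd j i)) => [y|]; rewrite mxE.
Qed.

Lemma is_derive_dot n (f g : V -> 'rV[R]_n) x v df dg :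
  is_derive x v f df -> is_derive x v g dg ->
  is_derive x v (fun y => dot (f y) (g y)) (dot df (g x) + dot (f x) dg).
Proof.
move=> /is_derive_mxP fd /is_derive_mxP gd.
have H k : is_derive x v (fun y => f y 0 k * g y 0 k)
    (df 0 k * g x 0 k + f x 0 k * dg 0 k) := is_derive_mul (fd 0 k) (gd 0 k).
have := is_derive_sum H => {}H.
apply: (is_derive_fun H); last by rewrite -big_split.
by move=> y; rewrite fct_sumE.
Qed.

Lemma is_derive_cross (f g : V -> 'rV[R]_3) x v df dg :
  is_derive x v f df -> is_derive x v g dg ->
  is_derive x v (fun y => cross (f y) (g y)) (cross df (g x) + cross (f x) dg).
Proof.
move=> /is_derive_mxP fd /is_derive_mxP gd; apply/is_derive_mxP => i.
have H j k : is_derive x v (fun y => f y 0 j * g y 0 k - f y 0 k * g y 0 j)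
    (df 0 j * g x 0 k + f x 0 j * dg 0 k - (df 0 k * g x 0 j + f x 0 k * dg 0 j)).
  by apply: is_derive_sub; exact: is_derive_mul.
rewrite (ord1 i); apply: ord3P.
- apply: (is_derive_fun (H 1 2)) => [y|]; rewrite ?mxE /= ?vec3E //; ring.
- apply: (is_derive_fun (H 2 0)) => [y|]; rewrite ?mxE /= ?vec3E //; ring.
- apply: (is_derive_fun (H 0 1)) => [y|]; rewrite ?mxE /= ?vec3E //; ring.
Qed.

Lemma is_derive_chain (W W' : normedModType R) (f : V -> W) (g : W -> W') x v df :
  differentiable f x -> differentiable g (f x) -> 'D_v f x = df ->
  is_derive x v (fun y => g (f y)) ('D_df g (f x)).
Proof.
move=> fd gd <-; rewrite -derive_comp //; apply: derivableP.
by apply: diff_derivable; exact: differentiable_comp.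
Qed.

Lemma smooth_is_derive (W : normedModType R) (U : set V) (f : V -> W) x v :
  smooth_open U f -> U x -> is_derive x v f ('D_v f x).
Proof.
move=> fs Ux; apply: derivableP; apply: diff_derivable.
exact: smooth_open_diff fs Ux.
Qed.

Lemma smooth_mulmx (U : set V) m n p (f : V -> 'M[R]_(m, n)) (g : V -> 'M[R]_(n, p)) :
  open U -> smooth_open U f -> smooth_open U g ->
  smooth_open U (fun x => f x *m g x).
Proof.
move=> oU fs gs; apply: (smooth_mx oU) => i j.
apply: (@smooth_eq _ _ _ oU _ (fun x => dot (row i (f x)) (row j (g x)^T) : R^o)).
  apply: smooth_dot => //; apply: smooth_mx => // i' j'.
    by apply: (smooth_eq oU (smooth_entry oU i j' fs)) => x _; rewrite mxE.
  by apply: (smooth_eq oU (smooth_entry oU j' j gs)) => x _; rewrite !mxE.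
by move=> x _; rewrite /dot mxE; apply: eq_bigr => k _; rewrite !mxE.
Qed.

Lemma smooth_trmx (U : set V) m n (f : V -> 'M[R]_(m, n)) :
  open U -> smooth_open U f -> smooth_open U (fun x => (f x)^T).
Proof.
move=> oU fs; apply: (smooth_mx oU) => i j.
by apply: (smooth_eq oU (smooth_entry oU j i fs)) => x _; rewrite mxE.
Qed.

End DeriveVec.

Section DeriveCurve.
Variable R : realType.

Lemma is_derive1 (V : normedModType R) (f : R -> V) (t : R) df :
  is_derive t 1 f df -> derive1 f t = df.
Proof. by rewrite derive1E => -[_ ->]. Qed.

Lemma smooth_derive1 (V : normedModType R) (f : R -> V) (t : R) :
  smooth_open setT (f : R^o -> V) -> is_derive t 1 f (derive1 f t).
Proof.
move=> fs; rewrite derive1E; apply: derivableP; apply: diff_derivable.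
exact: (smooth_open_diff fs).
Qed.

Lemma is_derive_reparam (W : normedModType R) (f : R -> W) (g : R -> R) (t : R) df dg :
  is_derive (g t) 1 f df -> is_derive t 1 g dg ->
  is_derive t 1 (fun s => f (g s)) (dg *: df).
Proof.
move=> [fd <-] [gd gE].
have fdd : differentiable (f : R^o -> W) (g t) by apply/derivable1_diffP.
have gdd : differentiable (g : R^o -> R^o) t by apply/derivable1_diffP.
have H := @is_derive_chain R R^o R^o W g f t 1 dg gdd fdd gE.
apply: (is_derive_fun H) => //.
transitivity ('d (f : R^o -> W) (g t) (dg *: (1 : R^o))).
  by rewrite -[dg *: _]/(dg * 1) mulr1; exact: deriveE.
rewrite (deriveE _ fdd); exact: linearZ.
Qed.

Lemma is_derive_shift0 (W : normedModType R) (f : R -> W) (r : R) df :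
  is_derive r 1 f df -> is_derive (0 : R) 1 (fun t => f (t + r)) df.
Proof.
move=> fd; have sd : is_derive (0 : R) 1 (fun t : R => t + r) 1.
  by have := is_derive_add (is_derive_id (0 : R) 1) (is_derive_const (r : R) (0 : R) 1);
     rewrite addr0.
rewrite -[df]scale1r; apply: is_derive_reparam sd.
by rewrite add0r.
Qed.

Lemma sphere_velocity n (c : R -> 'rV[R]_n) (a t : R) :
  smooth_open setT (c : R^o -> _) -> (forall s, dot (c s) (c s) = a) ->
  dot (c t) (derive1 c t) = 0.
Proof.
move=> cs ca; have cd := smooth_derive1 t cs.
have [_] := is_derive_dot cd cd.
have -> : (fun s => dot (c s) (c s)) = fun=> a by apply/funext => s; exact: ca.
have [_ ->] := is_derive_const (a : R) t 1.
by rewrite (dotC (derive1 c t)); lra.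
Qed.

End DeriveCurve.

Section Arc.
Variable R : realType.

(** The sine of the angular radius of a circle of geodesic curvature r, that is,
    the factor normalising a centre of squared length 1 + r^2. *)
Definition rho (r : R) : R := (Num.sqrt (1 + r ^+ 2))^-1.

Lemma sq1_gt0 (r : R) : 0 < 1 + r ^+ 2.
Proof. by rewrite ltr_pwDl // sqr_ge0. Qed.

Lemma rho_gt0 r : 0 < rho r.
Proof. by rewrite invr_gt0 sqrtr_gt0 sq1_gt0. Qed.

Lemma rho_sq r : rho r ^+ 2 = (1 + r ^+ 2)^-1.
Proof. by rewrite exprVn sqr_sqrtr // ltW // sq1_gt0. Qed.

Lemma rho_sqM r : rho r ^+ 2 * (1 + r ^+ 2) = 1.
Proof. by rewrite rho_sq mulVf // gt_eqF // sq1_gt0. Qed.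

Lemma is_derive_rho (r : R) : is_derive r 1 (@rho) (- r * rho r ^+ 3).
Proof.
have d1 : is_derive r 1 (fun r : R => 1 + r * r) (0 + (1 * r + r * 1)).
  by apply: is_derive_add; apply: is_derive_mul.
have p1 : 0 < 1 + r * r by rewrite -expr2 sq1_gt0.
have d2 := @is_derive1_comp R _ (fun r => 1 + r * r) r _ _ (is_derive1_sqrt p1) d1.
have s1 : 0 < Num.sqrt (1 + r * r) by rewrite sqrtr_gt0.
have d3 := @is_deriveV R (Num.sqrt \o (fun r : R => 1 + r * r)) r _ 1 (lt0r_neq0 s1) d2.
apply: (is_derive_fun d3); first by move=> y; rewrite /rho expr2.
rewrite /rho expr2 /GRing.scale /=; field.
by rewrite gt_eqF.
Qed.

Lemma smooth_rho (V : normedModType R) (U : set V) (f : V -> R^o) : open U ->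
  smooth_open U f -> smooth_open U (fun x => rho (f x) : R^o).
Proof.
move=> oU fs.
have s1 : smooth_open U (fun x => 1 + f x ^+ 2 : R^o).
  by apply: smoothD => //; [exact: smooth_cst|exact: smoothM].
apply: smoothV => //; first by apply: smooth_sqrt => // x _; exact: sq1_gt0.
by move=> x _; rewrite gt_eqF // sqrtr_gt0 sq1_gt0.
Qed.

End Arc.

(** * Orthonormal frames and oriented circles *)

Section Frames.
Variable R : realType.
Implicit Types p v u m x y U : 'rV[R]_3.

Definition frame p v := [/\ dot p p = 1, dot v v = 1 & dot p v = 0].

Lemma cross_frame1 p v : frame p v -> cross v (cross p v) = p.
Proof. by move=> [pp vv pv]; rewrite cross_cross vv dotC pv scale1r scale0r subr0. Qed.

Lemma cross_frame2 p v : frame p v -> cross (cross p v) p = v.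
Proof. by move=> [pp vv pv]; rewrite crossl_cross pp (dotC v) pv scale1r scale0r subr0. Qed.

Lemma dot_cross_frame p v : frame p v -> dot (cross p v) (cross p v) = 1.
Proof. by move=> [pp vv pv]; rewrite dot_cross_cross pp vv pv (dotC v) pv mul0r subr0 mul1r. Qed.

Lemma frame_opp p v : frame p v -> frame p (- v).
Proof. by move=> [pp vv pv]; split; rewrite ?dotE ?vv ?pv ?opprK ?oppr0. Qed.

Lemma frame_sym p v : frame p v -> frame v p.
Proof. by move=> [pp vv pv]; split; rewrite // dotC. Qed.

Lemma frame_expand p v y : frame p v ->
  y = dot y p *: p + dot y v *: v + dot y (cross p v) *: cross p v.
Proof.
move=> F; have [pp vv pv] := F.
have := cross_cross (cross p v) y (cross p v).
rewrite dot_cross_frame // scale1r [cross y _]cross_cross crossDr crossNr !crossZr cross_frame2 //.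
rewrite [cross (cross p v) v]crossC cross_frame1 // scalerN opprK => E.
by rewrite [dot y p *: p + _]addrC E dotC subrK.
Qed.

(** The vector U with <U, U> = 1 + k^2 such that the circle <U, y> = k passes
    through p in the direction v. *)
Definition centre p v (k : R) : 'rV[R]_3 := k *: p + cross p v.

Lemma dot_centre p v k : frame p v -> dot (centre p v k) (centre p v k) = 1 + k ^+ 2.
Proof.
move=> F; have [pp vv pv] := F.
rewrite /centre !dotE (dotC (cross _ _) p) !dot_crossl pp dot_cross_frame //; ring.
Qed.

Lemma dot_centrep p v k : frame p v -> dot (centre p v k) p = k.
Proof.
move=> F; have [pp vv pv] := F.
by rewrite /centre !dotE pp (dotC (cross _ _) p) dot_crossl addr0 mulr1.
Qed.

Lemma dot_centrev p v k : frame p v -> dot (centre p v k) v = 0.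
Proof.
move=> F; have [pp vv pv] := F.
by rewrite /centre !dotE pv (dotC (cross _ _) v) dot_crossr addr0 mulr0.
Qed.

Lemma cross_centre p v k : frame p v -> cross (centre p v k) p = v.
Proof. by move=> F; rewrite /centre !crossE scaler0 add0r cross_frame2. Qed.

(** The velocity U x y of the positive rotation about U is a unit vector on the
    circle. *)
Lemma circle_frame U k y : dot U U = 1 + k ^+ 2 -> dot y y = 1 -> dot U y = k ->
  frame y (cross U y).
Proof.
move=> UU yy Uy; split=> //; last exact: dot_crossr.
rewrite dot_cross_cross UU yy Uy (dotC y) Uy; ring.
Qed.

Lemma circle_centre U k y : dot y y = 1 -> dot U y = k ->
  centre y (cross U y) k = U.
Proof. by move=> yy Uy; rewrite /centre cross_cross yy (dotC y) Uy scale1r addrC subrK. Qed.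

Lemma centre_opp p v k : centre p (- v) (- k) = - centre p v k.
Proof. by rewrite /centre crossE scaleNr opprD. Qed.

Definition unitv x : 'rV[R]_3 := (Num.sqrt (dot x x))^-1 *: x.

Lemma dot_unitv x : x != 0 -> dot (unitv x) (unitv x) = 1.
Proof.
move=> /dot_gt0 x0; rewrite /unitv !dotE mulrA -expr2 exprVn sqr_sqrtr ?ltW //.
by rewrite mulVf // gt_eqF.
Qed.

Lemma unitv_id x : dot x x = 1 -> unitv x = x.
Proof. by move=> xx; rewrite /unitv xx sqrtr1 invr1 scale1r. Qed.

Lemma unitvZ (a : R) x : 0 < a -> unitv (a *: x) = unitv x.
Proof.
move=> a0; rewrite /unitv !dotE scalerA mulrA -expr2 sqrtrM ?sqr_ge0 //.
rewrite sqrtr_sqr gtr0_norm // invfM mulrAC mulVf ?mul1r //.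
by rewrite gt_eqF.
Qed.

Lemma unitvN x : unitv (- x) = - unitv x.
Proof. by rewrite /unitv !dotE opprK scalerN. Qed.

Lemma smooth_unitv (V : normedModType R) (A : set V) (f : V -> 'rV[R]_3) :
  open A -> smooth_open A f -> (forall z, A z -> f z != 0) ->
  smooth_open A (fun z => unitv (f z)).
Proof.
move=> oA fs f0; apply: smoothZ => //.
have ds : smooth_open A (fun z => dot (f z) (f z) : R^o) by exact: smooth_dot.
have d0 z : A z -> 0 < dot (f z) (f z) by move=> Az; apply: dot_gt0; exact: f0.
apply: smoothV => //; first exact: smooth_sqrt.
by move=> z Az; rewrite gt_eqF // sqrtr_gt0 d0.
Qed.

Lemma dot_rho_unit U (r : R) : dot U U = 1 + r ^+ 2 -> dot (rho r *: U) (rho r *: U) = 1.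
Proof. by move=> UU; rewrite dotZl dotZr UU mulrA -expr2 rho_sqM. Qed.

Lemma frame_unitv p v : dot p p = 1 -> dot p v = 0 -> v != 0 -> frame p (unitv v).
Proof. by move=> pp pv v0; split; rewrite ?dot_unitv // /unitv dotE pv mulr0. Qed.

Lemma exists_frame u : dot u u = 1 -> exists m, frame u m.
Proof.
move=> uu; suff [y uy] : exists y, cross u y != 0.
  by exists (unitv (cross u y)); apply: frame_unitv => //; exact: dot_crossl.
apply: contrapT => /forallNP H.
have {}H y : cross u y = 0 by apply/eqP/negPn/negP; exact: H.
have := H (vec3 1 0 0); have := H (vec3 0 1 0).
move=> /rowP H1 /rowP H2.
have := H1 0; have := H1 2; have := H2 1; have := H2 2.
rewrite !mxE /= => A B C D.
by move: uu; rewrite dot3; nra.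
Qed.

(** The point of the open half great circle from - u to u through m whose slope
    is r, i.e. the cotangent of its distance to u. *)
Definition arcpos u m (r : R) : 'rV[R]_3 := rho r *: (r *: u + m).

Lemma frame_arcpos u m r : frame u m -> frame (arcpos u m r) (cross u m).
Proof.
move=> F; have [uu mm um] := F; split; last 2 first.
- exact: dot_cross_frame.
- by rewrite /arcpos !dotE dot_crossl dot_crossr mulr0 addr0 mulr0.
rewrite /arcpos !dotE uu mm um (dotC m) um; have := rho_sqM r.
by move: (rho r) => s E; rewrite -[RHS]E; ring.
Qed.

Lemma cross_arcpos u m r : frame u m ->
  cross (arcpos u m r) (cross u m) = rho r *: (u - r *: m).
Proof.
move=> F; rewrite /arcpos !crossE cross_frame1 //; congr (_ *: _).
by rewrite [cross u _]crossC cross_frame2 // scalerN addrC.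
Qed.

(** The circle of centre u and curvature r crosses the half great circle through
    m at slope r, in the direction u x m.  This turns the circles with a given
    centre into a one-parameter family of frames. *)
Lemma centre_arcpos u m r : frame u m ->
  rho r *: centre (arcpos u m r) (cross u m) r = u.
Proof.
move=> F; rewrite /centre cross_arcpos // /arcpos.
have := rho_sqM r; move: (rho r) => s E.
rewrite -[RHS]scale1r -E; apply: row3P; rewrite !mxE; ring.
Qed.

End Frames.

(** * Motion along a circle *)

Lemma exists_angle (R : realType) (a b : R) : a ^+ 2 + b ^+ 2 = 1 ->
  exists t, cos t = a /\ sin t = b.
Proof.
move=> ab; have a1 : -1 <= a <= 1 by nra.
have bE : Num.sqrt (1 - a ^+ 2) = `|b| by rewrite -ab addrC addKr sqrtr_sqr.
have ca : cos (acos a) = a by rewrite acosK // in_itv.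
have [b0|b0] := leP 0 b.
  by exists (acos a); rewrite ca sin_acos // bE ger0_norm.
exists (- acos a); rewrite cosN ca sinN sin_acos // bE ltr0_norm // opprK.
by [].
Qed.

Lemma is_derive_scal1 (R : realType) (w t : R) : is_derive t 1 (fun t => w * t) w.
Proof.
have H := is_derive_mul (is_derive_const (w : R) t 1) (is_derive_id t 1).
by apply: (is_derive_fun H) => //; ring.
Qed.

Section CircleMotion.
Variable R : realType.
Implicit Types p v u m x y : 'rV[R]_3.

(** Uniform motion on the circle of curvature k tangent to v at p; the parameter
    is the angle of rotation about the centre, and k rho^2 U is the
    Euclidean centre of the circle. *)
Definition circle_pos p v (k t : R) : 'rV[R]_3 :=
  (rho k ^+ 2 * k) *: centre p v k
  + (rho k ^+ 2 * cos t) *: (p - k *: cross p v) + (rho k * sin t) *: v.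

Definition circle_dir p v (k t : R) : 'rV[R]_3 :=
  cos t *: v - (rho k * sin t) *: (p - k *: cross p v).

(** The acceleration of the unit speed motion on the sphere with geodesic
    curvature k. *)
Definition bend p v (k : R) : 'rV[R]_3 := - p + k *: cross p v.

Section fixed.
Variables (p v : 'rV[R]_3) (k : R).
Hypothesis F : frame p v.

Let dots : [/\ dot p p = 1, dot v v = 1, dot p v = 0, dot v p = 0 &
  [/\ dot (cross p v) (cross p v) = 1, dot p (cross p v) = 0,
  dot v (cross p v) = 0, dot (cross p v) p = 0 & dot (cross p v) v = 0]].
Proof.
have [pp vv pv] := F; split=> //; first by rewrite dotC.
split; rewrite ?dot_cross_frame ?dot_crossl ?dot_crossr //.
  by rewrite dotC dot_crossl.
by rewrite dotC dot_crossr.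
Qed.

Lemma circle_pos_center t : dot (centre p v k) (circle_pos p v k t) = k.
Proof.
rewrite /circle_pos dotDr dotDr !dotZr dot_centre // dot_centrev //.
have [pp vv pv vp [nn pn vn np nv]] := dots.
rewrite /centre !dotE pp nn pn np.
have := rho_sqM k; move: (rho k ^+ 2) => s E.
transitivity (k * (s * (1 + k ^+ 2))); first ring.
by rewrite E mulr1.
Qed.

Lemma circle_pos_unit t : dot (circle_pos p v k t) (circle_pos p v k t) = 1.
Proof.
have [pp vv pv vp [nn pn vn np nv]] := dots.
rewrite {1}/circle_pos dotDl dotDl !dotZl circle_pos_center.
have -> : dot (p - k *: cross p v) (circle_pos p v k t) = cos t.
  rewrite /circle_pos /centre !dotE pp pv nn pn np nv.
  have := rho_sqM k; move: (rho k ^+ 2) => s E.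
  transitivity (cos t * (s * (1 + k ^+ 2))); first ring.
  by rewrite E mulr1.
have -> : dot v (circle_pos p v k t) = rho k * sin t.
  by rewrite /circle_pos /centre !dotE vv vp vn; ring.
have E := rho_sqM k; have C := cos2Dsin2 t.
transitivity (rho k ^+ 2 * k ^+ 2 + rho k ^+ 2 * (cos t ^+ 2 + sin t ^+ 2)); first ring.
by rewrite C -[RHS]E; ring.
Qed.

Lemma cross_circle_pos t : cross (centre p v k) (circle_pos p v k t) = circle_dir p v k t.
Proof.
rewrite /circle_pos !crossDr !crossZr crossvv scaler0 add0r.
have -> : cross (centre p v k) (p - k *: cross p v) = (1 + k ^+ 2) *: v.
  rewrite crossDr cross_centre // crossNr crossZr /centre !crossE.
  rewrite [cross p _]cross_cross; have [pp _ pv] := F; rewrite pp pv.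
  apply: row3P; rewrite !mxE; ring.
have -> : cross (centre p v k) v = - (p - k *: cross p v).
  rewrite /centre !crossE [cross (cross _ _) v]crossC cross_frame1 //.
  by rewrite opprB.
rewrite scalerA scalerN /circle_dir; congr (_ *: _ - _).
by rewrite mulrAC rho_sqM mul1r.
Qed.

Lemma circle_pos_frame t : frame (circle_pos p v k t) (circle_dir p v k t).
Proof.
rewrite -cross_circle_pos; apply: circle_frame; first exact: dot_centre.
  exact: circle_pos_unit.
exact: circle_pos_center.
Qed.

Lemma circle_pos_centre t :
  centre (circle_pos p v k t) (circle_dir p v k t) k = centre p v k.
Proof.
by rewrite -cross_circle_pos circle_centre ?circle_pos_unit ?circle_pos_center.
Qed.

Lemma circle_pos0 : circle_pos p v k 0 = p.
Proof.
rewrite /circle_pos cos0 sin0 mulr0 scale0r addr0 mulr1 /centre.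
have := rho_sqM k; move: (rho k ^+ 2) => s E.
rewrite -[RHS]scale1r -E; apply: row3P; rewrite !mxE /=; ring.
Qed.

Lemma circle_dir0 : circle_dir p v k 0 = v.
Proof. by rewrite /circle_dir cos0 sin0 mulr0 scale0r subr0 scale1r. Qed.

Lemma is_derive_circle_pos (w t : R) :
  is_derive t 1 (fun t => circle_pos p v k (w * t))
    ((w * rho k) *: circle_dir p v k (w * t)).
Proof.
have dl := is_derive_scal1 w t.
have dc := is_derive1_comp (is_derive_cos (w * t)) dl.
have ds := is_derive1_comp (is_derive_sin (w * t)) dl.
have H1 : is_derive t 1 (fun t => rho k ^+ 2 * cos (w * t))
    (0 * cos (w * t) + rho k ^+ 2 * (- sin (w * t) * w)).
  by apply: is_derive_mul; exact: dc.
have H2 : is_derive t 1 (fun t => rho k * sin (w * t))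
    (0 * sin (w * t) + rho k * (cos (w * t) * w)).
  by apply: is_derive_mul; exact: ds.
have H3 := is_derive_scale H1 (is_derive_const (p - k *: cross p v) t 1).
have H4 := is_derive_scale H2 (is_derive_const v t 1).
have H5 := is_derive_add (is_derive_const ((rho k ^+ 2 * k) *: centre p v k) t 1) H3.
apply: (is_derive_fun (is_derive_add H5 H4)); first by [].
rewrite /circle_dir; apply: row3P; rewrite !mxE /=; ring.
Qed.

Lemma is_derive_circle_dir (w t : R) :
  is_derive t 1 (fun t => circle_dir p v k (w * t))
    ((w * rho k) *: bend (circle_pos p v k (w * t)) (circle_dir p v k (w * t)) k).
Proof.
have dl := is_derive_scal1 w t.
have dc := is_derive1_comp (is_derive_cos (w * t)) dl.
have ds := is_derive1_comp (is_derive_sin (w * t)) dl.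
have H2 : is_derive t 1 (fun t => rho k * sin (w * t))
    (0 * sin (w * t) + rho k * (cos (w * t) * w)).
  by apply: is_derive_mul; exact: ds.
have H3 := is_derive_scale H2 (is_derive_const (p - k *: cross p v) t 1).
have H4 := is_derive_scale dc (is_derive_const v t 1).
apply: (is_derive_fun (is_derive_sub H4 H3)); first by [].
(* The acceleration points to the axis: it is k U - (1 + k^2) y. *)
have -> : bend (circle_pos p v k (w * t)) (circle_dir p v k (w * t)) k =
  k *: centre p v k - (1 + k ^+ 2) *: circle_pos p v k (w * t).
  rewrite -(circle_pos_centre (w * t)) /bend /centre.
  apply: row3P; rewrite !mxE /=; ring.
rewrite /circle_pos.
have E := rho_sqM k; have E0 := rho_gt0 k.
have E' : 1 + k ^+ 2 = (rho k)^-1 ^+ 2 by rewrite exprVn rho_sq invrK.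
rewrite E' in E *; move: (rho k) E E0 => s E E0.
apply: row3P; rewrite !mxE /=; field; lra.
Qed.

Lemma smooth_circle_motion (w : R) :
  smooth_open setT (fun t : R^o => circle_pos p v k (w * t)) /\
  smooth_open setT (fun t : R^o => circle_dir p v k (w * t)).
Proof.
have oT : open (setT : set R^o) by exact: openT.
have sl : smooth_open setT (fun t : R^o => w * t : R^o).
  by apply: smoothM => //; [exact: smooth_cst|exact: smooth_id].
have sc := smooth_cos oT sl; have ss := smooth_sin oT sl.
split.
  by apply: smoothD => //; [apply: smoothD => //; [exact: smooth_cst|]|];
    apply: smoothZ => //; try exact: smooth_cst; apply: smoothM => //; exact: smooth_cst.
by apply: smoothB => //; apply: smoothZ => //; try exact: smooth_cst;
  apply: smoothM => //; exact: smooth_cst.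
Qed.

Lemma circle_pos_neq : circle_pos p v k (pi / 2) <> p.
Proof.
move=> E; have [pp vv pv vp _] := dots.
have := dot_centrev k F; have := congr1 (fun x => dot x v) E; rewrite /circle_pos pv.
rewrite cos_pihalf sin_pihalf mulr0 scale0r addr0 mulr1.
move: (centre p v k) => z + zv; rewrite dotDl !dotZl zv vv mulr0 add0r mulr1.
by apply/eqP; rewrite gt_eqF // rho_gt0.
Qed.

Lemma circle_pos_surj y : dot y y = 1 -> dot (centre p v k) y = k ->
  exists t, y = circle_pos p v k t.
Proof.
move=> yy Uy.
have rk := rho_gt0 k.
have E := rho_sqM k.
have [pp vv pv vp [nn pn vn np nv]] := dots.
have yE := frame_expand y F.
move: yy Uy; rewrite yE.
set a := dot y p; set b := dot y v; set c := dot y (cross p v).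
rewrite /centre !dotE pp vv pv vp nn pn vn np nv => yy Uy.
have cE : c = k - k * a by lra.
have AB : (a - k * c) ^+ 2 + ((rho k)^-1 * b) ^+ 2 = 1.
  by rewrite exprMn exprVn rho_sq invrK; rewrite cE in yy *; nra.
have [t [ct st]] := exists_angle AB.
exists t; rewrite /circle_pos ct st mulrA divff ?gt_eqF // mul1r /centre cE.
move: E; move: (rho k ^+ 2) => s E.
transitivity ((s * (1 + k ^+ 2)) *: (a *: p + (k - k * a) *: cross p v) + b *: v).
  by rewrite E scale1r addrAC.
apply: row3P; rewrite !mxE /=; ring.
Qed.

End fixed.
End CircleMotion.

(** * Contact elements of the two-sphere *)

Section Imag.
Variable R : realType.
Implicit Types p v u m x y : 'rV[R]_3.
Implicit Types q : 'rV[R]_4.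

Definition im x : 'rV[R]_4 := quat 0 (x 0 0) (x 0 1) (x 0 2).
Definition imp q : 'rV[R]_3 := vec3 (q 0 1) (q 0 2) (q 0 3).

Lemma ord4P (P : 'I_4 -> Prop) : P 0 -> P 1 -> P 2 -> P 3 -> forall i, P i.
Proof.
move=> P0 P1 P2 P3 [[|[|[|[|i]]]] i4] //.
- by rewrite (_ : Ordinal i4 = 0) //; exact: val_inj.
- by rewrite (_ : Ordinal i4 = 1) //; exact: val_inj.
- by rewrite (_ : Ordinal i4 = 2) //; exact: val_inj.
- by rewrite (_ : Ordinal i4 = 3) //; exact: val_inj.
Qed.

Lemma row4P (x y : 'rV[R]_4) : x 0 0 = y 0 0 -> x 0 1 = y 0 1 -> x 0 2 = y 0 2 ->
  x 0 3 = y 0 3 -> x = y.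
Proof. by move=> *; apply/rowP; exact: ord4P. Qed.

Lemma dot4 (x y : 'rV[R]_4) : dot x y =
  x 0 0 * y 0 0 + x 0 1 * y 0 1 + x 0 2 * y 0 2 + x 0 3 * y 0 3.
Proof.
rewrite /dot !big_ord_recl big_ord0 addr0 !addrA.
by congr (_ + x 0 _ * y 0 _ + x 0 _ * y 0 _ + x 0 _ * y 0 _); exact: val_inj.
Qed.

Lemma quatE (a b c d : R) : (quat a b c d 0 0 = a) * (quat a b c d 0 1 = b) *
  (quat a b c d 0 2 = c) * (quat a b c d 0 3 = d).
Proof. by rewrite !mxE. Qed.

Lemma imK : cancel im imp.
Proof. by move=> x; apply: row3P; rewrite /imp /im !mxE. Qed.

Lemma impK q : q 0 0 = 0 -> im (imp q) = q.
Proof. by move=> q0; apply: row4P; rewrite /imp /im !mxE. Qed.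

Lemma im_inj : injective im. Proof. exact: can_inj imK. Qed.

Lemma dot_im x y : dot (im x) (im y) = dot x y.
Proof. by rewrite dot4 dot3 /im !quatE mul0r add0r. Qed.

Lemma imZ (a : R) x : im (a *: x) = a *: im x.
Proof. by apply: row4P; rewrite /im !mxE /= ?mulr0. Qed.

Lemma imN x : im (- x) = - im x.
Proof. by rewrite -scaleN1r imZ scaleN1r. Qed.

Lemma im0 : im 0 = 0.
Proof. by rewrite -(scale0r 0) imZ scale0r. Qed.

Lemma im00 x : im x 0 0 = 0. Proof. by rewrite quatE. Qed.

Lemma S2_im x : S2 (im x) <-> dot x x = 1.
Proof. by rewrite /S2 /= dot_im im00; split=> [[]|]. Qed.

Lemma S2P q : S2 q <-> exists2 x, q = im x & dot x x = 1.
Proof.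
split=> [Sq|[x -> /S2_im//]]; have [qq q0] := Sq.
by exists (imp q); rewrite ?impK //; apply/S2_im; rewrite impK.
Qed.

Lemma smooth_im (V : normedModType R) (A : set V) (f : V -> 'rV[R]_3) :
  open A -> smooth_open A f -> smooth_open A (fun z => im (f z)).
Proof.
move=> oA fs; apply: smooth_mx => // i; rewrite (ord1 i); apply: ord4P.
- by apply: (smooth_eq oA (smooth_cst oA (0 : R^o))) => z _; rewrite quatE.
- by apply: (smooth_eq oA (smooth_entry oA 0 0 fs)) => z _; rewrite quatE.
- by apply: (smooth_eq oA (smooth_entry oA 0 1 fs)) => z _; rewrite quatE.
- by apply: (smooth_eq oA (smooth_entry oA 0 2 fs)) => z _; rewrite quatE.
Qed.

Lemma smooth_imp (V : normedModType R) (A : set V) (f : V -> 'rV[R]_4) :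
  open A -> smooth_open A f -> smooth_open A (fun z => imp (f z)).
Proof.
move=> oA fs; apply: smooth_mx => // i; rewrite (ord1 i); apply: ord3P.
- by apply: (smooth_eq oA (smooth_entry oA 0 1 fs)) => z _; rewrite vec3E.
- by apply: (smooth_eq oA (smooth_entry oA 0 2 fs)) => z _; rewrite vec3E.
- by apply: (smooth_eq oA (smooth_entry oA 0 3 fs)) => z _; rewrite vec3E.
Qed.

Lemma is_derive_im (V : normedModType R) (f : V -> 'rV[R]_3) (z w : V) df :
  is_derive z w f df -> is_derive z w (fun s => im (f s)) (im df).
Proof.
move=> /is_derive_mxP fd; apply/is_derive_mxP => i; rewrite (ord1 i); apply: ord4P.
- by apply: (is_derive_fun (is_derive_const (0 : R) z w)) => [y|]; rewrite quatE.
- by apply: (is_derive_fun (fd 0 0)) => [y|]; rewrite quatE.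
- by apply: (is_derive_fun (fd 0 1)) => [y|]; rewrite quatE.
- by apply: (is_derive_fun (fd 0 2)) => [y|]; rewrite quatE.
Qed.

Lemma is_derive_imp (V : normedModType R) (f : V -> 'rV[R]_4) (z w : V) df :
  is_derive z w f df -> is_derive z w (fun s => imp (f s)) (imp df).
Proof.
move=> /is_derive_mxP fd; apply/is_derive_mxP => i; rewrite (ord1 i); apply: ord3P.
- by apply: (is_derive_fun (fd 0 1)) => [y|]; rewrite vec3E.
- by apply: (is_derive_fun (fd 0 2)) => [y|]; rewrite vec3E.
- by apply: (is_derive_fun (fd 0 3)) => [y|]; rewrite vec3E.
Qed.

Lemma is_derive_pair (V W W' : normedModType R) (f : V -> W) (g : V -> W') (z w : V) df dg :
  differentiable f z -> differentiable g z ->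
  is_derive z w f df -> is_derive z w g dg ->
  is_derive z w (fun s => (f s, g s)) (df, dg).
Proof.
move=> fd gd [_ <-] [_ <-]; apply: DeriveDef.
  by apply: diff_derivable; exact: differentiable_pair.
rewrite !deriveE //; last exact: differentiable_pair.
by rewrite diff_pair.
Qed.

Lemma is_derive_fst (V W W' : normedModType R) (f : V -> W * W') (z w : V) df :
  differentiable f z -> is_derive z w f df -> is_derive z w (fun s => (f s).1) df.1.
Proof.
move=> fd [_ <-]; have lc : continuous (fst : W * W' -> W) by move=> x; exact: cvg_fst.
apply: DeriveDef; last exact: (derive_linear (l := fst)).
apply: diff_derivable; apply: (@differentiable_comp _ _ _ _ f fst) => //.
exact: (linear_differentiable (f := fst)).
Qed.

End Imag.

Section ContactElements.
Variable R : realType.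
Implicit Types p v u m x y : 'rV[R]_3.

(** Points and directions are computed in R^3 and transported to imaginary
    quaternions; [dcelem] is the derivative of [celem] for the velocities dp
    and dv. *)
Definition line v : 'M[R]_4 := (im v)^T *m im v.
Definition celem p v : 'rV[R]_4 * 'M[R]_4 := (im p, line v).
Definition dcelem (p v dp dv : 'rV[R]_3) : 'rV[R]_4 * 'M[R]_4 :=
  (im dp, (im dv)^T *m im v + (im v)^T *m im dv).

Lemma trmx_mulNN n (a b : 'rV[R]_n) : (- a)^T *m (- b) = a^T *m b.
Proof.
apply/matrixP => i j; rewrite [LHS]mxE [RHS]mxE.
by apply: eq_bigr => l _; rewrite ![in LHS]mxE ![in RHS]mxE; ring.
Qed.

Lemma lineN v : line (- v) = line v.
Proof. by rewrite /line imN trmx_mulNN. Qed.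

Lemma dot_mulmx n (a b : 'rV[R]_n) : a *m b^T = (dot a b)%:M.
Proof.
apply/matrixP => i j; rewrite !ord1 !mxE eqxx mulr1n.
by apply: eq_bigr => k _; rewrite mxE.
Qed.

Lemma mulmx_line w v : im w *m line v = im (dot w v *: v).
Proof. by rewrite /line mulmxA dot_mulmx mul_scalar_mx dot_im imZ. Qed.

Lemma line_inj v v' : dot v v = 1 -> dot v' v' = 1 -> line v = line v' ->
  v' = v \/ v' = - v.
Proof.
move=> vv vv' E; apply: unit_collinear => //.
have H : dot v' v *: v = v' by apply: im_inj; rewrite -mulmx_line E mulmx_line vv' scale1r.
by move: vv'; rewrite -{1}H dotZl (dotC v' v) -expr2.
Qed.

Lemma celem_inj p v p' v' : frame p v -> frame p' v' -> celem p v = celem p' v' ->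
  p' = p /\ (v' = v \/ v' = - v).
Proof.
move=> [_ vv _] [_ vv' _] [/im_inj -> lE]; split=> //.
exact: line_inj.
Qed.

Lemma tangent_S2 p w : tangent_space (@S2 R) (im p) w ->
  exists2 v, w = im v & dot p v = 0.
Proof.
move=> [c [[cs cS] c0 <-]].
have w0 : derive1 c 0 0 0 = 0.
  have [_ <-] := (is_derive_mxP _ _ _ _).1 (smooth_derive1 0 cs) 0 0.
  have [_ <-] := is_derive_const (0 : R) (0 : R) 1.
  have -> // : (fun t : R => c t 0 0) = fun=> 0.
  by apply/funext => t; case: (cS t).
exists (imp (derive1 c 0)); first by rewrite impK.
have cc s : dot (c s) (c s) = 1 by case: (cS s).
by rewrite -dot_im impK // -c0; exact: sphere_velocity cs cc.
Qed.

Lemma rho0 : rho 0 = 1 :> R.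
Proof. by rewrite /rho expr0n addr0 sqrtr1 invr1. Qed.

Lemma frame_tangent p v : frame p v -> tangent_space (@S2 R) (im p) (im v).
Proof.
move=> F; exists (fun t => im (circle_pos p v 0 (1 * t))); split.
- split; last by move=> t; apply/S2_im; exact: circle_pos_unit.
  by apply: smooth_im; [exact: openT|case: (smooth_circle_motion p v 0 1)].
- by rewrite mulr0 circle_pos0.
- apply: is_derive1; have := is_derive_im (is_derive_circle_pos p v 0 1 0).
  by rewrite mul1r mulr0 circle_dir0 rho0 scale1r.
Qed.

(** Contact elements are frames (p, v) up to the sign of v, the sign being the
    orientation of the tangent line. *)
Lemma contact_elementsP e : contact_elements (@S2 R) e <->
  exists p v, frame p v /\ e = celem p v.
Proof.
split.
  move=> [/S2P[p pE pp] [w [tw ww eE]]].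
  move: tw; rewrite pE => /tangent_S2[v vE pv].
  exists p, v; rewrite vE dot_im in ww; split=> //.
  by rewrite (surjective_pairing e) pE eE vE.
move=> [p [v [F ->]]]; have [pp vv pv] := F; split; first exact/S2_im.
by exists (im v); rewrite dot_im; split=> //; exact: frame_tangent.
Qed.

Lemma contact_celem p v : frame p v -> contact_elements (@S2 R) (celem p v).
Proof. by move=> F; apply/contact_elementsP; exists p, v. Qed.

Lemma smooth_celem (V : normedModType R) (A : set V) (f g : V -> 'rV[R]_3) :
  open A -> smooth_open A f -> smooth_open A g ->
  smooth_open A (fun z => celem (f z) (g z)).
Proof.
move=> oA fs gs; apply: smooth_pair => //; first exact: smooth_im.
by apply: smooth_mulmx => //; [apply: smooth_trmx => //|]; exact: smooth_im.
Qed.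

Lemma is_derive_line (V : normedModType R) (g : V -> 'rV[R]_3) (z w : V) dg :
  is_derive z w g dg ->
  is_derive z w (fun s => line (g s)) ((im dg)^T *m im (g z) + (im (g z))^T *m im dg).
Proof.
move=> gd; have H := is_derive_im gd.
exact: (is_derive_mulmx (is_derive_trmx H) H).
Qed.

Lemma is_derive_celem (A : set R^o) (f g : R -> 'rV[R]_3) (t : R) df dg :
  open A -> A t -> smooth_open A (f : R^o -> 'rV[R]_3) ->
  smooth_open A (g : R^o -> 'rV[R]_3) ->
  is_derive t 1 f df -> is_derive t 1 g dg ->
  is_derive t 1 (fun t => celem (f t) (g t)) (dcelem (f t) (g t) df dg).
Proof.
move=> oA At fs gs fd gd; apply: is_derive_pair.
- exact: smooth_open_diff (smooth_im oA fs) At.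
- have H := smooth_im oA gs.
  exact: smooth_open_diff (smooth_mulmx oA (smooth_trmx oA H) H) At.
- exact: is_derive_im.
- exact: is_derive_line.
Qed.

End ContactElements.

(** * Families of circles indexed by frames *)

Section ArcDerivative.
Variable R : realType.
Implicit Types p v u m x y : 'rV[R]_3.

Lemma is_derive_arcpos u m (r : R) : frame u m ->
  is_derive r 1 (arcpos u m) (rho r ^+ 2 *: cross (arcpos u m r) (cross u m)).
Proof.
move=> F; rewrite cross_arcpos //.
have H1 := is_derive_scale (is_derive_id r 1) (is_derive_const u r 1).
have H2 := is_derive_add H1 (is_derive_const m r 1).
have H := is_derive_scale (is_derive_rho r) H2.
apply: (is_derive_fun H); first by [].
have := rho_sqM r; move: (rho r) => s E.
transitivity (- r * s ^+ 3 *: (r *: u + m) + (s * (s ^+ 2 * (1 + r ^+ 2))) *: u).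
  by rewrite E scaler0 !addr0 mulr1 scale1r.
apply: row3P; rewrite !mxE /=; ring.
Qed.

Lemma smooth_arcpos (V : normedModType R) (A : set V) (f g : V -> 'rV[R]_3) (h : V -> R^o) :
  open A -> smooth_open A f -> smooth_open A g -> smooth_open A h ->
  smooth_open A (fun z => arcpos (f z) (g z) (h z)).
Proof.
move=> oA fs gs hs; apply: smoothZ => //; first exact: smooth_rho.
by apply: smoothD => //; exact: smoothZ.
Qed.

Lemma arcpos_unitv u m r : frame u m -> arcpos u m r = unitv (r *: u + m).
Proof.
move=> [uu mm um]; rewrite /unitv /arcpos /rho !dotE uu mm um (dotC m) um.
by congr ((Num.sqrt _)^-1 *: _); ring.
Qed.

Lemma cauchy_schwarz n (x y : 'rV[R]_n) : dot x y ^+ 2 <= dot x x * dot y y.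
Proof.
have [->|/dot_gt0 y0] := eqVneq y 0; first by rewrite !dotE mulr0 expr0n.
have := dot_ge0 (dot y y *: x - dot x y *: y).
rewrite !dotE (dotC y x) => H.
have : 0 <= dot y y * (dot x x * dot y y - dot x y ^+ 2).
  by rewrite (le_trans H) // le_eqVlt; apply/orP; left; apply/eqP; ring.
by rewrite pmulr_rge0 // subr_ge0.
Qed.

Lemma derive_sq_le (f : R -> 'rV[R]_3) (g : R -> R) (t : R) df dg :
  is_derive t 1 f df -> is_derive t 1 g dg ->
  (forall s, (g s - g t) ^+ 2 <= dot (f s - f t) (f s - f t)) ->
  dg ^+ 2 <= dot df df.
Proof.
move=> /is_derive_mxP fd gd H; rewrite leNgt; apply/negP => lt.
have q (h : R -> R) dh : is_derive t 1 h dh ->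
  (s^-1 * (h (s + t) - h t)) @[s --> (0 : R)^'] --> dh.
  move=> [hd <-]; apply: cvg_trans hd; apply: near_eq_cvg; near=> s.
  by rewrite /GRing.scale /= mulr1.
have := q _ _ gd; have := q _ _ (fd 0 0); have := q _ _ (fd 0 1); have := q _ _ (fd 0 2).
set q2 := fun s => s^-1 * _; set q1 := fun s => s^-1 * _; set q0 := fun s => s^-1 * _.
set qg := fun s => s^-1 * _ => c2 c1 c0 cg.
have C := cvgB (cvgD (cvgD (cvgM c0 c0) (cvgM c1 c1)) (cvgM c2 c2)) (cvgM cg cg).
have : \forall s \near (0 : R)^',
    (q0 s * q0 s + q1 s * q1 s + q2 s * q2 s - qg s * qg s) < 0.
  apply: (cvgr_lt _ (C _ _ _ _ _ _ _)).
  by rewrite -dot3 subr_lt0 -expr2.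
move/filter_ex => [s].
have := H (s + t); rewrite dot3 !mxE expr2.
rewrite /q0 /q1 /q2 /qg.
set a := g _ - _; set b := f _ 0 0 - _; set c := f _ 0 1 - _; set d := f _ 0 2 - _.
move=> le; apply/negP; rewrite -leNgt.
have -> // : forall z : R, z = s^-1 ^+ 2 * (b * b + c * c + d * d - a * a) -> 0 <= z.
  by move=> _ ->; rewrite mulr_ge0 ?sqr_ge0 // subr_ge0.
by ring.
Unshelve. all: by end_near. Qed.

End ArcDerivative.

Section Root.
Variable R : realType.
Implicit Types p v u m x y g : 'rV[R]_3.

(** Let s run from -1 to 1 along the arc s u + (1 - s^2) m, whose ends are - u
    and u.  The function s - (1 - s^2) H takes the values -1 and 1 there, and
    at a zero the slope r = s / (1 - s^2) solves the equation. *)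
Lemma exists_slope (H : 'rV[R]_3 -> R) u m : frame u m ->
  (forall (a : R) x, 0 < a -> H (a *: x) = H x) ->
  (forall b : R^o -> 'rV[R]_3, smooth_open setT b ->
     (forall s, exists r t, b s = r *: u + t *: m) -> (forall s, b s != 0) ->
     smooth_open setT (fun s => H (b s) : R^o)) ->
  exists r, H (r *: u + m) = r.
Proof.
move=> [uu mm um] HZ HS.
pose b (s : R) := s *: u + (1 - s * s) *: m.
have b0 s : b s != 0.
  apply/eqP => bs; have : dot (b s) u = 0 by rewrite bs dot0l.
  have : dot (b s) m = 0 by rewrite bs dot0l.
  rewrite /b !dotE uu um (dotC m) um mm; nra.
have oT : open (setT : set R^o) by exact: openT.
have si := @smooth_id _ R^o _ oT.
have s2 : smooth_open (setT : set R^o) (fun s : R^o => 1 - s * s : R^o).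
  by apply: smoothB => //; [exact: smooth_cst|exact: smoothM].
have bs : smooth_open (setT : set R^o) b.
  by apply: smoothD => //; apply: smoothZ => //; exact: smooth_cst.
pose G (s : R) : R := s - (1 - s * s) * H (b s).
have Gs : smooth_open (setT : set R^o) (G : R^o -> R^o).
  apply: smoothB => //; apply: smoothM => //.
  by apply: HS => // s; exists s, (1 - s * s).
have Gc : {within `[-1, 1], continuous G}.
  apply: continuous_subspaceT => t; apply: differentiable_continuous.
  exact: smooth_open_diff Gs _.
have le11 : -1 <= 1 :> R by lra.
(* The ends of the arc have infinite slope; a zero of G is not one of them. *)
have [|s] := IVT le11 Gc (v := 0).
  by rewrite /G mulrNN mulr1 subrr !mul0r !subr0 ge_min le_max lerN10 ler01 orbT.
rewrite in_itv /= => /andP[s1 s2'] /eqP; rewrite /G subr_eq0 => /eqP sE.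
have s3 : 1 - s * s != 0.
  by apply/eqP => s0; move: sE; rewrite s0 mul0r => s00; rewrite s00 in s0; lra.
have s4 : 0 < 1 - s * s by rewrite lt_neqAle eq_sym s3 /=; nra.
exists (s / (1 - s * s)).
have -> : H (s / (1 - s * s) *: u + m) = H (b s).
  rewrite -(HZ (1 - s * s)) //; congr H.
  by rewrite scalerDr scalerA mulrC divfK.
by apply: (mulIf s3); rewrite divfK // mulrC -sE.
Qed.

End Root.

Section Sphere.
Variable R : realType.
Implicit Types p v u m x y g : 'rV[R]_3.

Lemma sqrt2_gt0 : 0 < Num.sqrt 2 :> R. Proof. by rewrite sqrtr_gt0. Qed.

Lemma sqrt2_neq0 : Num.sqrt 2 != 0 :> R. Proof. by rewrite gt_eqF // sqrt2_gt0. Qed.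

Lemma sqrt2_sq : Num.sqrt 2 * Num.sqrt 2 = 2 :> R.
Proof. by rewrite -expr2 sqr_sqrtr. Qed.

Lemma S2plus_nz x : S2plus x -> x != 0.
Proof.
move=> xx; apply/eqP => x0; have : dot x x = 2^-1 by exact: xx.
by rewrite x0 dot0l; lra.
Qed.

Lemma unitv_S2plus x : S2plus x -> unitv x = Num.sqrt 2 *: x.
Proof.
move=> xx; have {}xx : dot x x = 2^-1 by exact: xx.
by rewrite /unitv xx sqrtrV // invrK.
Qed.

Lemma S2plus_unit u : dot u u = 1 -> S2plus ((Num.sqrt 2)^-1 *: u).
Proof.
move=> uu; rewrite /S2plus /= !dotE uu mulr1 -invfM sqrt2_sq.
by [].
Qed.

Lemma unitv_inv_sqrt2 u : dot u u = 1 -> unitv ((Num.sqrt 2)^-1 *: u) = u.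
Proof.
by move=> uu; rewrite unitvZ ?invr_gt0 ?sqrt2_gt0 // unitv_id.
Qed.

Lemma tangent_S2plus x g : tangent_space (@S2plus R) x g -> dot x g = 0.
Proof.
by move=> [c [[cs cS] c0 <-]]; rewrite -c0; exact: sphere_velocity cs cS.
Qed.

End Sphere.

Section FramesToKappa.
Variable R : realType.
Implicit Types p v u m x y g : 'rV[R]_3.
Let oT : open (setT : set R^o) := openT.

(** Frames do not form an open set, so smoothness is tested on smooth families of
    frames. *)
Definition smooth_on_frames (k : 'rV[R]_3 -> 'rV[R]_3 -> R) :=
  forall (V : normedModType R) (A : set V) (P W : V -> 'rV[R]_3), open A ->
    smooth_open A P -> smooth_open A W -> (forall z, A z -> frame (P z) (W z)) ->
    smooth_open A (fun z => k (P z) (W z) : R^o).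

Variable k : 'rV[R]_3 -> 'rV[R]_3 -> R.
Hypothesis ks : smooth_on_frames k.
Hypothesis kN : forall p v, frame p v -> k p (- v) = - k p v.
(* The curvature is the same at all the frames of one oriented circle. *)
Hypothesis kC : forall p v p' v', frame p v -> frame p' v' ->
  centre p' v' (k p v) = centre p v (k p v) -> k p' v' = k p v.

Let U p v := centre p v (k p v).

(** If the curvatures differ, U' - U = (k' - k) y for a unit vector y, which then
    lies on both circles, with the same direction U x y = U' x y.  So the two
    circles share the frame (y, U x y), hence the curvature. *)
Lemma family_tangent p v p' v' : frame p v -> frame p' v' ->
  dot (U p v) (U p' v') = 1 + k p v * k p' v' -> k p v = k p' v' /\ U p v = U p' v'.
Proof.
move=> F F'; rewrite /U.
have := dot_centre (k p v) F; have := dot_centre (k p' v') F'.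
move E1 : (k p v) => k1; move E2 : (k p' v') => k2.
move U1E : (centre p v k1) => U1; move U2E : (centre p' v' k2) => U2 D2 D1 D12.
have D : dot (U2 - U1) (U2 - U1) = (k2 - k1) ^+ 2.
  by rewrite !dotE D1 D2 (dotC U2) D12; ring.
have [kE|kne] := eqVneq k1 k2.
  split=> //; apply/esym/eqP; rewrite -subr_eq0; apply/eqP/dot_eq0.
  by rewrite D kE subrr expr0n.
have k0 : k2 - k1 != 0 by rewrite subr_eq0 eq_sym.
pose y := (k2 - k1)^-1 *: (U2 - U1).
have yy : dot y y = 1 by rewrite /y dotZl dotZr D; field.
have y1 : dot U1 y = k1 by rewrite /y dotZr dotDr dotNr D1 D12; field.
have y2 : dot U2 y = k2 by rewrite /y dotZr dotDr dotNr D2 (dotC U2) D12; field.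
have yw : cross U2 y = cross U1 y.
  have -> : U2 = U1 + (k2 - k1) *: y by rewrite /y scalerA divff // scale1r addrC subrK.
  by rewrite crossDl crossZl crossvv scaler0 addr0.
have Fy := circle_frame D1 yy y1.
have A1 : k y (cross U1 y) = k p v.
  by apply: kC => //; rewrite E1 circle_centre.
have A2 : k y (cross U1 y) = k p' v'.
  by apply: kC => //; rewrite E2 -yw circle_centre.
by move: kne; rewrite -E1 -E2 -A1 A2 eqxx.
Qed.

(** If p' lies on the first circle, both circles pass through p' and the claim is
    Cauchy-Schwarz for their normals at p'.  Otherwise turn v' about p' by t in
    [0, pi]: if the difference G of the two sides were positive at 0 it would
    be negative at pi, where the circle is reversed, and vanish in between;
    but then p' would lie on the first circle by [family_tangent]. *)
Lemma family_spacelike p v p' v' : frame p v -> frame p' v' ->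
  dot (U p v) (U p' v') <= 1 + k p v * k p' v'.
Proof.
move=> F F'.
have D1 := dot_centre (k p v) F; have D2 := dot_centre (k p' v') F'.
have [Up|Up] := eqVneq (dot (U p v) p') (k p v).
  have [pp vv pv] := F'.
  have Fy := circle_frame D1 pp Up.
  have E := circle_centre pp Up.
  move: Fy E; set w := cross _ p' => Fy E.
  have -> : dot (U p v) (U p' v') = k p v * k p' v' + dot (cross p' w) (cross p' v').
    rewrite -E [U p' v']/U /centre; move: (k p v) (k p' v') => k1 k2.
    by rewrite !dotE pp (dotC (cross p' w) p') !dot_crossl; ring.
  rewrite addrC lerD2r.
  have := cauchy_schwarz (cross p' w) (cross p' v').
  rewrite !dot_cross_frame // mulr1 => H.
  by rewrite leNgt; apply/negP => lt; nra.
rewrite leNgt; apply/negP => gt.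
pose w t := cos t *: v' + sin t *: cross p' v'.
have [pp vv pv] := F'.
have Fw t : frame p' (w t).
  split=> //; last by rewrite /w !dotE pv dot_crossl !mulr0 addr0.
  rewrite /w !dotE vv (dotC (cross p' v') v') !dot_crossr dot_cross_frame // -[RHS](cos2Dsin2 t).
  by ring.
have ws : smooth_open (setT : set R^o) w.
  have si := @smooth_id _ R^o _ oT.
  by apply: smoothD => //; apply: smoothZ => //; (try exact: smooth_cst);
    [exact: smooth_cos|exact: smooth_sin].
have kws : smooth_open (setT : set R^o) (fun t => k p' (w t) : R^o).
  by apply: ks => //; exact: smooth_cst.
pose G (t : R) : R := dot (U p v) (U p' (w t)) - (1 + k p v * k p' (w t)).
have Gs : smooth_open (setT : set R^o) (G : R^o -> R^o).
  apply: smoothB => //.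
    apply: smooth_dot => //; first exact: smooth_cst.
    apply: smoothD => //; first by apply: smoothZ => //; exact: smooth_cst.
    by apply: smooth_cross => //; exact: smooth_cst.
  apply: smoothD => //; first exact: smooth_cst.
  by apply: smoothM => //; exact: smooth_cst.
have Gc : {within `[0, pi], continuous G}.
  apply: continuous_subspaceT => t; apply: differentiable_continuous.
  exact: smooth_open_diff Gs _.
have w0 : w 0 = v' by rewrite /w cos0 sin0 scale1r scale0r addr0.
have wpi : w pi = - v' by rewrite /w cospi sinpi scaleN1r scale0r addr0.
have G0 : 0 < G 0 by rewrite /G w0 subr_gt0.
have G1 : G pi < 0.
  rewrite /G wpi /U kN // centre_opp dotNr.
  rewrite -/(U p v) -/(U p' v').
  by move: gt; lra.
have [|t _ Gt] := IVT (pi_ge0 R) Gc (v := 0).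
  by rewrite ge_min le_max (ltW G1) (ltW G0) orbT.
have /(family_tangent F (Fw t))[kE UE] : dot (U p v) (U p' (w t)) = 1 + k p v * k p' (w t).
  by apply/eqP; rewrite -subr_eq0; apply/eqP.
move/eqP: Up; apply; rewrite UE kE; exact: dot_centrep.
Qed.

(** * The curvature as a function of the centre *)

Lemma acceleration_norm n (x y : 'rV[R]_n) (a b c : R) : dot x x = 1 ->
  dot y y = 1 -> dot x y = 0 ->
  dot (a *: x + b *: (c *: y) + (- c *: x + 0)) (a *: x + b *: (c *: y) + (- c *: x + 0))
  = (a - c) ^+ 2 + (b * c) ^+ 2.
Proof. by move=> xx yy xy; rewrite addr0 !dotE xx yy (dotC y) xy; ring. Qed.

Lemma spacelike_dist n (x y : 'rV[R]_n) (a b : R) : dot x x = 1 + a ^+ 2 ->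
  dot y y = 1 + b ^+ 2 -> dot x y <= 1 + a * b -> (a - b) ^+ 2 <= dot (x - y) (x - y).
Proof.
move=> xx yy xy; rewrite !dotDl !dotDr !dotNl !dotNr xx yy (dotC y x); lra.
Qed.

(** For parallel centres <U, U'>^2 = (1 + k^2) (1 + k'^2), which exceeds
    (1 + k k')^2 by (k - k')^2, against [family_spacelike]. *)
Lemma curvature_unique p v p' v' : frame p v -> frame p' v' ->
  rho (k p v) *: U p v = rho (k p' v') *: U p' v' -> k p v = k p' v'.
Proof.
move=> F F' E.
have := family_spacelike F F'; rewrite -/(U p v) -/(U p' v').
have r0 := rho_gt0 (k p v); have r0' := rho_gt0 (k p' v').
have -> : dot (U p v) (U p' v') = (rho (k p v) * rho (k p' v'))^-1.
  have : rho (k p v) * rho (k p' v') * dot (U p v) (U p' v') = 1.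
    rewrite -mulrA -dotZr -E dotZr /U dot_centre // mulrA -expr2; exact: rho_sqM.
  have n0 : rho (k p v) * rho (k p' v') != 0 by rewrite gt_eqF // mulr_gt0.
  by move=> D; apply: (mulfI n0); rewrite D divff.
have : ((rho (k p v) * rho (k p' v'))^-1) ^+ 2 = (1 + k p v ^+ 2) * (1 + k p' v' ^+ 2).
  by rewrite exprVn exprMn !rho_sq invfM !invrK.
have : 0 < (rho (k p v) * rho (k p' v'))^-1 by rewrite invr_gt0 mulr_gt0.
set d := (_ * _)^-1; move: d (k p v) (k p' v') => d a a' d0 dd H.
have : (a - a') ^+ 2 = 0 by apply/eqP; rewrite eq_le sqr_ge0 andbT; nra.
by move/eqP; rewrite sqrf_eq0 subr_eq0 => /eqP.
Qed.

Lemma curvature_exists u m : frame u m ->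
  exists r, k (arcpos u m r) (cross u m) = r.
Proof.
move=> F; have E r : arcpos u m r = unitv (r *: u + m) by exact: arcpos_unitv.
have [r rE] : exists r, k (unitv (r *: u + m)) (cross u m) = r; last first.
  by exists r; rewrite E.
apply: (exists_slope (H := fun x => k (unitv x) (cross u m)) F).
  by move=> a x a0; rewrite unitvZ.
move=> b bs bE b0; apply: ks => //.
- exact: smooth_unitv.
- exact: smooth_cst.
move=> s _; apply: frame_sym; apply: frame_unitv => //; first exact: dot_cross_frame.
have [r [t ->]] := bE s.
by rewrite !dotE !(dotC (cross u m)) dot_crossl dot_crossr !mulr0 addr0.
Qed.

Definition centred_curv u : R := xget 0 [set r |
  exists p v, [/\ frame p v, k p v = r & rho r *: centre p v r = u]].

Lemma centred_curvE p v : frame p v -> centred_curv (rho (k p v) *: U p v) = k p v.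
Proof.
move=> F; rewrite /centred_curv; case: xgetP => [r _ [p' [v' [F' kr E]]]|H].
  by rewrite -kr; apply: curvature_unique => //; rewrite /U kr.
by case: (H (k p v)); exists p, v.
Qed.

Lemma centred_curv_root u m r : frame u m ->
  k (arcpos u m r) (cross u m) = r <-> r = centred_curv u.
Proof.
move=> F; have FA s := frame_arcpos s F.
have H s : k (arcpos u m s) (cross u m) = s -> s = centred_curv u.
  move=> E; have := centred_curvE (FA s).
  by rewrite /U E centre_arcpos // => ->.
split; first exact: H.
by have [s sE] := curvature_exists F; move=> ->; rewrite -(H s sE).
Qed.

Lemma smooth_arc_curvature u m : frame u m ->
  smooth_open setT (fun r : R^o => k (arcpos u m r) (cross u m) : R^o).
Proof.
move=> F;apply: ks => //.
- by apply: smooth_arcpos => //; (try exact: smooth_cst); exact: smooth_id.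
- exact: smooth_cst.
- by move=> r _; exact: frame_arcpos.
Qed.

(** Along the half great circle, let a be the derivative of the curvature at the
    root r0, and let s = rho r0, P the point and n = P x w.  Then
    U' = (a - s^2) P + r0 s^2 n, and the infinitesimal form of
    [family_spacelike] is a^2 <= (a - s^2)^2 + (r0 s^2)^2.  Since
    s^2 (1 + r0^2) = 1, this reads 2 a <= 1. *)
Lemma arc_curvature_derive u m : frame u m ->
  exists2 a, is_derive (centred_curv u) 1 (fun r => k (arcpos u m r) (cross u m)) a & a <= 2^-1.
Proof.
move=> F; set r0 := centred_curv u; set w := cross u m.
have r0E : k (arcpos u m r0) w = r0 by apply/centred_curv_root.
pose kr (r : R) : R := k (arcpos u m r) w.
have kd : is_derive (r0 : R) 1 kr (derive1 kr r0).
  by rewrite derive1E; exact: (@smooth_is_derive R R^o R^o setT kr r0 1 (smooth_arc_curvature F)).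
set a := derive1 _ _ in kd; exists a => //.
have Pd : is_derive (r0 : R) 1 (arcpos u m) (rho r0 ^+ 2 *: cross (arcpos u m r0) w).
  exact: is_derive_arcpos.
set P := arcpos u m r0 in r0E Pd *; set s := rho r0 in Pd.
have FP : frame P w := frame_arcpos r0 F.
have [PP ww Pw] := FP.
have Ud := is_derive_add (is_derive_scale kd Pd) (is_derive_cross Pd (is_derive_const w r0 1)).
have FA r := frame_arcpos r F.
have le r : (k (arcpos u m r) w - k (arcpos u m r0) w) ^+ 2 <=
   dot (U (arcpos u m r) w - U (arcpos u m r0) w) (U (arcpos u m r) w - U (arcpos u m r0) w).
  apply: spacelike_dist; [exact: dot_centre|exact: dot_centre|].
  exact: family_spacelike.
have := derive_sq_le Ud kd le.
have krE : kr r0 = r0 := r0E.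
rewrite -/P krE; set n := cross P w.
have -> : cross (s ^+ 2 *: n) w = - s ^+ 2 *: P.
  by rewrite crossZl crossC /n cross_frame1 // scalerN scaleNr.
rewrite cross0r; have nn : dot n n = 1 := dot_cross_frame FP.
have Pn : dot P n = 0 by exact: dot_crossl.
rewrite (acceleration_norm _ _ _ PP nn Pn).
have := rho_sqM r0; rewrite -/s; have s0 : 0 < s by exact: rho_gt0.
move=> E H.
have : 0 <= s ^+ 2 * (1 - 2 * a) by nra.
rewrite pmulr_rge0 ?exprn_gt0 //; lra.
Qed.

(** Extended from the sphere to be constant on rays, so that it is a smooth
    function on an open set. *)
Definition kappa x := centred_curv (unitv x).

Lemma open_dot_gt0 (V : normedModType R) n (f : V -> 'rV[R]_n) :
  smooth_open setT f -> open [set z | 0 < dot (f z) (f z)].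
Proof.
move=> fs; apply: (@open_comp _ _ (fun z => dot (f z) (f z) : R^o) [set r : R | 0 < r]).
  move=> z _; apply: differentiable_continuous.
  by apply: (smooth_open_diff (U := setT)) => //; apply: smooth_dot => //; exact: openT.
exact: open_gt.
Qed.

Lemma open_nonzero : open [set x : 'rV[R]_3 | x != 0].
Proof.
rewrite (_ : [set x : 'rV[R]_3 | x != 0] = [set x | 0 < dot x x]).
  by apply: (@open_dot_gt0 _ _ id); apply: smooth_id; exact: openT.
by apply/seteqP; split=> x /=; rewrite dot_gt0E.
Qed.

(** The component of a orthogonal to x, up to the factor <x, x>: a polynomial
    expression that completes x to a frame wherever it does not vanish. *)
Definition companion (a : 'rV[R]_3) x := dot x x *: a - dot a x *: x.

Lemma frame_companion a x : x != 0 -> companion a x != 0 ->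
  frame (unitv x) (unitv (companion a x)).
Proof.
move=> x0 a0; apply: frame_unitv => //; first exact: dot_unitv.
rewrite /unitv dotZl /companion !dotE (dotC x a); ring.
Qed.

(** Near x0 the curvature is the unique root of k (arcpos u m r) (u x m) - r,
    whose derivative in r is at most 1/2 - 1 by [arc_curvature_derive]. *)
Lemma smooth_kappa : smooth_open [set x : 'rV[R]_3 | x != 0] (kappa : _ -> R^o).
Proof.
have o3 : open [set: 'rV[R]_3] := openT.
apply: (smooth_local open_nonzero) => x0 /= xn0.
have [m0 F0] := exists_frame (dot_unitv xn0).
have cs : smooth_open [set: 'rV[R]_3] (companion m0).
  apply: smoothB => //; apply: smoothZ => //; (try exact: smooth_cst);
    (try exact: smooth_id); apply: smooth_dot => //;
    (try exact: smooth_cst); exact: smooth_id.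
pose A := [set x : 'rV[R]_3 | x != 0] `&` [set x | 0 < dot (companion m0 x) (companion m0 x)].
have oA : open A.
  apply: openI; first exact: open_nonzero.
  exact: open_dot_gt0.
have Ax0 : A x0.
  split=> //=; apply: dot_gt0.
  have [_ mm um] := F0.
  have -> : companion m0 x0 = dot x0 x0 *: m0.
    rewrite /companion (_ : dot m0 x0 = 0) ?scale0r ?subr0 //.
    have : Num.sqrt (dot x0 x0) * dot (unitv x0) m0 = 0 by rewrite um mulr0.
    rewrite /unitv dotZl mulrA divff ?mul1r; first by rewrite dotC.
    by rewrite gt_eqF // sqrtr_gt0 dot_gt0.
  apply/eqP => E; have : dot m0 (dot x0 x0 *: m0) = 0 by rewrite E dot0r.
  by rewrite dotZr mm mulr1; apply/eqP; rewrite gt_eqF // dot_gt0.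
exists A, (kappa : _ -> R^o); split=> //.
have A1 x : A x -> x != 0 by case.
have A2 x : A x -> companion m0 x != 0.
  by move=> [_ /=]; rewrite dot_gt0E.
pose u x := unitv x; pose m x := unitv (companion m0 x).
have FA x : A x -> frame (u x) (m x) by move=> Ax; apply: frame_companion; [exact: A1|exact: A2].
pose F (z : 'rV[R]_3 * R^o) : R^o := k (arcpos (u z.1) (m z.1) z.2) (cross (u z.1) (m z.1)) - z.2.
have oAR : open [set z : 'rV[R]_3 * R^o | A z.1] by exact: open_cylinder.
have FE x r : F (x, r) = k (arcpos (u x) (m x) r) (cross (u x) (m x)) - r by [].
apply: (root_smooth (F := F)) => //.
- have i1 := smooth_fst oAR (smooth_id oAR).
  have i2 := smooth_snd oAR (smooth_id oAR).
  have us : smooth_open [set z : 'rV[R]_3 * R^o | A z.1] (fun z => u z.1).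
    by apply: smooth_unitv => // z Az; exact: A1.
  have ms : smooth_open [set z : 'rV[R]_3 * R^o | A z.1] (fun z => m z.1).
    apply: smooth_unitv => // [|z Az]; last exact: A2.
    exact: (@smooth_comp _ _ _ oAR _ _ _ _ setT (companion m0) (fun z => z.1)).
  apply: smoothB => //; apply: ks => //.
  + exact: smooth_arcpos.
  + exact: smooth_cross.
  + by move=> z Az; apply: frame_arcpos; exact: FA.
- move=> x r Ax; rewrite FE; rewrite -(centred_curv_root r (FA x Ax)).
  by split=> [/eqP|->]; rewrite ?subrr // subr_eq0 => /eqP.
- move=> x Ax.
  have [a ad a2] := arc_curvature_derive (FA x Ax).
  rewrite derive_snd.
  have := is_derive_sub ad (is_derive_id (centred_curv (u x)) 1) => -[_ ->].
  by rewrite lt_eqF //; lra.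
Qed.

(** * Oddness and the gradient bound *)

Lemma kappa_frame p v : frame p v ->
  kappa ((Num.sqrt 2)^-1 *: (rho (k p v) *: centre p v (k p v))) = k p v.
Proof.
move=> F; rewrite /kappa unitv_inv_sqrt2; first exact: centred_curvE.
exact/dot_rho_unit/dot_centre.
Qed.

Lemma kappa_smooth : smooth_function kappa.
Proof.
move=> x xx; exists [set x | x != 0], kappa; split=> //.
- exact: open_nonzero.
- exact: S2plus_nz.
- exact: smooth_kappa.
Qed.

Lemma kappa_centre u : dot u u = 1 ->
  exists p v, [/\ frame p v, k p v = centred_curv u & rho (k p v) *: centre p v (k p v) = u].
Proof.
move=> uu; have [m F] := exists_frame uu.
have kE : k (arcpos u m (centred_curv u)) (cross u m) = centred_curv u by apply/centred_curv_root.
exists (arcpos u m (centred_curv u)), (cross u m); split=> //; first exact: frame_arcpos.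
by rewrite kE; exact: centre_arcpos.
Qed.

Lemma centred_curvN u : dot u u = 1 -> centred_curv (- u) = - centred_curv u.
Proof.
move=> uu; have [p [v [F kE E]]] := kappa_centre uu.
have := centred_curvE (frame_opp F).
rewrite /U kN // centre_opp scalerN {1}/rho sqrrN -/(rho (k p v)) E => ->.
by rewrite kE.
Qed.

Lemma kappa_odd : odd_function kappa.
Proof.
move=> x xx; rewrite /kappa unitvN centred_curvN // dot_unitv //; exact: S2plus_nz.
Qed.

(** Test the gradient g on the curve c of centres along the half great circle in
    the direction m of g.  Up to the factor 1 / sqrt 2, the velocity of c has
    component (a - 1) / (1 + kappa^2) along m, while kappa changes at the
    rate a.  With G = |g| / (1 + kappa^2) this gives a = (a - 1) G, and
    a <= 1/2 forces G < 1. *)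
Lemma kappa_bound : gradient_bound kappa.
Proof.
move=> x xx; rewrite /gradient_norm /gradient.
case: xgetP => [g _ [tg gP]|_]; last first.
  by rewrite /round_metric dot0l mulr0 sqrtr0 ltr_pwDl // sqr_ge0.
have xg := tangent_S2plus tg.
have [->|g0] := eqVneq g 0.
  by rewrite /round_metric dot0l mulr0 sqrtr0 ltr_pwDl // sqr_ge0.
set u := unitv x; have uE : u = Num.sqrt 2 *: x := unitv_S2plus xx.
have uu : dot u u = 1 by apply: dot_unitv; exact: S2plus_nz.
have ug : dot u g = 0 by rewrite uE dotZl xg mulr0.
set m := unitv g; have F : frame u m by apply: frame_unitv.
pose ng := Num.sqrt (dot g g).
have ng0 : 0 < ng by rewrite sqrtr_gt0 dot_gt0.
have gE : g = ng *: m by rewrite /m /unitv scalerA divff ?scale1r // gt_eqF.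
have -> : Num.sqrt (round_metric g g) = Num.sqrt 2 * ng by rewrite /round_metric sqrtrM.
rewrite -[kappa x]/(centred_curv u).
clearbody m u.
set r0 := centred_curv u; set w := cross u m.
have [a kd a2] := arc_curvature_derive F.
rewrite -/r0 in kd.
pose kr (r : R) : R := k (arcpos u m r) w.
rewrite -/(kr) in kd.
have r0E : kr r0 = r0 by apply/centred_curv_root.
have Pd : is_derive (r0 : R) 1 (arcpos u m) (rho r0 ^+ 2 *: cross (arcpos u m r0) w).
  exact: is_derive_arcpos.
have Ud := is_derive_add (is_derive_scale kd Pd) (is_derive_cross Pd (is_derive_const w r0 1)).
pose UU (r : R) : 'rV[R]_3 := kr r *: arcpos u m r + cross (arcpos u m r) w.
pose c (t : R) : 'rV[R]_3 := (Num.sqrt 2)^-1 *: (rho (kr (t + r0)) *: UU (t + r0)).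
have FA r := frame_arcpos r F.
have krs : smooth_open (setT : set R^o) (kr : R^o -> R^o) := smooth_arc_curvature F.
have arcs : smooth_open (setT : set R^o) (arcpos u m : R^o -> _).
  by apply: smooth_arcpos => //; (try exact: smooth_cst); exact: smooth_id.
have c1s : smooth_open (setT : set R^o) (fun r : R^o => (Num.sqrt 2)^-1 *: (rho (kr r) *: UU r)).
  apply: smoothZ => //; first exact: smooth_cst.
  apply: smoothZ => //; first exact: smooth_rho.
  apply: smoothD => //; first exact: smoothZ.
  by apply: smooth_cross => //; exact: smooth_cst.
have cs : smooth_open (setT : set R^o) (c : R^o -> _).
  apply: (@smooth_comp _ _ _ oT _ _ _ _ setT
     (fun r : R^o => (Num.sqrt 2)^-1 *: (rho (kr r) *: UU r))
     (fun t : R^o => t + r0 : R^o)) => //.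
  by apply: smoothD => //; [exact: smooth_id|exact: smooth_cst].
have uUU r : dot (rho (kr r) *: UU r) (rho (kr r) *: UU r) = 1.
  exact/dot_rho_unit/dot_centre/FA.
have cS t : S2plus (c t) by exact: S2plus_unit.
have c0 : c 0 = x.
  rewrite /c add0r r0E.
  have -> : rho r0 *: UU r0 = u by rewrite /UU r0E; exact: centre_arcpos.
  by rewrite uE scalerA mulVf ?scale1r // sqrt2_neq0.
have kc t : kappa (c t) = kr (t + r0) by apply: kappa_frame.
have := gP c (conj cs cS) c0.
have -> : derive1 (kappa \o c : R -> R^o) 0 = a.
  have -> : (kappa \o c : R -> R^o) = (fun t => kr (t + r0)) by apply/funext => t; exact: kc.
  exact: is_derive1 (is_derive_shift0 kd).
have -> : round_metric g (derive1 c 0) = Num.sqrt 2 * ng * rho r0 ^+ 2 * (a - 1).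
  pose f (t : R) : R := dot g (c t).
  have fd : is_derive (0 : R) 1 f (dot 0 (c 0) + dot g (derive1 c 0)).
    by apply: is_derive_dot; exact: smooth_derive1.
  pose h (r : R) : R := (Num.sqrt 2)^-1 * (rho (kr r) * dot g (UU r)).
  have fh : f = fun t => h (t + r0) by apply/funext => t; rewrite /f /c /h !dotZr.
  have mm : dot m m = 1 by case: F.
  have um : dot u m = 0 by case: F.
  have mu : dot m u = 0 by rewrite dotC.
  have gw : dot g w = 0 by rewrite gE dotZl /w dot_crossr mulr0.
  have gP0 r : dot g (arcpos u m r) = rho r * ng.
    by rewrite gE /arcpos !dotE mm mu; ring.
  have gN0 r : dot g (cross (arcpos u m r) w) = - rho r * r * ng.
    by rewrite cross_arcpos // gE !dotE mm mu; ring.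
  have gU : dot g (UU r0) = 0.
    by rewrite /UU dotDr dotZr gP0 gN0 r0E; ring.
  have rkd : is_derive (r0 : R) 1 (fun r => rho (kr r)) (- r0 * rho r0 ^+ 3 * a).
    have := @is_derive1_comp R (@rho R) kr r0 (- r0 * rho r0 ^+ 3) a.
    by apply; rewrite ?r0E //; exact: is_derive_rho.
  have gUd := is_derive_dot (is_derive_const g r0 1) Ud.
  have hd := is_derive_mul (is_derive_const ((Num.sqrt 2)^-1 : R) r0 1) (is_derive_mul rkd gUd).
  have := is_derive_shift0 hd; rewrite -[fun t => _]/(fun t => h (t + r0)) -fh => -[_ E].
  move: fd => [_]; rewrite E dot0l add0r => {}E.
  rewrite /round_metric -E -/(UU r0) gU dot0l add0r mul0r mulr0 !add0r r0E.
  have A1 := gP0 r0; have A2 := gN0 r0.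
  have A3 : dot g (cross (rho r0 ^+ 2 *: cross (arcpos u m r0) w) w) = - (rho r0 ^+ 3 * ng).
    rewrite crossZl [cross (cross _ _) w]crossC (cross_frame1 (FA r0)).
    by rewrite dotZr dotNr gP0; ring.
  move: A1 A2 A3; rewrite cross0r addr0.
  move: (cross (rho r0 ^+ 2 *: cross (arcpos u m r0) w) w).
  move: (cross (arcpos u m r0) w) (arcpos u m r0) => X1 X2 X3 A1 A2 A3.
  rewrite !dotDr !dotZr A1 A2 A3.
  have rE : Num.sqrt 2 = 2 * (Num.sqrt 2)^-1 :> R.
    have n0 := @sqrt2_neq0 R.
    by apply: (mulIf n0); rewrite sqrt2_sq divfK.
  rewrite [in RHS]rE.
  have := rho_sqM r0; move: (Num.sqrt 2)^-1 (rho r0) => s2 s E1.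
  transitivity (2 * s2 * ng * s ^+ 2 * (a - s ^+ 2 * (1 + r0 ^+ 2))); first ring.
  by rewrite E1.
have := rho_sqM r0; have s0 := rho_gt0 r0.
set N := Num.sqrt 2 * ng; move: (rho r0) s0 => s s0 E1 E2.
rewrite ltNge; apply/negP => le.
have s2 : 0 < s ^+ 2 by rewrite exprn_gt0.
have G1 : 1 <= N * s ^+ 2 by rewrite -E1 mulrC ler_pM2r.
move: (N * s ^+ 2) G1 E2 => G G1 E2; nra.
Qed.

End FramesToKappa.

(** * Hopf images of planes *)

Section Hopf.
Variable R : realType.
Implicit Types p v u m x y : 'rV[R]_3.
Implicit Types a b q : 'rV[R]_4.

(** The oriented circle (U, k) as a set of imaginary quaternions. *)
Definition circ (U : 'rV[R]_3) (k : R) : set 'rV[R]_4 :=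
  [set y | S2 y /\ dot y (im U) = k].

Definition minor a b (i j : 'I_4) : R := a 0 i * b 0 j - b 0 i * a 0 j.
(** The imaginary parts of b conj(a) and, for [coaxis], of conj(a) b: up to a
    common factor, the coordinates of the bivector of a and b in the two
    three-dimensional eigenspaces. *)
Definition axis a b : 'rV[R]_3 :=
  vec3 (minor a b 0 1 + minor a b 2 3) (minor a b 0 2 - minor a b 1 3)
       (minor a b 0 3 + minor a b 1 2).
Definition coaxis a b : 'rV[R]_3 :=
  vec3 (minor a b 0 1 - minor a b 2 3) (minor a b 0 2 + minor a b 1 3)
       (minor a b 0 3 - minor a b 1 2).

Definition hopf3 q : 'rV[R]_3 :=
  vec3 (q 0 0 ^+ 2 + q 0 1 ^+ 2 - q 0 2 ^+ 2 - q 0 3 ^+ 2)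
       (2 * (q 0 1 * q 0 2 + q 0 0 * q 0 3)) (2 * (q 0 1 * q 0 3 - q 0 0 * q 0 2)).

Lemma hopf_im q : hopf q = im (hopf3 q).
Proof.
rewrite /hopf /qmul /qconj /qi /im /hopf3 !quatE !vec3E.
apply: row4P; rewrite !quatE; ring.
Qed.

Lemma dot_hopf3 q : dot (hopf3 q) (hopf3 q) = dot q q ^+ 2.
Proof. rewrite dot3 dot4 /hopf3 !vec3E; ring. Qed.

Lemma dot_axis a b : dot (axis a b) (axis a b) = dot a a * dot b b - dot a b ^+ 2.
Proof. rewrite dot3 !dot4 /axis !vec3E /minor; ring. Qed.

Lemma dot_hopf_axis a b (c s : R) : dot (hopf3 (c *: a + s *: b)) (axis a b) =
  dot (c *: a + s *: b) (c *: a + s *: b) * coaxis a b 0 0.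
Proof. rewrite dot3 !dot4 /axis /coaxis /hopf3 !vec3E /minor !mxE; ring. Qed.

(** The polarisation of the quadratic map [hopf3]. *)
Definition hopf_mixed a b : 'rV[R]_3 :=
  vec3 (2 * (a 0 0 * b 0 0 + a 0 1 * b 0 1 - a 0 2 * b 0 2 - a 0 3 * b 0 3))
       (2 * (a 0 1 * b 0 2 + b 0 1 * a 0 2 + a 0 0 * b 0 3 + b 0 0 * a 0 3))
       (2 * (a 0 1 * b 0 3 + b 0 1 * a 0 3 - a 0 0 * b 0 2 - b 0 0 * a 0 2)).

Lemma hopf3_comb a b (c s : R) : hopf3 (c *: a + s *: b) =
  c ^+ 2 *: hopf3 a + (c * s) *: hopf_mixed a b + s ^+ 2 *: hopf3 b.
Proof. apply: row3P; rewrite /hopf3 /hopf_mixed !mxE /= ?mxE; ring. Qed.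

Lemma hopf_mixedE a b : dot a a *: hopf_mixed a b =
  2 *: (cross (axis a b) (hopf3 a) + dot a b *: hopf3 a).
Proof.
rewrite !dot4; apply: row3P; rewrite /cross /axis /hopf_mixed /hopf3 !mxE /= ?mxE /minor /=; ring.
Qed.

(** Homogeneous form of the fact that, for an orthonormal pair, b = u a with u the
    axis, so that the Hopf image of b is that of a after a half turn about u. *)
Lemma hopf3_rot a b : dot a a ^+ 2 *: hopf3 b =
  (dot a b ^+ 2 - dot (axis a b) (axis a b)) *: hopf3 a
  + (2 * dot a b) *: cross (axis a b) (hopf3 a)
  + (2 * dot (axis a b) (hopf3 a)) *: axis a b.
Proof.
rewrite !dot4 !dot3; apply: row3P; rewrite /cross /axis /hopf3 !mxE /= ?mxE /minor /=; ring.
Qed.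

(** For an orthonormal pair, cos(t/2) a + sin(t/2) b = exp(u t/2) a with u the
    axis, so its Hopf image is that of a rotated about u by t. *)
Lemma hopf_circle a b (k : R) : orthonormal_pair a b -> coaxis a b 0 0 = k * rho k ->
  @hopf R @` (plane a b `&` @S3 R) = circ ((rho k)^-1 *: axis a b) k.
Proof.
move=> [aa bb ab] hE; set u := axis a b.
have uu : dot u u = 1 by rewrite dot_axis aa bb ab expr0n subr0 mulr1.
have rk := rho_gt0 k; have rk0 : rho k != 0 by rewrite gt_eqF.
set U := (rho k)^-1 *: u.
have UU : dot U U = 1 + k ^+ 2.
  rewrite /U !dotE uu mulr1 -expr2 exprVn rho_sq invrK //.
have qq (c s : R) : dot (c *: a + s *: b) (c *: a + s *: b) = c ^+ 2 + s ^+ 2.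
  by rewrite !dotE aa bb ab (dotC b) ab; ring.
apply/seteqP; split=> [_ [q [[c [s ->]] qS] <-]|y [/S2P[z -> zz] yU]].
  have cs : dot (c *: a + s *: b) (c *: a + s *: b) = 1 by exact: qS.
  rewrite hopf_im; split; first by apply/S2_im; rewrite dot_hopf3 cs expr1n.
  rewrite dot_im /U dotZr /u dot_hopf_axis cs mul1r hE.
  by rewrite mulrC mulfK.
set p := hopf3 a.
have pp : dot p p = 1 by rewrite dot_hopf3 aa expr1n.
have up : dot u p = k * rho k.
  have := dot_hopf_axis a b 1 0; rewrite qq scale1r scale0r addr0 -/p -/u dotC => ->.
  by rewrite hE expr1n expr0n addr0 mul1r.
have Up : dot U p = k by rewrite /U dotZl up mulrC mulfK.
have F := circle_frame UU pp Up.
have CU := circle_centre pp Up.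
have [|t zE] := @circle_pos_surj R p (cross U p) k F z zz.
  by rewrite CU; rewrite dot_im dotC in yU.
have M : hopf_mixed a b = 2 *: cross u p.
  by have := hopf_mixedE a b; rewrite aa ab scale1r scale0r addr0.
have B : hopf3 b = (2 * (k * rho k)) *: u - p.
  have := hopf3_rot a b; rewrite aa ab -/u uu -/p up expr1n scale1r => ->.
  by rewrite expr0n mulr0 scale0r addr0 sub0r scaleN1r addrC.
pose c := cos (t / 2); pose s := sin (t / 2).
have cs1 : c ^+ 2 + s ^+ 2 = 1 by exact: cos2Dsin2.
have tE : t = t / 2 + t / 2 by rewrite -splitr.
have ct : cos t = c ^+ 2 - s ^+ 2 by rewrite {1}tE cosD -!expr2.
have st : sin t = 2 * (c * s) by rewrite {1}tE sinD /c /s; ring.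
exists (c *: a + s *: b); first by split; [exists c, s|rewrite /S3 /= qq].
rewrite hopf_im; congr (im _); rewrite hopf3_comb M B -/p zE /circle_pos CU ct st.
have -> : cross p (cross U p) = U - k *: p.
  by rewrite cross_cross pp (dotC p) Up scale1r.
have -> : cross U p = (rho k)^-1 *: cross u p by rewrite /U crossZl.
move: (cross u p) => w.
rewrite /U; clearbody u p.
have E := rho_sqM k.
have -> : rho k ^+ 2 * (c ^+ 2 - s ^+ 2) *: (p - k *: ((rho k)^-1 *: u - k *: p)) =
  (c ^+ 2 - s ^+ 2) *: (p - (k * rho k) *: u).
  transitivity ((c ^+ 2 - s ^+ 2) *:
    ((rho k ^+ 2 * (1 + k ^+ 2)) *: p - (k * rho k ^+ 2 * (rho k)^-1) *: u)).
    by apply: row3P; rewrite !mxE; ring.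
  have -> : k * rho k ^+ 2 * (rho k)^-1 = k * rho k by field.
  by rewrite E scale1r.
transitivity ((c ^+ 2 + s ^+ 2) * (k * rho k) *: u + (c ^+ 2 - s ^+ 2) *: (p - (k * rho k) *: u)
   + (2 * (c * s)) *: w).
  by apply: row3P; rewrite !mxE; ring.
congr (_ + _ + _); rewrite ?cs1 ?mul1r !scalerA; congr (_ *: _).
  by field.
by field.
Qed.

Lemma wedgeE a b i j : wedge a b i j = minor a b i j.
Proof. by rewrite /wedge /minor !mxE !big_ord1 !mxE. Qed.

Lemma bivectorE (y x : 'rV[R]_3) i j : bivector y x i j =
  y 0 0 * (2^-1 * (minor (q1 R) (qi R) i j - minor (qj R) (qk R) i j)) +
  y 0 1 * (2^-1 * (minor (q1 R) (qj R) i j + minor (qi R) (qk R) i j)) +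
  y 0 2 * (2^-1 * (minor (q1 R) (qk R) i j - minor (qi R) (qj R) i j)) +
  x 0 0 * (2^-1 * (minor (q1 R) (qi R) i j + minor (qj R) (qk R) i j)) +
  x 0 1 * (2^-1 * (minor (q1 R) (qj R) i j - minor (qi R) (qk R) i j)) +
  x 0 2 * (2^-1 * (minor (q1 R) (qk R) i j + minor (qi R) (qj R) i j)).
Proof.
rewrite /bivector /v1 /v2 /v3 /v4 /v5 /v6 -!wedgeE.
move: (wedge (q1 R) (qi R)) (wedge (qj R) (qk R)) (wedge (q1 R) (qj R)) => w1 w2 w3.
move: (wedge (qi R) (qk R)) (wedge (q1 R) (qk R)) (wedge (qi R) (qj R)) => w4 w5 w6.
by rewrite !mxE.
Qed.

(** The coordinates of a wedge b in the two triples of basis bivectors are the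
    coaxis and the axis. *)
Lemma bivector_axis a b (eta u : 'rV[R]_3) (x y : 'rV[R]_3) :
  x = (Num.sqrt 2)^-1 *: u -> y = (Num.sqrt 2)^-1 *: eta ->
  (Num.sqrt 2)^-1 *: wedge a b = bivector y x <-> axis a b = u /\ coaxis a b = eta.
Proof.
move=> -> ->; have s0 : (Num.sqrt 2)^-1 != 0 :> R by rewrite invr_eq0 sqrt2_neq0.
have E := wedgeE a b.
have -> : bivector ((Num.sqrt 2)^-1 *: eta) ((Num.sqrt 2)^-1 *: u) =
    (Num.sqrt 2)^-1 *: bivector eta u.
  have Z (c : R) (z : 'rV[R]_3) i : (c *: z) 0 i = c * z 0 i by rewrite mxE.
  by rewrite /bivector !Z !scalerDr !scalerA.
move BE : (bivector eta u) => B.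
have [B01 B23 B02 B13 [B03 B12]] : [/\ B 0 1 = (eta 0 0 + u 0 0) / 2,
    B 2 3 = (u 0 0 - eta 0 0) / 2, B 0 2 = (eta 0 1 + u 0 1) / 2,
    B 1 3 = (eta 0 1 - u 0 1) / 2 &
    B 0 3 = (eta 0 2 + u 0 2) / 2 /\ B 1 2 = (u 0 2 - eta 0 2) / 2].
  by split; [| | | |split]; rewrite -BE bivectorE /minor /q1 /qi /qj /qk !quatE; field.
have Bskew i j : B i j = - B j i by rewrite -BE !bivectorE /minor; ring.
have Mskew i j : minor a b i j = - minor a b j i by rewrite /minor; ring.
have skew0 (z : R) : z = - z -> z = 0 by move=> zz; lra.
split.
  move/(scalerI s0) => W.
  have {W}W i j : minor a b i j = B i j by rewrite -E W.
  by split; apply: row3P; rewrite /axis /coaxis !vec3E !W ?B01 ?B23 ?B02 ?B13 ?B03 ?B12; field.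
move=> [A' C']; congr (_ *: _).
have A i : axis a b 0 i = u 0 i by rewrite A'.
have C i : coaxis a b 0 i = eta 0 i by rewrite C'.
have A0 := A 0; have A1 := A 1; have A2 := A 2; have C0 := C 0; have C1 := C 1; have C2 := C 2.
rewrite /axis /coaxis !vec3E in A0 A1 A2 C0 C1 C2.
have W01 : minor a b 0 1 = B 0 1 by rewrite B01 -A0 -C0; field.
have W23 : minor a b 2 3 = B 2 3 by rewrite B23 -A0 -C0; field.
have W02 : minor a b 0 2 = B 0 2 by rewrite B02 -A1 -C1; field.
have W13 : minor a b 1 3 = B 1 3 by rewrite B13 -A1 -C1; field.
have W03 : minor a b 0 3 = B 0 3 by rewrite B03 -A2 -C2; field.
have W12 : minor a b 1 2 = B 1 2 by rewrite B12 -A2 -C2; field.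
have D i : minor a b i i = B i i.
  by rewrite (skew0 _ (Mskew i i)) (skew0 _ (Bskew i i)).
apply/matrixP; apply: ord4P; apply: ord4P; rewrite E //.
all: by rewrite Mskew Bskew; congr (- _).
Qed.

(** A unit quaternion a with u a = a eta, and b = u a.  In general a is
    proportional to 1 - u eta, which represents the rotation taking eta to u;
    it vanishes for u = - eta, where a may be any unit imaginary quaternion
    orthogonal to eta, here j. *)
Lemma exists_pair (eta u : 'rV[R]_3) : dot eta eta = 1 -> dot u u = 1 -> eta 0 1 = 0 ->
  exists a b, [/\ orthonormal_pair a b, axis a b = u & coaxis a b = eta].
Proof.
move=> ee uu e1.
have [un|un] := eqVneq u (- eta).
  exists (quat 0 0 1 0), (quat 0 (eta 0 2) 0 (- eta 0 0)).
  move: ee; rewrite dot3 e1 => ee; split.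
  - by split; rewrite dot4 !quatE; move: ee; lra.
  - by rewrite un; apply: row3P; rewrite /axis /minor !vec3E !quatE !mxE ?e1; ring.
  - by apply: row3P; rewrite /coaxis /minor !vec3E !quatE ?e1; ring.
pose d := dot u eta.
have d1 : 0 < 1 + d.
  have : 0 < dot (u + eta) (u + eta).
    by apply: dot_gt0; rewrite addr_eq0.
  by rewrite !dotE uu ee (dotC eta) -/d; lra.
pose s := (Num.sqrt (2 * (1 + d)))^-1.
have s2 : s ^+ 2 * (2 * (1 + d)) = 1.
  by rewrite exprVn sqr_sqrtr ?mulVf //; [rewrite gt_eqF //|]; lra.
pose c := cross eta u.
pose a : 'rV[R]_4 := s *: quat (1 + d) (c 0 0) (c 0 1) (c 0 2).
pose b : 'rV[R]_4 := s *: im (eta + u).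
have cc : dot c c = 1 - d ^+ 2 by rewrite dot_cross_cross ee uu -/d (dotC eta) -/d; ring.
have ce : dot c eta = 0 by rewrite dotC dot_crossl.
have cu : dot c u = 0 by rewrite dotC dot_crossr.
have W : axis a b = (s ^+ 2 * (1 + d)) *: (eta + u) + s ^+ 2 *: cross c (eta + u) /\
   coaxis a b = (s ^+ 2 * (1 + d)) *: (eta + u) - s ^+ 2 *: cross c (eta + u).
  rewrite /a /b; clearbody s; split.
    by apply: row3P; rewrite /axis /minor /cross !vec3E !mxE /= ?mxE /=; ring.
  by apply: row3P; rewrite /coaxis /minor /cross !vec3E !mxE /= ?mxE /=; ring.
have K : cross c (eta + u) = (1 + d) *: (u - eta).
  rewrite crossDr !crossl_cross ee uu -/d (dotC eta) -/d.
  by apply: row3P; rewrite !mxE; ring.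
exists a, b; case: W => -> ->; rewrite K; split.
- split; rewrite /a /b !dotZl !dotZr.
  + have -> : dot (quat (1 + d) (c 0 0) (c 0 1) (c 0 2)) (quat (1 + d) (c 0 0) (c 0 1) (c 0 2)) =
      (1 + d) ^+ 2 + dot c c by rewrite dot4 dot3 !quatE; ring.
    by rewrite cc -[RHS]s2; ring.
  + rewrite dot_im !dotE ee uu -/d (dotC eta) -/d -[RHS]s2; ring.
  + have -> : dot (quat (1 + d) (c 0 0) (c 0 1) (c 0 2)) (im (eta + u)) = dot c (eta + u).
      by rewrite dot4 dot3 /im !quatE; ring.
    by rewrite dotDr ce cu; ring.
- transitivity ((s ^+ 2 * (2 * (1 + d))) *: u); last by rewrite s2 scale1r.
  by apply: row3P; rewrite !mxE; ring.
- transitivity ((s ^+ 2 * (2 * (1 + d))) *: eta); last by rewrite s2 scale1r.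
  by apply: row3P; rewrite !mxE; ring.
Qed.

(** The circle about x / |x| with geodesic curvature kappa x. *)
Definition kcircle (kappa : 'rV[R]_3 -> R) x : set 'rV[R]_4 :=
  circ ((rho (kappa x))^-1 *: (Num.sqrt 2 *: x)) (kappa x).

Lemma kcircle_centre (kappa : 'rV[R]_3 -> R) U (r : R) : dot U U = 1 + r ^+ 2 ->
  kappa ((Num.sqrt 2)^-1 *: (rho r *: U)) = r ->
  exists2 x, S2plus x & circ U r = kcircle kappa x.
Proof.
move=> /dot_rho_unit/S2plus_unit xx kx.
exists ((Num.sqrt 2)^-1 *: (rho r *: U)); first exact: xx.
rewrite /kcircle kx [Num.sqrt 2 *: _]scalerA divff ?sqrt2_neq0 // scale1r scalerA.
by rewrite mulVf ?scale1r // gt_eqF // rho_gt0.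
Qed.

Lemma engendered_graph (kappa : 'rV[R]_3 -> R) :
  engendered_family (graph_f_kappa kappa) =
  [set C | exists2 x, S2plus x & C = kcircle kappa x].
Proof.
have n0 := @sqrt2_neq0 R.
pose eta x : 'rV[R]_3 := rho (kappa x) *: vec3 (kappa x) 0 1.
have etaE x : f_kappa kappa x = (Num.sqrt 2)^-1 *: eta x.
  have -> : f_kappa kappa x = vec3 (kappa x / Num.sqrt (2 + 2 * kappa x ^+ 2)) 0
     (1 / Num.sqrt (2 + 2 * kappa x ^+ 2)) by [].
  have -> : Num.sqrt (2 + 2 * kappa x ^+ 2) = Num.sqrt 2 * Num.sqrt (1 + kappa x ^+ 2).
    by rewrite -sqrtrM //; congr Num.sqrt; ring.
  have r0 : Num.sqrt (1 + kappa x ^+ 2) != 0 by rewrite gt_eqF // sqrtr_gt0 sq1_gt0.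
  by apply: row3P; rewrite /eta /rho !mxE /=; field; rewrite n0 r0.
have xE x : x = (Num.sqrt 2)^-1 *: (Num.sqrt 2 *: x) by rewrite scalerA mulVf ?scale1r.
have eta1 x : dot (eta x) (eta x) = 1.
  by rewrite /eta dotZl dotZr dot3 !vec3E -[RHS](rho_sqM (kappa x)); ring.
have eta0 x : eta x 0 0 = kappa x * rho (kappa x) by rewrite /eta mxE vec3E mulrC.
apply/seteqP; split=> C.
  move=> [a [b [ab [x xx W] ->]]]; exists x => //.
  have [A1 A2] := (bivector_axis a b (xE x) (etaE x)).1 W.
  by rewrite (hopf_circle ab (k := kappa x)) ?A2 // A1.
move=> [x xx ->].
have uu : dot (Num.sqrt 2 *: x) (Num.sqrt 2 *: x) = 1.
  have xx' : dot x x = 2^-1 by exact: xx.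
  by rewrite dotZl dotZr xx' mulrA sqrt2_sq divff.
have e1 : eta x 0 1 = 0 by rewrite /eta mxE vec3E mulr0.
have [a [b [ab A1 A2]]] := exists_pair (eta1 x) uu e1.
exists a, b; split=> //.
  by exists x => //; apply/(bivector_axis a b (xE x) (etaE x)).
by rewrite (hopf_circle ab (k := kappa x)) ?A2 // A1.
Qed.

End Hopf.

(** * The geodesic curvature of a path geometry *)

Section Calculus.
Variable R : realType.

Lemma open_smooth_preimage (V W : normedModType R) (A : set V) (B : set W) (f : V -> W) :
  open A -> open B -> smooth_open A f -> open (A `&` f @^-1` B).
Proof.
move=> oA oB fs; rewrite openE => z [Az Bz]; rewrite /interior /=.
apply: filterI; first exact: open_nbhs_nbhs.
have fc : {for z, continuous f}.
  by apply: differentiable_continuous; exact: smooth_open_diff fs Az.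
by apply: fc; exact: open_nbhs_nbhs.
Qed.

(** f f' = 0, so f^2 is constant.  Applied to quantities that vanish as long as a
    leaf moves and are stationary when it stops. *)
Lemma zero_or_critical (f : R -> R) :
  smooth_open setT (f : R^o -> R^o) ->
  (forall t, f t = 0 \/ derive1 f t = 0) ->
  forall s t, f s = 0 -> f t = 0.
Proof.
move=> fs H s t fs0.
have fd (r : R) := smooth_derive1 r fs.
have f2 (r : R) : is_derive r 1 (fun r => f r * f r) 0.
  apply: (is_derive_fun (is_derive_mul (fd r) (fd r))) => //.
  by case: (H r) => ->; rewrite ?mulr0 ?mul0r addr0.
have := is_derive_0_is_cst t s f2 => /=.
by rewrite fs0 mul0r => /eqP; rewrite mulf_eq0 orbb => /eqP.
Qed.

Lemma constant_of_derive0 n (f : R -> 'rV[R]_n) : smooth_open setT (f : R^o -> _) ->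
  (forall t, derive1 f t = 0) -> forall s t, f s = f t.
Proof.
move=> fs f0 s t; apply/rowP => i.
apply: (is_derive_0_is_cst (f := fun r => f r 0 i)) => r.
have fd := smooth_derive1 r fs.
by have := (is_derive_mxP _ _ _ _).1 fd 0 i; rewrite f0 mxE.
Qed.

Lemma derive1_comp0 (V W : normedModType R) (A : set V) (G : V -> W) (c : R -> V) (t : R) :
  smooth_open A G -> smooth_open setT (c : R^o -> V) -> A (c t) ->
  derive1 c t = 0 -> derive1 (fun t => G (c t)) t = 0.
Proof.
move=> Gs cs At c0; apply: is_derive1.
have := @is_derive_chain R R^o V W c G t 1 0 _ _ _; rewrite derive0; apply.
- exact: (smooth_open_diff cs).
- exact: smooth_open_diff Gs At.
- by rewrite -[LHS]derive1E.
Qed.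

End Calculus.

Section CircularPathGeometry.
Variable R : realType.
Implicit Types p v u m x y U : 'rV[R]_3.
Notation V := ('rV[R]_4 * 'M[R]_4)%type.
Notation N := (contact_elements (@S2 R)).
Variable D : V -> set V.
Hypothesis Dcpg : circular_path_geometry D.

Let Dline : smooth_line_field N D. Proof. by case: Dcpg => -[]. Qed.
Let Dcontact : forall e, N e -> D e `<=` contact_plane (@S2 R) e.
Proof. by case: Dcpg => -[]. Qed.
Let Dtrans : forall e w, N e -> D e w -> w.1 = 0 -> w = 0.
Proof. by case: Dcpg => -[]. Qed.
Let Dcirc : forall C, paths (@S2 R) D C -> is_circle C.
Proof. by case: Dcpg. Qed.
Let oT : open (setT : set R^o) := openT.

Lemma mulmx_line4 (q : 'rV[R]_4) v : q *m line v = dot q (im v) *: im v.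
Proof. by rewrite /line mulmxA dot_mulmx mul_scalar_mx. Qed.

(** Legendrian: the point moves along the contact direction.  Transverse: it moves
    at nonzero speed. *)
Lemma D_span p v (X : V) : frame p v -> X != 0 ->
  D (celem p v) = [set w | exists a : R, w = a *: X] ->
  dot X.1 (im v) != 0 /\ X.1 = dot X.1 (im v) *: im v.
Proof.
move=> F X0 DX; have Ne := contact_celem F.
have DXX : D (celem p v) X by rewrite DX; exists 1; rewrite scale1r.
have [_ /=] := Dcontact Ne DXX; rewrite mulmx_line4 => E.
split; last by rewrite E.
apply: contra_neq X0 => d0; apply: (Dtrans Ne DXX).
by rewrite -E d0 scale0r.
Qed.

Lemma D_ex p v : frame p v -> exists X : V, X != 0 /\
  D (celem p v) = [set w | exists a : R, w = a *: X].
Proof.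
move=> F; have [_ /(_ _ (contact_celem F))[A [X [oA Ae Xs XD]]]] := Dline.
by exists (X (celem p v)); apply: XD => //; exact: contact_celem.
Qed.

(** Normalise a vector of D at (p, v) so that the point moves with velocity v, and
    let dv be the velocity of the direction.  The second component is then
    dv^T v + v^T dv, from which p x v and v extract <p x v, dv>. *)
Definition leaf_curv p v : R :=
  let w := xget 0 [set w | D (celem p v) w /\ w.1 = im v] in
  (im (cross p v) *m w.2 *m (im v)^T) 0 0.

Lemma leaf_curvE p v (w : V) : frame p v -> D (celem p v) w -> w.1 = im v ->
  leaf_curv p v = (im (cross p v) *m w.2 *m (im v)^T) 0 0.
Proof.
move=> F Dw w1; rewrite /leaf_curv; case: xgetP => [w' _ [Dw' w1']|H]; last by case: (H w).
have [X [X0 DX]] := D_ex F; have [d0 _] := D_span F X0 DX.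
have X10 : X.1 != 0 by apply: contra_neq d0 => ->; rewrite dot0l.
suff -> : w' = w by [].
move: Dw Dw'; rewrite DX => -[a aE] [b bE]; rewrite aE bE; congr (_ *: _).
have : a *: X.1 = b *: X.1.
  by rewrite -[LHS]/((a *: X).1) -[RHS]/((b *: X).1) -aE -bE w1 w1'.
move/eqP; rewrite -subr_eq0 -scalerBl scaler_eq0 (negPf X10) orbF subr_eq0.
by move/eqP.
Qed.

(** A formula free of choices, from which smoothness and oddness are read off. *)
Lemma leaf_curv_span p v (X : V) : frame p v -> X != 0 ->
  D (celem p v) = [set w | exists a : R, w = a *: X] ->
  leaf_curv p v = (im (cross p v) *m X.2 *m (im v)^T) 0 0 / dot X.1 (im v).
Proof.
move=> F X0 DX; have [d0 XE] := D_span F X0 DX.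
rewrite (@leaf_curvE p v ((dot X.1 (im v))^-1 *: X)) //.
- by rewrite /= -scalemxAr -scalemxAl mxE mulrC.
- by rewrite DX; exists (dot X.1 (im v))^-1.
- by rewrite /= {2}XE scalerA mulVf // scale1r.
Qed.

Lemma leaf_curvN p v : frame p v -> leaf_curv p (- v) = - leaf_curv p v.
Proof.
move=> F; have [X [X0 DX]] := D_ex F.
have E : celem p (- v) = celem p v by rewrite /celem lineN.
rewrite (leaf_curv_span F X0 DX) (@leaf_curv_span _ _ X) ?E //; last exact: frame_opp.
rewrite crossNr !imN dotNr invrN mulrN linearN /= mulmxN mulNmx.
by rewrite !mulNmx opprK.
Qed.

Lemma smooth_leaf_curv : smooth_on_frames leaf_curv.
Proof.
move=> W A P Q oA Ps Qs F.
apply: (smooth_local oA) => z0 Az0.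
have [_ /(_ _ (contact_celem (F _ Az0)))[B [X [oB Be Xs XD]]]] := Dline.
have ls := smooth_celem oA Ps Qs.
pose A' := A `&` (fun z => celem (P z) (Q z)) @^-1` B.
have oA' : open A' by exact: open_smooth_preimage.
have AA z : A' z -> A z by case.
have XX z : A' z -> X (celem (P z) (Q z)) != 0 /\ D (celem (P z) (Q z)) =
    [set w | exists a : R, w = a *: X (celem (P z) (Q z))].
  by move=> [Az Bz]; apply: XD => //; exact/contact_celem/F.
have sub (W' : normedModType R) (f : W -> W') : smooth_open A f -> smooth_open A' f.
  by apply: smooth_open_sub; exact: AA.
exists A', (fun z => leaf_curv (P z) (Q z)); split=> //.
pose Y z := X (celem (P z) (Q z)).
have Ys : smooth_open A' Y.
  apply: (@smooth_comp _ _ _ oA' _ _ _ _ B X (fun z => celem (P z) (Q z))) => //.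
    exact: sub.
  by move=> z [].
have {}Ps := sub _ _ Ps; have {}Qs := sub _ _ Qs.
apply: (@smooth_eq _ _ _ oA' _ (fun z => (im (cross (P z) (Q z)) *m (Y z).2 *m (im (Q z))^T) 0 0 *
   (dot (Y z).1 (im (Q z)))^-1 : R^o)); last first.
  move=> z Az; have [Y0 DY] := XX z Az.
  by rewrite (leaf_curv_span (F _ (AA _ Az)) Y0 DY).
apply: smoothM => //.
  apply: smooth_entry => //; apply: smooth_mulmx => //.
    apply: smooth_mulmx => //; last exact: smooth_snd.
    by apply: smooth_im => //; exact: smooth_cross.
  by apply: smooth_trmx => //; exact: smooth_im.
apply: smoothV => //.
  apply: smooth_dot => //; [exact: smooth_fst|exact: smooth_im].
move=> z Az; have [Y0 DY] := XX z Az.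
by have [] := D_span (F _ (AA _ Az)) Y0 DY.
Qed.

(** * Leaves over a circle *)

(** Integral curves may stop and turn back, so the point of the curve cannot be
    used as a parameter; statements along such a curve are proved by
    [zero_or_critical] instead. *)
Definition leaf_curve e (c : R -> V) :=
  [/\ smooth_curve N c, (forall t, D (c t) (derive1 c t)) & c 0 = e].

Lemma D_scale e w (a : R) : N e -> D e w -> D e (a *: w).
Proof.
move=> /contact_elementsP[p [v [F ->]]].
have [X [_ ->]] := D_ex F; move=> [b ->]; exists (a * b).
by rewrite scalerA.
Qed.

Lemma leaf_curve_leaf e c t : leaf_curve e c -> leaf N D e (c t).
Proof.
move=> [[cs cN] cD c0]; exists (fun s => c (t * s)); split.
- split; last by move=> s; exact: cN.
  apply: (@smooth_comp _ _ _ oT _ _ _ _ setT c (fun s : R^o => t * s : R^o)) => //.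
  by apply: smoothM => //; [exact: smooth_cst|exact: smooth_id].
- move=> s; have -> : derive1 (fun s => c (t * s)) s = t *: derive1 c (t * s).
    apply: is_derive1; exact: is_derive_reparam (smooth_derive1 _ cs) (is_derive_scal1 t s).
  exact: D_scale.
- by rewrite mulr0.
- by rewrite mulr1.
Qed.

Lemma leaf_curve_moves e c t : leaf_curve e c -> (c t).1 <> e.1 ->
  exists s, (derive1 c s).1 <> 0.
Proof.
move=> [[cs cN] cD c0] ne; apply: contrapT => /forallNP H; apply: ne.
rewrite -c0; apply: (@constant_of_derive0 _ _ (fun s => (c s).1)).
  exact: smooth_fst.
move=> s; have /contrapT <- := H s; apply: is_derive1.
apply: is_derive_fst; last exact: smooth_derive1.
exact: (smooth_open_diff cs).
Qed.

Section circle.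
Variables (p0 v0 U : 'rV[R]_3) (k : R).
Hypothesis F0 : frame p0 v0.
Hypothesis UU : dot U U = 1 + k ^+ 2.
Hypothesis path : fst @` leaf N D (celem p0 v0) = circ U k.

Lemma path_pos : dot U p0 = k.
Proof.
have : circ U k (im p0).
  rewrite -path; exists (celem p0 v0) => //.
  suff H : leaf_curve (celem p0 v0) (fun=> celem p0 v0) by exact: (leaf_curve_leaf 0 H).
  split=> //.
    split=> [|t]; first exact: smooth_cst.
    exact: contact_celem.
  move=> t; have [X [_ ->]] := D_ex F0; exists 0; rewrite scale0r.
  exact: is_derive1 (is_derive_const _ _ _).
by rewrite /circ /= dot_im dotC => -[].
Qed.

Section curve.
Variable c : R -> V.
Hypothesis cl : leaf_curve (celem p0 v0) c.

Let pos t := imp (c t).1.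

Let cs : smooth_open setT (c : R^o -> V). Proof. by case: cl => -[]. Qed.

Let pos_smooth : smooth_open setT (pos : R^o -> _).
Proof. by apply: smooth_imp => //; exact: smooth_fst. Qed.

Let pos_frame t : exists2 v, frame (pos t) v & c t = celem (pos t) v.
Proof.
have [[_ cN] _ _] := cl; have /contact_elementsP[p [v [F E]]] := cN t.
by rewrite /pos E imK; exists v.
Qed.

Let pos_circ t : dot (pos t) (pos t) = 1 /\ dot U (pos t) = k.
Proof.
have [v [pp _ _] E] := pos_frame t; split=> //.
have : circ U k (c t).1 by rewrite -path; exists (c t) => //; exact: leaf_curve_leaf.
by rewrite E /circ /= dot_im dotC => -[].
Qed.

(* The unit tangent of the oriented circle at the current point. *)
Let tau t := cross U (pos t).

Let tau_frame t : frame (pos t) (tau t).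
Proof. by have [pp Up] := pos_circ t; exact: circle_frame UU pp Up. Qed.

Let c1_derive (t : R) : is_derive t 1 (fun s => (c s).1) (derive1 c t).1.
Proof.
apply: is_derive_fst; last exact: smooth_derive1.
exact: (smooth_open_diff cs).
Qed.

Let pos_derive (t : R) : is_derive t 1 pos (imp (derive1 c t).1).
Proof. exact: is_derive_imp. Qed.

Let pos_derive_im t : im (imp (derive1 c t).1) = (derive1 c t).1.
Proof.
apply: impK; have [_ <-] := (is_derive_mxP _ _ _ _).1 (c1_derive t) 0 0.
have -> : (fun s => (c s).1 0 0) = (fun=> 0 : R).
  by apply/funext => s; have [v _ ->] := pos_frame s; rewrite im00.
by have [_ ->] := is_derive_const (0 : R) t 1.
Qed.

(* The velocity is orthogonal to the position and, as <U, pos> is constant, to U. *)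
Let pos_derive_tau t : imp (derive1 c t).1 = dot (imp (derive1 c t).1) (tau t) *: tau t.
Proof.
set d := imp _; have F := tau_frame t; have [pp Up] := pos_circ t.
have H1 : dot d (pos t) = 0.
  rewrite dotC /d -(is_derive1 (pos_derive t)).
  exact: sphere_velocity pos_smooth (fun s => proj1 (pos_circ s)).
  have H2 : dot d U = 0.
  have [_] := is_derive_dot (is_derive_const U t 1) (pos_derive t).
  have -> : (fun s => dot U (pos s)) = (fun=> k).
    by apply/funext => s; case: (pos_circ s).
  have [_ ->] := is_derive_const (k : R) t 1.
  by rewrite dot0l add0r dotC -/d.
have H3 : dot d (cross (pos t) (tau t)) = 0.
  have E := circle_centre pp Up; rewrite -/(tau t) in E.
  by move: H2; rewrite -E /centre dotDr dotZr H1 mulr0 add0r.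
by rewrite {1}(frame_expand d F) H1 H3 !scale0r add0r addr0.
Qed.

(* By transversality, a leaf stops when its point does. *)
Let stop t : (derive1 c t).1 = 0 -> derive1 c t = 0.
Proof.
by have [[_ cN] cD _] := cl; exact: Dtrans (cN t) (cD t).
Qed.

Let tau_smooth : smooth_open setT (tau : R^o -> _).
Proof. by apply: smooth_cross => //; exact: smooth_cst. Qed.

(* For a contact element of direction v this is <tau, v>^2 - 1: it measures how far
   the contact element is from being tangent to the circle. *)
Let defect t : R := dot (im (tau t) *m (c t).2) (im (tau t)) - 1.

Let defectE t v : c t = celem (pos t) v -> defect t = dot (tau t) v ^+ 2 - 1.
Proof.
by move=> E; rewrite /defect E /= mulmx_line dot_im dotZl (dotC v) expr2.
Qed.

Let defect_eq t : (derive1 c t).1 <> 0 -> defect t = 0.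
Proof.
move=> ne; have [v Fv E] := pos_frame t.
rewrite (defectE E).
have [[_ cN] cD _] := cl.
have [_ /=] := Dcontact (cN t) (cD t).
rewrite E /= -pos_derive_im mulmx_line => /im_inj.
have := pos_derive_tau t; set d := imp _.
set a := dot d (tau t); set b := dot d v => dt dv.
have [_ vv _] := Fv; have [_ tt _] := tau_frame t.
have a0 : a != 0.
  apply/eqP => a0; apply: ne; rewrite -pos_derive_im -/d dt a0 scale0r.
  exact: im0.
have aE : a = b * dot (tau t) v by rewrite /a -dv dotZl dotC.
have bE : b = a * dot (tau t) v by rewrite /b {1}dt dotZl.
have : a * (dot (tau t) v ^+ 2 - 1) = 0 by rewrite mulrBr mulr1 {2}aE bE; ring.
by move/eqP; rewrite mulf_eq0 (negPf a0) /= => /eqP.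
Qed.

Let defect_smooth : smooth_open setT (defect : R^o -> R^o).
Proof.
apply: smoothB => //; last exact: smooth_cst.
have ts : smooth_open setT (fun t : R^o => im (tau t)) by exact: smooth_im.
apply: smooth_dot => //; apply: smooth_mulmx => //; exact: smooth_snd.
Qed.

Let defect_cases t : defect t = 0 \/ derive1 defect t = 0.
Proof.
have [d0|/eqP d0] := eqVneq (derive1 c t).1 0; last by left; exact: defect_eq.
right; pose G (e : V) : R^o := dot (im (cross U (imp e.1)) *m e.2) (im (cross U (imp e.1))) - 1.
have oV : open [set: V] by exact: openT.
have Gs : smooth_open setT G.
  have i := smooth_id oV.
  have ts : smooth_open [set: V] (fun e => im (cross U (imp e.1))).
    apply: smooth_im => //; apply: smooth_cross => //; first exact: smooth_cst.
    by apply: smooth_imp => //; exact: smooth_fst.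
  apply: smoothB => //; last exact: smooth_cst.
  by apply: smooth_dot => //; apply: smooth_mulmx => //; exact: smooth_snd.
exact: (derive1_comp0 Gs cs (t := t) I (stop d0)).
Qed.

Lemma curve_defect : (exists t, (c t).1 <> im p0) -> dot (cross U p0) v0 ^+ 2 = 1.
Proof.
move=> [t ne]; have [s s0] := leaf_curve_moves cl ne.
have [_ _ c0] := cl.
have E : defect 0 = 0.
  exact: (zero_or_critical defect_smooth defect_cases _ (defect_eq s0)).
have p0E : pos 0 = p0 by rewrite /pos c0 imK.
have := @defectE 0 v0; rewrite c0 p0E E => /(_ erefl) /esym/eqP.
by rewrite subr_eq0 /tau p0E => /eqP.
Qed.

Hypothesis v0E : v0 = cross U p0.

Lemma curve_celem t : c t = celem (pos t) (tau t).
Proof.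
have [_ _ c0] := cl.
have p0E : pos 0 = p0 by rewrite /pos c0 imK.
have E0 : defect 0 = 0.
  rewrite (@defectE 0 v0) ?c0 ?p0E // /tau p0E -v0E.
  by have [_ -> _] := F0; rewrite expr1n subrr.
have E : defect t = 0.
  exact: (zero_or_critical defect_smooth defect_cases _ E0).
have [v Fv cE] := pos_frame t.
have [_ vv _] := Fv; have [_ tt _] := tau_frame t.
move: E; rewrite (defectE cE) => /eqP; rewrite subr_eq0 cE => /eqP E.
have [->//|->] := unit_collinear tt vv E.
by rewrite /celem lineN.
Qed.

(* The difference between the curvature prescribed by D along the circle and the
   curvature of the circle. *)
Let gap t : R := leaf_curv (pos t) (tau t) - k.

Let gap_smooth : smooth_open setT (gap : R^o -> R^o).
Proof.
apply: smoothB => //; last exact: smooth_cst.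
by apply: smooth_leaf_curv => //.
Qed.

(* While the point moves, the velocity of the lift lies in D, and the curvature
   read from it is that of the circle. *)
Let gap_eq t : (derive1 c t).1 <> 0 -> gap t = 0.
Proof.
move=> ne; have [[_ cN] cD _] := cl.
have F := tau_frame t; have [pp Up] := pos_circ t.
have [_ tt _] := F.
have := pos_derive_tau t; set d := imp _; set a := dot d (tau t) => dE.
have a0 : a != 0.
  apply/eqP => a0; apply: ne; rewrite -pos_derive_im -/d dE a0 scale0r.
  exact: im0.
have td : is_derive t 1 tau (a *: cross U (tau t)).
  have := is_derive_cross (is_derive_const U t 1) (pos_derive t).
  by rewrite -/d dE crossZr cross0l add0r.
have cE : c = fun t => celem (pos t) (tau t) by apply/funext => s; exact: curve_celem.
have c'E : derive1 c t = dcelem (pos t) (tau t) d (a *: cross U (tau t)).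
  rewrite {1}cE; apply: is_derive1.
  exact: (is_derive_celem oT (t := t) I pos_smooth tau_smooth (pos_derive t) td).
have Dw : D (celem (pos t) (tau t)) (a^-1 *: derive1 c t).
  by rewrite -curve_celem; apply: D_scale; [exact: cN|exact: cD].
rewrite /gap (leaf_curvE F Dw); last first.
  by rewrite c'E /= dE imZ scalerA mulVf // scale1r.
apply/eqP; rewrite subr_eq0; apply/eqP.
rewrite c'E /= imZ.
set n := cross (pos t) (tau t); set dt := cross U (tau t).
have -> : a^-1 *: ((a *: im dt)^T *m im (tau t) + (im (tau t))^T *m (a *: im dt)) =
    (im dt)^T *m im (tau t) + (im (tau t))^T *m im dt.
  rewrite linearZ /= -scalemxAl -scalemxAr -scalerDr scalerA mulVf //.
  by rewrite scale1r.
rewrite mulmxDr mulmxDl !mulmxA !(dot_mulmx (im n)) !mul_scalar_mx -!scalemxAl.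
rewrite !dot_mulmx !dot_im.
have -> : dot n (tau t) = 0 by rewrite dotC; exact: dot_crossr.
rewrite tt scale0r addr0 !mxE eqxx mulr1.
have nE : n = U - k *: pos t.
  by rewrite /n /tau cross_cross pp (dotC _ U) Up scale1r.
have -> : dt = k *: U - (1 + k ^+ 2) *: pos t.
  by rewrite /dt /tau cross_cross Up UU.
have Un : dot U (pos t) = k := Up.
rewrite nE; clear nE td c'E dE; move: Un UU pp; clear -R; move: (pos t) => q.
by move=> Uq UU qq; rewrite !dotE Uq UU qq (dotC q) Uq; ring.
Qed.

(* [leaf_curv] is smooth only along frames, so the gap is written as a smooth
   function G of the position by means of the retraction P of a neighbourhood of
   the circle onto it; where the position is stationary, so is the gap. *)
Let gap_cases t : gap t = 0 \/ derive1 gap t = 0.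
Proof.
have [d0|/eqP d0] := eqVneq (derive1 c t).1 0; last by left; exact: gap_eq.
right.
pose q y := y - (rho k ^+ 2 * dot U y) *: U.
pose P y := (rho k ^+ 2 * k) *: U + rho k *: unitv (q y).
have rk := rho_gt0 k.
have Uq y : dot U (q y) = 0.
  rewrite /q dotDr dotNr dotZr UU.
  transitivity (dot U y * (1 - rho k ^+ 2 * (1 + k ^+ 2))); first ring.
  by rewrite rho_sqM subrr mulr0.
have Uu y : dot U (unitv (q y)) = 0 by rewrite /unitv dotZr Uq mulr0.
have UP y : dot U (P y) = k.
  move: (Uu y); rewrite /P; move: (unitv (q y)) => z Uz.
  rewrite dotDr !dotZr Uz UU; transitivity (k * (rho k ^+ 2 * (1 + k ^+ 2))); first ring.
  by rewrite rho_sqM mulr1.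
have PP y : q y != 0 -> dot (P y) (P y) = 1.
  move=> q0; rewrite {1}/P dotDl [dot (_ *: U) _]dotZl UP [dot (_ *: unitv _) _]dotZl.
  have -> : dot (unitv (q y)) (P y) = rho k.
    move: (Uu y) (dot_unitv q0); rewrite /P; move: (unitv (q y)) => z Uz zz.
    by rewrite dotDr !dotZr zz (dotC _ U) Uz; ring.
  by rewrite -[RHS](rho_sqM k); ring.
pose A := [set y | 0 < dot (q y) (q y)].
have oR : open [set: 'rV[R]_3] by exact: openT.
have i := smooth_id oR.
have qs : smooth_open [set: 'rV[R]_3] q.
  apply: smoothB => //; apply: smoothZ => //; last exact: smooth_cst.
  apply: smoothM => //; first exact: smooth_cst.
  by apply: smooth_dot => //; exact: smooth_cst.
have oA : open A by exact: open_dot_gt0.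
have qA y : A y -> q y != 0 by rewrite /A /= dot_gt0E.
have Ps : smooth_open A P.
  apply: smoothD => //; first exact: smooth_cst.
  apply: smoothZ => //; first exact: smooth_cst.
  apply: smooth_unitv => //; exact: smooth_open_sub qs.
pose G y : R^o := leaf_curv (P y) (cross U (P y)) - k.
have Gs : smooth_open A G.
  apply: smoothB => //; last exact: smooth_cst.
  apply: smooth_leaf_curv => //.
    by apply: smooth_cross => //; exact: smooth_cst.
  by move=> y Ay; apply: circle_frame (UP y) => //; apply: PP; exact: qA.
have qpos s : dot (q (pos s)) (q (pos s)) = rho k ^+ 2.
  have [pp Up] := pos_circ s.
  rewrite /q Up; move: (pos s) pp Up => y pp Up.
  rewrite !dotDl !dotDr !dotNl !dotNr !dotZl !dotZr pp UU (dotC y) Up.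
  have := rho_sqM k; move: (rho k ^+ 2) => r E.
  transitivity (1 - r * k ^+ 2 * 2 + r * k ^+ 2 * (r * (1 + k ^+ 2))); first ring.
  have E2 : r + r * k ^+ 2 = 1 by rewrite -[RHS]E; ring.
  by rewrite E mulr1; lra.
have Ppos s : P (pos s) = pos s.
  rewrite /P /unitv qpos sqrtr_sqr gtr0_norm // scalerA divff ?gt_eqF // scale1r /q.
  by have [_ ->] := pos_circ s; rewrite addrC subrK.
have -> : gap = fun t => G (pos t) by apply/funext => s; rewrite /G Ppos.
apply: (derive1_comp0 Gs pos_smooth); first by rewrite /A /= qpos exprn_gt0.
rewrite (is_derive1 (pos_derive t)) (stop d0) /=.
by apply: im_inj; rewrite impK ?im0 // mxE.
Qed.

Lemma curve_curvature s : (exists t, (c t).1 <> im p0) ->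
  leaf_curv (imp (c s).1) (cross U (imp (c s).1)) = k.
Proof.
move=> [t ne]; have [r r0] := leaf_curve_moves cl ne.
have : gap s = 0 by exact: (zero_or_critical gap_smooth gap_cases _ (gap_eq r0)).
by move/eqP; rewrite subr_eq0 => /eqP.
Qed.

End curve.
End circle.
(** * From path geometries to curvature functions *)

Lemma is_circle_circ C : is_circle C ->
  exists U k, dot U U = 1 + k ^+ 2 /\ C = circ U k.
Proof.
move=> [_ [h [/S2P[u -> uu] /andP[h1 h2] ->]]].
have h0 : 0 < 1 - h ^+ 2 by nra.
pose s := Num.sqrt (1 - h ^+ 2).
have s0 : 0 < s by rewrite sqrtr_gt0.
have s2 : s ^+ 2 = 1 - h ^+ 2 by rewrite sqr_sqrtr // ltW.
have sn : s != 0 by rewrite gt_eqF.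
exists (s^-1 *: u), (h / s); split.
  rewrite dotZl dotZr uu mulr1 -expr2 exprMn exprVn s2; field.
  by rewrite gt_eqF.
apply/seteqP; split=> y [yS yu]; split=> //.
  by rewrite imZ dotZr yu mulrC.
by move: yu; rewrite imZ dotZr mulrC => /(mulIf _) ->//; rewrite invr_eq0.
Qed.

Lemma circ_opp U k : circ (- U) (- k) = circ U k.
Proof.
apply/seteqP; split=> y [yS yU]; split=> //; move: yU; rewrite imN dotNr.
  by move/oppr_inj.
by move=> ->.
Qed.

Lemma leaf_point e (q : 'rV[R]_4) : (fst @` leaf N D e) q ->
  exists2 c, leaf_curve e c & (c 1).1 = q.
Proof.
move=> [_ [c [cs cD c0 <-]] <-]; exists c => //.
Qed.

(** The leaf reaches a point of the circle other than p, so it moves, and then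
    the defect vanishes identically: v is tangent to the circle at p.  The
    sign of (U, k) is chosen to match v. *)
Lemma path_tangent p v : frame p v -> exists U k,
  [/\ dot U U = 1 + k ^+ 2, fst @` leaf N D (celem p v) = circ U k,
      v = cross U p & dot U p = k].
Proof.
move=> F.
have [U [k [UU P]]] : exists U k, dot U U = 1 + k ^+ 2 /\
    fst @` leaf N D (celem p v) = circ U k.
  apply: is_circle_circ; apply: Dcirc; exists (celem p v) => //.
  exact: contact_celem.
have Up := path_pos F P.
have [pp vv pv] := F.
have FU := circle_frame UU pp Up.
have CU := circle_centre pp Up.
pose w := cross U p; pose y := circle_pos p w k (pi / 2).
have yC : circ U k (im y).
  split; first by apply/S2_im; exact: circle_pos_unit.
  by rewrite dot_im dotC -CU; exact: circle_pos_center.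
rewrite -P in yC; have [c cl cy] := leaf_point yC.
have ne : (c 1).1 <> im p by rewrite cy => /im_inj; exact: circle_pos_neq.
have wv : dot w v ^+ 2 = 1 by exact: (curve_defect UU P cl (ex_intro _ 1 ne)).
have [_ ww pw] := FU; rewrite -/w in ww pw.
have [vE|vE] := unit_collinear ww vv wv; first by exists U, k.
exists (- U), (- k); split.
- by rewrite dotNl dotNr opprK UU sqrrN.
- by rewrite circ_opp.
- by rewrite crossNl.
- by rewrite dotNl Up.
Qed.

(** Every other point of the circle is reached by an integral curve from (p, v),
    along which [leaf_curv] is the curvature of the circle. *)
Lemma path_of_frame p v : frame p v ->
  fst @` leaf N D (celem p v) = circ (centre p v (leaf_curv p v)) (leaf_curv p v)
  /\ forall p' v', frame p' v' ->
       centre p' v' (leaf_curv p v) = centre p v (leaf_curv p v) ->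
       leaf_curv p' v' = leaf_curv p v.
Proof.
move=> F; have [U [k [UU P vE Up]]] := path_tangent F.
have [pp vv pv] := F.
have FU := circle_frame UU pp Up.
have CU := circle_centre pp Up.
have curve p' : dot p' p' = 1 -> dot U p' = k -> p' <> p ->
    leaf_curv p' (cross U p') = k /\ leaf_curv p v = k.
  move=> pp' Up' ne.
  have pC : circ U k (im p') by split; [exact/S2_im|rewrite dot_im dotC].
  rewrite -P in pC; have [c cl cy] := leaf_point pC.
  have ex : exists t, (c t).1 <> im p by exists 1; rewrite cy => /im_inj.
  have K s := curve_curvature F UU P cl vE s ex.
  have K0 := K 0; have K1 := K 1.
  have [_ _ c0] := cl.
  by rewrite c0 imK -vE in K0; rewrite cy imK in K1.
have kE : leaf_curv p v = k.
  (* A quarter turn provides a point other than p. *)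
  pose w := cross U p; pose y := circle_pos p w k (pi / 2).
  have yU : dot U y = k by rewrite -{1}CU; exact: circle_pos_center.
  have yy : dot y y = 1 by exact: circle_pos_unit.
  by apply: (proj2 (curve y yy yU _)); exact: circle_pos_neq.
have UE : centre p v k = U by rewrite vE CU.
rewrite kE UE; split=> // p' v' F' E.
have [pp' _ _] := F'.
have Up' : dot U p' = k by rewrite -E dot_centrep.
have v'E : v' = cross U p' by rewrite -E cross_centre.
have [pE|ne] := eqVneq p' p; first by rewrite v'E pE -vE.
by rewrite v'E; apply: (proj1 (curve p' pp' Up' _)); exact/eqP.
Qed.

Let kC p v p' v' (F : frame p v) (F' : frame p' v') := proj2 (path_of_frame F) p' v' F'.

Theorem path_geometry_kappa : exists kappa : 'rV[R]_3 -> R,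
  [/\ smooth_function kappa, odd_function kappa, gradient_bound kappa &
      paths (@S2 R) D = engendered_family (graph_f_kappa kappa)].
Proof.
exists (kappa leaf_curv); split.
- exact: (kappa_smooth smooth_leaf_curv leaf_curvN kC).
- exact: (kappa_odd smooth_leaf_curv leaf_curvN kC).
- exact: (kappa_bound smooth_leaf_curv leaf_curvN kC).
rewrite engendered_graph; apply/seteqP; split=> C.
  move=> [e /contact_elementsP[p [v [F ->]]] ->].
  have [-> _] := path_of_frame F; apply: kcircle_centre; first exact: dot_centre.
  exact: (kappa_frame smooth_leaf_curv leaf_curvN kC F).
move=> [x xx ->].
have uE := unitv_S2plus xx.
have uu : dot (unitv x) (unitv x) = 1 by apply: dot_unitv; exact: S2plus_nz.
have [p [v [F kE E]]] := kappa_centre smooth_leaf_curv leaf_curvN kC uu.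
exists (celem p v); first exact: contact_celem.
have [-> _] := path_of_frame F.
have r0 := rho_gt0 (leaf_curv p v).
have kx : kappa leaf_curv x = leaf_curv p v by rewrite kE.
by rewrite /kcircle kx -uE -E scalerA mulVf ?scale1r // gt_eqF.
Qed.

End CircularPathGeometry.

(** * Consequences of the gradient bound *)

Section KappaSphere.
Variable R : realType.
Implicit Types p v u m x y g U : 'rV[R]_3.
Notation V := ('rV[R]_4 * 'M[R]_4)%type.
Notation N := (contact_elements (@S2 R)).
Variable kappa : 'rV[R]_3 -> R.
Hypothesis kappaS : smooth_function kappa.

Let oT : open (setT : set R^o) := openT.

(** The extension of kappa, rescaled to the unit sphere, that is constant on rays. *)
Definition radial x : R := kappa ((Num.sqrt 2)^-1 *: unitv x).

Lemma radial_S2plus x : x != 0 -> S2plus ((Num.sqrt 2)^-1 *: unitv x).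
Proof. by move=> x0; apply: S2plus_unit; exact: dot_unitv. Qed.

Lemma radialE x : S2plus x -> radial x = kappa x.
Proof.
by move=> xx; rewrite /radial unitv_S2plus // scalerA mulVf ?scale1r // sqrt2_neq0.
Qed.

Lemma radialZ (a : R) x : 0 < a -> radial (a *: x) = radial x.
Proof. by move=> a0; rewrite /radial unitvZ. Qed.

Lemma smooth_radial (V : normedModType R) (A : set V) (f : V -> 'rV[R]_3) :
  open A -> smooth_open A f -> (forall z, A z -> f z != 0) ->
  smooth_open A (fun z => radial (f z) : R^o).
Proof.
move=> oA fs f0; apply: (smooth_local oA) => z0 Az0.
have [B [g [oB Bz gs gE]]] := kappaS (radial_S2plus (f0 _ Az0)).
pose h z := (Num.sqrt 2)^-1 *: unitv (f z).
have hs : smooth_open A h.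
  by apply: smoothZ => //; [exact: smooth_cst|exact: smooth_unitv].
pose A' := A `&` h @^-1` B.
have oA' : open A' by exact: open_smooth_preimage.
exists A', (g \o h); split=> //.
  apply: (@smooth_comp _ _ _ oA' _ _ _ _ B g h) => //.
    by apply: smooth_open_sub hs => z [].
  by move=> z [].
by move=> z [Az Bz'] _; rewrite /radial gE //; exact/radial_S2plus/f0.
Qed.

Lemma radial_smooth : smooth_open [set x : 'rV[R]_3 | x != 0] (radial : _ -> R^o).
Proof.
have oN := @open_nonzero R.
by apply: (@smooth_radial _ _ id) => //; exact: smooth_id.
Qed.

Let rad_diff x : x != 0 -> differentiable (radial : _ -> R^o) x.
Proof. by move=> x0; exact: (smooth_open_diff radial_smooth). Qed.

(** The Euclidean gradient of the extension, halved because the round metric is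
    twice the Euclidean one. *)
Definition gradient_vector x : 'rV[R]_3 :=
  2^-1 *: \row_i ('d (radial : _ -> R^o) x (delta_mx 0 i) : R).

Lemma round_gradient_vector x w : x != 0 ->
  round_metric (gradient_vector x) w = 'd (radial : _ -> R^o) x w.
Proof.
move=> x0; rewrite {2}(row_sum_delta w) linear_sum /=.
rewrite /round_metric /gradient_vector dotZl mulrA divff // mul1r /dot.
by apply: eq_bigr => i _; rewrite linearZ /= mxE mulrC.
Qed.

Lemma derive_curve_S2plus (c : R -> 'rV[R]_3) (t : R) :
  smooth_curve (@S2plus R) c ->
  is_derive t 1 (fun t => kappa (c t)) ('d (radial : _ -> R^o) (c t) (derive1 c t)).
Proof.
move=> [cs cS]; have c0 := S2plus_nz (cS t).
have H := @is_derive_chain R R^o 'rV[R]_3 R^o c radial t 1 (derive1 c t).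
apply: (is_derive_fun (H _ _ _)).
- exact: (smooth_open_diff cs).
- exact: rad_diff.
- by rewrite -derive1E.
- by move=> s; exact: radialE.
- by rewrite deriveE //; exact: rad_diff.
Qed.

(** Homogeneity of the extension makes its gradient tangent to the sphere; a
    great circle with this velocity shows that it is a tangent vector in the
    sense of curves. *)
Lemma is_gradient_vector x : S2plus x -> is_gradient kappa x (gradient_vector x).
Proof.
move=> xx; have x0 := S2plus_nz xx; set g := gradient_vector x.
split; last first.
  move=> c cc c0; rewrite round_gradient_vector //.
  apply/esym; apply: is_derive1; rewrite -c0.
  exact: derive_curve_S2plus.
have xg : dot x g = 0.
  have : round_metric g x = 0.
    rewrite round_gradient_vector // -deriveE; last exact: rad_diff.
    have H := @is_derive_chain R R^o 'rV[R]_3 R^o (fun t : R => (1 + t) *: x) radial 0 1 x.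
    have d1 : is_derive (0 : R) 1 (fun t : R => (1 + t) *: x) x.
      have := is_derive_scale
        (is_derive_add (is_derive_const (1 : R) (0 : R) 1) (is_derive_id (0 : R) 1))
        (is_derive_const x (0 : R) 1).
      by rewrite scaler0 addr0 add0r scale1r.
    have [dd dE] := d1.
    have df : differentiable (fun t : R^o => (1 + t) *: x) 0 by apply/derivable1_diffP.
    have := H df _ dE; rewrite addr0 scale1r => /(_ (rad_diff x0)) [_ <-].
    transitivity ('D_1 (cst (radial x : R^o)) (0 : R^o)); last exact: derive_cst.
    have nb : \forall t \near (0 : R^o), `|t| < 1.
      by apply/nbhs_normP; exists 1 => //= t; rewrite /= sub0r normrN.
    apply: near_eq_derive; apply: filterS nb => t t1'.
    have t1 : 0 < 1 + t.
      by move: t1'; rewrite ltr_norml => /andP[]; lra.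
    by rewrite /= radialZ.
  by rewrite /round_metric (dotC g) => E; lra.
clearbody g.
have [g0|g0] := eqVneq g 0.
  rewrite g0; exists (fun=> x); split=> //.
    by split=> [|t //]; exact: smooth_cst.
  exact: is_derive1 (is_derive_const _ _ _).
have uu : dot (unitv x) (unitv x) = 1 by exact: dot_unitv.
have n0 := @sqrt2_neq0 R.
have uE := unitv_S2plus xx.
have F : frame (unitv x) (unitv g).
  by apply: frame_unitv => //; rewrite uE dotZl xg mulr0.
pose w := Num.sqrt 2 * Num.sqrt (dot g g).
exists (fun t => (Num.sqrt 2)^-1 *: circle_pos (unitv x) (unitv g) 0 (w * t)); split.
- split; last by move=> t; apply: S2plus_unit; exact: circle_pos_unit.
  apply: smoothZ => //; first exact: smooth_cst.
  by case: (smooth_circle_motion (unitv x) (unitv g) 0 w).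
- by rewrite mulr0 circle_pos0 uE scalerA mulVf // scale1r.
- apply: is_derive1.
  have H := is_derive_scale (is_derive_const ((Num.sqrt 2)^-1 : R) (0 : R) 1)
     (is_derive_circle_pos (unitv x) (unitv g) 0 w 0).
  apply: (is_derive_fun H) => //.
  rewrite scale0r add0r mulr0 circle_dir0 rho0 mulr1 /w /unitv !scalerA mulrA mulVf // mul1r.
  by rewrite divff ?scale1r // gt_eqF // sqrtr_gt0 dot_gt0.
Qed.

Lemma gradientP x : S2plus x -> is_gradient kappa x (gradient kappa x).
Proof.
move=> xx; rewrite /gradient; case: xgetP => [g _ //|/(_ (gradient_vector x)) []].
exact: is_gradient_vector.
Qed.

Hypothesis kappa_bd : gradient_bound kappa.

(** The point r u + m moves along a great circle with angular speed rho(r)^2, so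
    this is the gradient bound in the slope parameter. *)
Lemma radial_arc_derive u m (r : R) : frame u m ->
  exists2 d, is_derive r 1 (fun r => radial (r *: u + m)) d &
    d < (1 + radial (r *: u + m) ^+ 2) * rho r ^+ 2.
Proof.
move=> F; pose c (t : R) := (Num.sqrt 2)^-1 *: arcpos u m (t + r).
have FA s := frame_arcpos s F.
have cS t : S2plus (c t) by apply: S2plus_unit; case: (FA (t + r)).
have arcs : smooth_open (setT : set R^o) (arcpos u m : R^o -> _).
  by apply: smooth_arcpos => //; (try exact: smooth_cst); exact: smooth_id.
have cs : smooth_open (setT : set R^o) (c : R^o -> _).
  apply: smoothZ => //; first exact: smooth_cst.
  apply: (@smooth_comp _ _ _ oT _ _ _ _ setT (arcpos u m : R^o -> _)
    (fun t : R^o => t + r : R^o)) => //.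
  by apply: smoothD => //; [exact: smooth_id|exact: smooth_cst].
have radE s : radial (s *: u + m) = kappa ((Num.sqrt 2)^-1 *: arcpos u m s).
  by rewrite /radial -arcpos_unitv.
set x := (Num.sqrt 2)^-1 *: arcpos u m r.
have c0 : c 0 = x by rewrite /c add0r.
have xx : S2plus x by rewrite -c0.
set n := cross (arcpos u m r) (cross u m).
have nn : dot n n = 1 := dot_cross_frame (FA r).
have c'E : derive1 c 0 = (Num.sqrt 2)^-1 *: (rho r ^+ 2 *: n).
  have := is_derive_scale (is_derive_const ((Num.sqrt 2)^-1 : R) (0 : R) 1)
    (is_derive_shift0 (is_derive_arcpos r F)).
  by rewrite scale0r !add0r => /is_derive1.
have [_ /(_ c (conj cs cS) c0)] := gradientP xx.
have kd0 : is_derive (0 : R) 1 (kappa \o c) (derive1 (kappa \o c : R -> R^o) 0).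
  have H := derive_curve_S2plus 0 (conj cs cS).
  by rewrite (is_derive1 H).
set d := derive1 _ _ in kd0 *; rewrite c'E => dE.
exists d.
  have sd : is_derive (r : R) 1 (fun t : R => t - r) 1.
    by have := is_derive_sub (is_derive_id (r : R) 1) (is_derive_const (r : R) (r : R) 1);
       rewrite subr0.
  have := @is_derive_reparam R R (kappa \o c) (fun t => t - r) r d 1.
  rewrite subrr scale1r => /(_ kd0 sd) H; apply: (is_derive_fun H) => //.
  by move=> s; rewrite radE /= /c subrK.
set g := gradient kappa x in dE.
have := kappa_bd xx; rewrite /gradient_norm -/g /round_metric.
rewrite radE -/x -dE /round_metric !dotZr.
have r2 : 0 < rho r ^+ 2 by rewrite exprn_gt0 // rho_gt0.
move=> lt; apply: le_lt_trans (_ : Num.sqrt (2 * dot g g) * rho r ^+ 2 < _); last first.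
  by rewrite ltr_pM2r.
rewrite [leLHS](_ : _ = (Num.sqrt 2 * dot g n) * rho r ^+ 2); last first.
  have n0 := @sqrt2_neq0 R.
  by rewrite -{1}sqrt2_sq; field.
rewrite ler_pM2r // sqrtrM // ler_pM2l ?sqrt2_gt0 //.
apply: le_trans (ler_norm _) _; rewrite -sqrtr_sqr ler_wsqrtr //.
by have := cauchy_schwarz g n; rewrite nn mulr1.
Qed.

(** By [radial_arc_derive], atan s - atan (kappa (s u + m)) has positive
    derivative; it vanishes at every solution. *)
Lemma slope_unique u m r r' : frame u m ->
  radial (r *: u + m) = r -> radial (r' *: u + m) = r' -> r = r'.
Proof.
move=> F.
suff H a b : radial (a *: u + m) = a -> radial (b *: u + m) = b -> a < b -> False.
  move=> Er Er'; case: (ltgtP r r') => // lt; first by case: (H r r').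
  by case: (H r' r).
move=> Ea Eb ab.
pose f (s : R) := atan s - atan (radial (s *: u + m)).
have fd (s : R) : exists2 d, is_derive s 1 f d & 0 < d.
  have [d dd dlt] := radial_arc_derive s F.
  have H := is_derive_sub (is_derive1_atan s)
    (is_derive1_comp (is_derive1_atan (radial (s *: u + m))) dd).
  exists ((1 + s ^+ 2)^-1 - (1 + radial (s *: u + m) ^+ 2)^-1 * d); first exact: H.
  rewrite subr_gt0 mulrC ltr_pdivrMr ?sq1_gt0 // mulrC -rho_sq.
  exact: dlt.
have fc : {within `[a, b], continuous f}.
  apply: continuous_subspaceT => s; apply: differentiable_continuous.
  by apply/derivable1_diffP; have [d [fds _] _] := fd s.
have fdd s : s \in `]a, b[ -> derivable f s 1 by move=> _; have [d [fds _] _] := fd s.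
have fab : f a = f b by rewrite /f Ea Eb !subrr.
have [c _ [_ c0]] := Rolle ab fdd fc fab.
by have [d [_ <-]] := fd c; rewrite c0 ltxx.
Qed.

(** * The line field of a curvature function *)

Hypothesis kappaN : odd_function kappa.

(** The geodesic curvature of the circle of the family tangent to v at p, i.e. the
    one whose curvature equals kappa at its centre. *)
Definition slope p v : R := xget 0 [set r | radial (centre p v r) = r].

Lemma frame_cross p v : frame p v -> frame p (cross p v).
Proof. by move=> F; have [pp _ _] := F; split; rewrite ?dot_crossl ?dot_cross_frame. Qed.

Lemma slope_root p v r : frame p v -> radial (centre p v r) = r <-> r = slope p v.
Proof.
move=> F; have Fn := frame_cross F.
have [s sE] : exists s, radial (s *: p + cross p v) = s.
  apply: (exists_slope Fn); first by move=> a x; exact: radialZ.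
  by move=> b bs _ b0; exact: smooth_radial.
have E : radial (centre p v (slope p v)) = slope p v.
  by rewrite /slope; case: xgetP => [r' _ //|/(_ s) []].
split=> [rE|->//].
exact: (slope_unique Fn rE E).
Qed.

Lemma radN x : x != 0 -> radial (- x) = - radial x.
Proof.
move=> x0; rewrite /radial unitvN scalerN kappaN //.
exact: radial_S2plus.
Qed.

Lemma centre_nz p v r : frame p v -> centre p v r != 0.
Proof.
move=> F; apply/eqP => E; have := dot_centre r F; rewrite E dot0l => /eqP.
by rewrite eq_sym gt_eqF // sq1_gt0.
Qed.

Lemma slopeN p v : frame p v -> slope p (- v) = - slope p v.
Proof.
move=> F; apply/esym/(slope_root _ (frame_opp F)).
rewrite centre_opp radN; last exact: centre_nz.
by congr (- _); apply/(slope_root _ F).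
Qed.

Lemma slope_centre p v p' v' : frame p v -> frame p' v' ->
  centre p' v' (slope p v) = centre p v (slope p v) -> slope p' v' = slope p v.
Proof.
by move=> F F' E; apply/esym/(slope_root _ F'); rewrite E; apply/(slope_root _ F).
Qed.

Lemma radial_slope p v : frame p v -> radial (centre p v (slope p v)) = slope p v.
Proof. by move=> F; apply/(slope_root _ F). Qed.

(** [radial_arc_derive] at the solution, where the two factors of its bound
    cancel. *)
Lemma radial_centre_derive p v : frame p v ->
  'd (radial : _ -> R^o) (centre p v (slope p v)) p < 1.
Proof.
move=> F; have [d dd dlt] := radial_arc_derive (slope p v) (frame_cross F).
have E := radial_slope F.
move: dlt; rewrite -[radial _]/(radial (centre p v (slope p v))) E mulrC rho_sqM.
suff -> : d = 'd (radial : _ -> R^o) (centre p v (slope p v)) p by [].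
have [_ <-] := dd.
have sd : is_derive (slope p v) 1 (fun r : R => r *: p + cross p v) p.
  have := is_derive_add
    (is_derive_scale (is_derive_id (slope p v) 1) (is_derive_const p (slope p v) 1))
    (is_derive_const (cross p v) (slope p v) 1).
  by rewrite scaler0 !addr0 scale1r.
have [sdd sE] := sd.
have rd : differentiable (radial : _ -> R^o) (centre p v (slope p v)).
  by apply: (smooth_open_diff radial_smooth); exact: centre_nz.
have ds : differentiable (fun r : R^o => r *: p + cross p v) (slope p v).
  by apply/derivable1_diffP.
have [_ ->] := @is_derive_chain R R^o 'rV[R]_3 R^o (fun r => r *: p + cross p v) radial
  (slope p v) 1 p ds rd sE.
by rewrite deriveE.
Qed.

(** Implicit function theorem for kappa (r p + p x v) - r, whose derivative in r
    is negative at the root by [radial_arc_derive]. *)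
Lemma smooth_slope (W : normedModType R) {Wf : findim W} (A : set W) (P Q : W -> 'rV[R]_3) :
  open A -> smooth_open A P -> smooth_open A Q -> (forall z, A z -> frame (P z) (Q z)) ->
  smooth_open A (fun z => slope (P z) (Q z) : R^o).
Proof.
move=> oA Ps Qs F.
pose G (z : W * R^o) : R^o := radial (centre (P z.1) (Q z.1) z.2) - z.2.
have oAR : open [set z : W * R^o | A z.1] by exact: open_cylinder.
have i1 := smooth_fst oAR (smooth_id oAR).
have i2 := smooth_snd oAR (smooth_id oAR).
have sub (f : W -> 'rV[R]_3) : smooth_open A f ->
    smooth_open [set z : W * R^o | A z.1] (fun z => f z.1).
  by move=> fs; apply: (@smooth_comp _ _ _ oAR _ _ _ _ A f (fun z => z.1)).
apply: (root_smooth (F := G)) => //.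
- apply: smoothB => //; apply: smooth_radial => //.
    apply: smoothD => //; first by apply: smoothZ => //; exact: sub.
    by apply: smooth_cross => //; exact: sub.
  by move=> z Az; apply: centre_nz; exact: F.
- move=> z r Az; rewrite /G /= -(slope_root r (F z Az)).
  by split=> [/eqP|->]; rewrite ?subrr // subr_eq0 => /eqP.
- move=> z Az; rewrite derive_snd /G /=.
  have Fz := F z Az.
  have [d dd dlt] := radial_arc_derive (slope (P z) (Q z)) (frame_cross Fz).
  have [_ ->] := is_derive_sub dd (is_derive_id (slope (P z) (Q z)) 1).
  move: dlt; rewrite -[radial _]/(radial (centre (P z) (Q z) (slope (P z) (Q z)))).
  by rewrite radial_slope // mulrC rho_sqM => d1; rewrite lt_eqF // subr_lt0.
Qed.

(** The velocity of the contact elements of the oriented circle tangent to v at p,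
    traversed at unit speed. *)
Definition spray p v : V := dcelem p v v (bend p v (slope p v)).

Lemma dcelemN p v dp dv : dcelem p (- v) dp (- dv) = dcelem p v dp dv.
Proof.
by rewrite /dcelem !imN !trmx_mulNN.
Qed.

Lemma dcelemZ p v (a : R) dp dv : dcelem p v (a *: dp) (a *: dv) = a *: dcelem p v dp dv.
Proof.
rewrite /dcelem !imZ; congr (_, _).
by rewrite linearZ /= -scalemxAl -scalemxAr -scalerDr.
Qed.

Lemma sprayN p v : frame p v -> spray p (- v) = - spray p v.
Proof.
move=> F; rewrite /spray slopeN // -(scaleN1r (dcelem _ _ _ _)) -dcelemZ !scaleN1r.
rewrite -[in LHS](opprK (bend _ _ _)) dcelemN; congr (dcelem _ _ _ (- _)).
by rewrite /bend crossNr scaleNr scalerN opprK.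
Qed.

Definition spray_field (e : V) : set V :=
  [set w | exists p v (a : R), [/\ frame p v, e = celem p v & w = a *: spray p v]].

Lemma spray_fieldE p v : frame p v ->
  spray_field (celem p v) = [set w | exists a : R, w = a *: spray p v].
Proof.
move=> F; apply/seteqP; split=> w; last by move=> [a ->]; exists p, v, a.
move=> [p' [v' [a [F' E ->]]]].
have [-> [->|->]] := celem_inj F F' E; first by exists a.
by exists (- a); rewrite sprayN // scalerN scaleNr.
Qed.

Lemma spray_nz p v : frame p v -> spray p v != 0.
Proof.
move=> [_ vv _]; apply/eqP => E; have : (spray p v).1 = 0 by rewrite E.
rewrite /= => v0; have := dot_im v v; rewrite v0 dot0l vv => /eqP.
by rewrite eq_sym oner_eq0.
Qed.

(** The integral curves of the line field: contact elements of a circle of the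
    family, with constant slope by [slope_circle]. *)
Definition circle_lift p v (w t : R) : V :=
  celem (circle_pos p v (slope p v) (w * t)) (circle_dir p v (slope p v) (w * t)).

Lemma slope_circle p v t : frame p v ->
  slope (circle_pos p v (slope p v) t) (circle_dir p v (slope p v) t) = slope p v.
Proof.
move=> F; apply: slope_centre => //; first exact: circle_pos_frame.
exact: circle_pos_centre.
Qed.

Lemma circle_lift_derive p v w t : frame p v ->
  derive1 (circle_lift p v w) t = (w * rho (slope p v)) *:
    spray (circle_pos p v (slope p v) (w * t)) (circle_dir p v (slope p v) (w * t)).
Proof.
move=> F; have [s1 s2] := smooth_circle_motion p v (slope p v) w.
rewrite (is_derive1 (is_derive_celem oT (t := t) I s1 s2 (is_derive_circle_pos p v _ w t)
  (is_derive_circle_dir (slope p v) F w t))).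
by rewrite dcelemZ /spray slope_circle.
Qed.

Lemma circle_lift_curve p v w : frame p v -> smooth_curve N (circle_lift p v w).
Proof.
move=> F; split; last by move=> t; exact/contact_celem/circle_pos_frame.
by have [s1 s2] := smooth_circle_motion p v (slope p v) w; exact: smooth_celem.
Qed.

Lemma circle_lift0 p v w : circle_lift p v w 0 = celem p v.
Proof. by rewrite /circle_lift mulr0 circle_pos0 circle_dir0. Qed.

(** The line of e, applied to a fixed v0, selects one of its two unit vectors
    where v0 is not orthogonal to it.  Normalising and orthogonalising makes
    the choice into frames on an open set of the ambient space, as required
    for a smooth local generator. *)
Lemma frame_chart p0 v0 : frame p0 v0 -> exists (B : set V) (P Q : V -> 'rV[R]_3),
  [/\ open B, B (celem p0 v0), smooth_open B P, smooth_open B Q &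
   (forall e, B e -> frame (P e) (Q e)) /\
   (forall e, N e -> B e -> e = celem (P e) (Q e))].
Proof.
move=> F0; have oV : open [set: V] by exact: openT.
pose a (e : V) := imp e.1.
pose w (e : V) := imp (im v0 *m e.2).
pose b (e : V) := companion (w e) (a e).
have i := smooth_id oV.
have as_ : smooth_open [set: V] a by apply: smooth_imp => //; exact: smooth_fst.
have ws : smooth_open [set: V] w.
  apply: smooth_imp => //; apply: smooth_mulmx => //; first exact: smooth_cst.
  exact: smooth_snd.
have bs : smooth_open [set: V] b.
  by apply: smoothB => //; apply: smoothZ => //; exact: smooth_dot.
pose B := [set e : V | 0 < dot (a e) (a e)] `&` [set e | 0 < dot (b e) (b e)].
have oB : open B.
  by apply: openI; exact: open_dot_gt0.
have Ba e : B e -> a e != 0.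
  by move=> [/= + _]; rewrite dot_gt0E.
have Bb e : B e -> b e != 0.
  by move=> [_ /=]; rewrite dot_gt0E.
have ab p v : frame p v -> a (celem p v) = p /\ b (celem p v) = dot v0 v *: v.
  move=> [pp vv pv]; split; first by rewrite /a imK.
  rewrite /b /companion /w /a /= imK mulmx_line imK pp scale1r !dotE.
  by rewrite (dotC v) pv mulr0 scale0r subr0.
exists B, (fun e => unitv (a e)), (fun e => unitv (b e)); split=> //.
- have [aE bE] := ab _ _ F0; have [pp vv _] := F0.
  by split; rewrite /= ?aE ?bE ?vv ?scale1r ?pp ?vv.
- by apply: smooth_unitv => //; exact: smooth_open_sub as_.
- by apply: smooth_unitv => //; exact: smooth_open_sub bs.
split=> [e Be|e /contact_elementsP[p [v [F ->]]] Be].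
  by apply: frame_companion; [exact: Ba|exact: Bb].
have [aE bE] := ab _ _ F; have := Bb _ Be; rewrite aE bE.
have [pp vv _] := F; rewrite (unitv_id pp).
case: (ltgtP (dot v0 v) 0) => [lt|gt|->]; last by rewrite scale0r eqxx.
- by rewrite -[dot v0 v]opprK scaleNr unitvN unitvZ ?oppr_gt0 // unitv_id // /celem lineN.
- by rewrite unitvZ // unitv_id.
Qed.

Lemma spray_path_geometry : path_geometry (@S2 R) spray_field.
Proof.
have tan p v (a : R) : frame p v -> tangent_space N (celem p v) (a *: spray p v).
  move=> F; have r0 := rho_gt0 (slope p v).
  exists (circle_lift p v (a / rho (slope p v))); split.
  - exact: circle_lift_curve.
  - exact: circle_lift0.
  - by rewrite circle_lift_derive // divfK ?gt_eqF // mulr0 circle_pos0 circle_dir0.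
split.
- split=> [e /contact_elementsP[p [v [F ->]]] w|e /contact_elementsP[p0 [v0 [F0 ->]]]].
    by rewrite spray_fieldE // => -[a ->]; exact: tan.
  have [B [P [Q [oB B0 Ps Qs [BF BE]]]]] := frame_chart F0.
  exists B, (fun e => spray (P e) (Q e)); split=> //.
    have ss : smooth_open B (fun e => slope (P e) (Q e) : R^o) by exact: smooth_slope.
    have bs : smooth_open B (fun e => bend (P e) (Q e) (slope (P e) (Q e))).
      apply: smoothD => //; first exact: smoothN.
      by apply: smoothZ => //; exact: smooth_cross.
    have iQ := smooth_im oB Qs; have ib := smooth_im oB bs.
    apply: smooth_pair => //; apply: smoothD => //; apply: smooth_mulmx => //;
      exact: smooth_trmx.
  move=> e' Ne Be; split; first exact/spray_nz/BF.
  by rewrite {1}(BE e' Ne Be) spray_fieldE //; exact: BF.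
- move=> e /contact_elementsP[p [v [F ->]]] w; rewrite spray_fieldE // => -[a ->].
  split; first exact: tan.
  have [_ vv _] := F.
  by rewrite /= -scalemxAl mulmx_line vv scale1r.
- move=> e w /contact_elementsP[p [v [F ->]]]; rewrite spray_fieldE // => -[a ->] /= E.
  have [_ vv _] := F.
  have : dot (a *: im v) (im v) = 0 by rewrite E dot0l.
  by rewrite dotZl dot_im vv mulr1 => ->; rewrite scale0r.
Qed.

(** * The leaves are lifts of circles *)

Let k := slope.
Let D := spray_field.

(** The centre is defined up to sign by a contact element; U^T U is a global
    function of it. *)
Definition squared_centre (e : V) : 'M[R]_3 :=
  let U := xget 0 [set U | exists p v, [/\ frame p v, e = celem p v & U = centre p v (k p v)]] in
  U^T *m U.

Lemma squared_centreE p v : frame p v ->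
  squared_centre (celem p v) = (centre p v (k p v))^T *m centre p v (k p v).
Proof.
move=> F; rewrite /squared_centre.
case: xgetP => [U _ [p' [v' [F' E ->]]]|H]; last first.
  by case: (H (centre p v (k p v))); exists p, v.
have [-> [->//|->]] := celem_inj F F' E.
by rewrite /k (slopeN F) centre_opp trmx_mulNN.
Qed.

(** In a local choice of frames, p' = a v and v' = a bend give U' = r' p, where r
    is the slope.  Differentiating kappa (U) = r gives
    r' = r' (d kappa) (p), and (d kappa) (p) < 1, so r' = 0.  Thus U^T U is a
    first integral. *)
Lemma spray_curve_derive (c : R -> V) (t : R) : smooth_curve N c ->
  D (c t) (derive1 c t) ->
  forall i j, is_derive t 1 (fun s => squared_centre (c s) i j) 0.
Proof.
move=> [cs cN] Dt i j.
have [p0 [v0 [F0 E0]]] := (contact_elementsP _).1 (cN t).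
have [B [P [Q [oB B0 Ps Qs [BF BE]]]]] := frame_chart F0.
rewrite -E0 in B0.
pose T := (setT : set R^o) `&` (c : R^o -> V) @^-1` B.
have oTT : open T by exact: open_smooth_preimage.
have Tt : T t by [].
have nT : \forall s \near (t : R^o), T s by exact: open_nbhs_nbhs.
have csT : smooth_open T (c : R^o -> V) by exact: smooth_open_sub cs.
pose p s := P (c s); pose v s := Q (c s).
have ps : smooth_open T (p : R^o -> _).
  by apply: (@smooth_comp _ _ _ oTT _ _ _ _ B P c) => // s [].
have vs : smooth_open T (v : R^o -> _).
  by apply: (@smooth_comp _ _ _ oTT _ _ _ _ B Q c) => // s [].
have F s : T s -> frame (p s) (v s) by move=> [_ Bs]; exact: BF.
have cE s : T s -> c s = celem (p s) (v s) by move=> [_ Bs]; exact: BE.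
have ks : smooth_open T (fun s : R^o => k (p s) (v s) : R^o).
  exact: smooth_slope.
have der (W : normedModType R) (f : R -> W) : smooth_open T (f : R^o -> W) ->
    is_derive t 1 f (derive1 f t).
  move=> fs; rewrite derive1E; apply: derivableP; apply: diff_derivable.
  exact: (smooth_open_diff fs).
have dp := der _ _ ps; have dv := der _ _ vs; have dk := der _ (fun s => k (p s) (v s)) ks.
set p' := derive1 p t in dp; set v' := derive1 v t in dv; set k' := derive1 _ t in dk.
have Ft := F t Tt; have [pp vv pv] := Ft.
set r := k (p t) (v t).
have c'E : derive1 c t = dcelem (p t) (v t) p' v'.
  have H := is_derive_celem oTT Tt ps vs dp dv.
  apply: is_derive1; apply: near_eq_is_derive H.
  by apply: filterS nT => s Ts; rewrite cE.
move: Dt; rewrite (cE t Tt) c'E /D (spray_fieldE Ft) => -[a].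
rewrite /spray -dcelemZ -/k -/r => -[/im_inj p'E lE].
have vv' : dot (v t) v' = 0.
  have [_] := is_derive_dot dv dv.
  have -> : 'D_1 (fun s : R => dot (v s) (v s)) t = 'D_1 (fun=> 1 : R) t.
    by apply: near_eq_derive; apply: filterS nT => s Ts; have [_ -> _] := F s Ts.
  have [_ ->] := is_derive_const (1 : R) t 1.
  by rewrite (dotC v'); lra.
have vb : dot (v t) (bend (p t) (v t) r) = 0.
  by rewrite /bend dotDr dotNr dotZr (dotC (v t)) pv dot_crossr mulr0 oppr0 addr0.
(* The direction is recovered from the derivative of its projector, as v' is
   orthogonal to v. *)
have v'E : v' = a *: bend (p t) (v t) r.
  have H q : dot (v t) q = 0 ->
      im (v t) *m ((im q)^T *m im (v t) + (im (v t))^T *m im q) = im q.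
    move=> vq; rewrite mulmxDr !mulmxA !dot_mulmx !mul_scalar_mx !dot_im vv vq.
    by rewrite scale0r add0r scale1r.
  apply: im_inj; rewrite -(H v') // lE H //.
  by rewrite dotZr vb mulr0.
pose U s := k (p s) (v s) *: p s + cross (p s) (v s).
have dU : is_derive t 1 U (k' *: p t).
  have H := is_derive_add (is_derive_scale dk dp) (is_derive_cross dp dv).
  apply: (is_derive_fun H) => //.
  rewrite p'E v'E -/r !crossZl !crossZr crossvv scaler0 add0r /bend crossDr crossNr crossvv.
  rewrite oppr0 add0r crossZr [cross (p t) (cross _ _)]crossC (cross_frame2 Ft).
  by apply: row3P; rewrite !mxE; ring.
have Us : smooth_open T (U : R^o -> _).
  by apply: smoothD => //; [exact: smoothZ|exact: smooth_cross].
have UE s : T s -> radial (U s) = k (p s) (v s).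
  by move=> Ts; exact: (radial_slope (F s Ts)).
have U0 : U t != 0 by exact: centre_nz.
have rd : differentiable (radial : _ -> R^o) (U t).
  by apply: (smooth_open_diff radial_smooth).
(* Differentiate kappa (U) = k. *)
have k'0 : k' = 0.
  have Ud : differentiable (U : R^o -> _) t by exact: (smooth_open_diff Us).
  have [_ dUE] := dU.
  have [_] := @is_derive_chain R R^o 'rV[R]_3 R^o U radial t 1 _ Ud rd dUE.
  have -> : 'D_1 (fun s : R^o => radial (U s) : R^o) t = k'.
    have -> : 'D_1 (fun s : R^o => radial (U s) : R^o) t =
        'D_1 (fun s : R^o => k (p s) (v s) : R^o) t.
      by apply: near_eq_derive; apply: filterS nT => s Ts; exact: UE.
    by case: dk.
  rewrite deriveE // linearZ /= => kE.
  have lt := radial_centre_derive Ft.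
  have : k' * (1 - 'd (radial : _ -> R^o) (U t) (p t)) = 0.
    by rewrite mulrBr mulr1 {1}kE subrr.
  move/eqP; rewrite mulf_eq0 => /orP[/eqP//|].
  by rewrite subr_eq0 => /eqP e1; move: lt; rewrite -/radial -/(U t) -e1 ltxx.
rewrite k'0 scale0r in dU.
have dsq := is_derive_mulmx (is_derive_trmx dU) dU.
rewrite trmx0 mul0mx mulmx0 addr0 in dsq.
have := (is_derive_mxP _ _ _ _).1 dsq i j; rewrite mxE => H.
apply: near_eq_is_derive H.
by apply: filterS nT => s Ts; rewrite (cE s Ts) squared_centreE //; exact: F.
Qed.

(** On a leaf U^T U is constant, so the centre is constant up to sign, and the
    sign of the curvature follows that of the centre since kappa is odd: the
    leaf stays over one circle.  Conversely [circle_lift] reaches all of it. *)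
Lemma spray_path p v : frame p v ->
  fst @` leaf N D (celem p v) = circ (centre p v (k p v)) (k p v).
Proof.
move=> F; apply/seteqP; split=> [_ [_ [c [[cs cN] cD c0 <-]] <-]|q [/S2P[y -> yy]]].
  have sqE : squared_centre (c 1) = squared_centre (c 0).
    apply/matrixP => i j.
    apply: (is_derive_0_is_cst (f := fun s => squared_centre (c s) i j)) => s.
    exact: spray_curve_derive.
  have [p1 [v1 [F1 E1]]] := (contact_elementsP _).1 (cN 1).
  move: sqE; rewrite c0 E1 !squared_centreE //.
  set U1 := centre p1 v1 _; set U0 := centre p v _ => E.
  have [pp _ _] := F1.
  split; first exact/S2_im.
  rewrite /= dot_im dotC.
  have D1 : dot U1 U1 = 1 + k p1 v1 ^+ 2 := dot_centre _ F1.
  have D0 : dot U0 U0 = 1 + k p v ^+ 2 := dot_centre _ F.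
  have H : dot U0 U1 *: U1 = dot U0 U0 *: U0.
    have := congr1 (fun A => U0 *m A) E.
    by rewrite !mulmxA !dot_mulmx !mul_scalar_mx.
  have U1p : dot U1 p1 = k p1 v1 by exact: dot_centrep.
  have D00 : 0 < dot U0 U0 by rewrite D0 sq1_gt0.
  pose b := dot U0 U1 / dot U0 U0.
  have U0E : U0 = b *: U1.
    by rewrite /b mulrC -scalerA H scalerA mulVf ?scale1r // gt_eqF.
  have b0 : b != 0.
    by apply: contraTneq D00 => b0; rewrite U0E b0 scale0r dot0l ltxx.
  have K0 : radial U0 = k p v := radial_slope F.
  have K1 : radial U1 = k p1 v1 := radial_slope F1.
  have U1n : U1 != 0 by exact: centre_nz.
  have kE : k p v = k p1 v1 /\ 0 < b \/ k p v = - k p1 v1 /\ b < 0.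
    case: (ltgtP b 0) b0 => // bs _; [right|left]; split=> //; rewrite -K0 -K1 U0E.
      have -> : b *: U1 = - (- b *: U1) by rewrite scaleNr opprK.
      rewrite radN //; last by rewrite scaler_eq0 oppr_eq0 negb_or lt_eqF.
      by rewrite radialZ // oppr_gt0.
    by rewrite radialZ.
  have b2 : b ^+ 2 = 1.
    have : b ^+ 2 * dot U1 U1 = dot U1 U1.
      transitivity (dot U0 U0); first by rewrite U0E dotZl dotZr; ring.
      by rewrite D0 D1; case: kE => -[-> _]; rewrite ?sqrrN.
    move/eqP; rewrite -subr_eq0 -[X in _ - X]mul1r -mulrBl mulf_eq0 => /orP[].
      by rewrite subr_eq0 => /eqP.
    by rewrite D1 gt_eqF // sq1_gt0.
  rewrite U0E dotZl U1p.
  move/eqP: b2; rewrite -(expr1n _ 2) eqf_sqr => /orP[] /eqP bE.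
    by rewrite bE mul1r; case: kE => -[-> // bs]; lra.
  by rewrite bE mulN1r; case: kE => -[-> // bs]; lra.
rewrite dot_im dotC => Uy.
have [t ->] := circle_pos_surj F yy Uy.
exists (circle_lift p v t 1); last by rewrite /circle_lift mulr1.
exists (circle_lift p v t); split=> //.
- exact: circle_lift_curve.
- move=> s; rewrite (circle_lift_derive _ _ F).
  rewrite /D spray_fieldE //; last exact: circle_pos_frame.
  by exists (t * rho (slope p v)).
- exact: circle_lift0.
Qed.

Lemma circ_is_circle U r : dot U U = 1 + r ^+ 2 -> is_circle (circ U r).
Proof.
move=> UU; have r0 := rho_gt0 r; have E := rho_sqM r.
exists (im (rho r *: U)), (rho r * r); split.
- exact/S2_im/dot_rho_unit.
- have lt1 : (rho r * r) ^+ 2 < 1.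
    by rewrite -[ltRHS]E exprMn mulrDr mulr1 ltrDr exprn_gt0.
  by rewrite -ltr_norml -(expr_lt1 (n := 2)) // real_normK // num_real.
apply/seteqP; split=> q [qS qU]; split=> //.
  by rewrite imZ dotZr qU.
by move: qU; rewrite imZ dotZr => /mulfI; apply; rewrite gt_eqF.
Qed.

Lemma paths_spray : paths (@S2 R) D = engendered_family (graph_f_kappa kappa).
Proof.
rewrite engendered_graph; apply/seteqP; split=> C.
  move=> [e /contact_elementsP[p [v [F ->]]] ->]; rewrite spray_path //.
  have U2 := dot_centre (k p v) F; apply: kcircle_centre => //.
  have xx := S2plus_unit (dot_rho_unit U2).
  rewrite -radialE // radialZ ?invr_gt0 ?sqrt2_gt0 // radialZ ?rho_gt0 //.
  exact: radial_slope.
move=> [x xx ->].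
have uE := unitv_S2plus xx.
have uu : dot (unitv x) (unitv x) = 1 by apply: dot_unitv; exact: S2plus_nz.
have [m F] := exists_frame uu.
set r := kappa x; have FA := frame_arcpos r F; have r0 := rho_gt0 r.
have CE := centre_arcpos r F.
set p := arcpos _ _ _ in FA CE; set v := cross _ _ in FA CE.
have CE' : centre p v r = (rho r)^-1 *: unitv x.
  by rewrite -CE scalerA mulVf ?scale1r // gt_eqF.
have kE : k p v = r.
  have ri : 0 < (rho r)^-1 by rewrite invr_gt0.
  apply/esym/(slope_root _ FA); rewrite CE' (radialZ _ ri).
  by rewrite uE radialZ ?sqrt2_gt0 // radialE.
apply: (ex_intro2 _ _ (celem p v)); first exact: contact_celem.
by rewrite spray_path // kE CE' uE.
Qed.

Theorem kappa_path_geometry : engenders_circular_path_geometry (graph_f_kappa kappa).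
Proof.
exists D; split; last exact: paths_spray.
split; first exact: spray_path_geometry.
move=> C [e /contact_elementsP[p [v [F ->]]] ->]; rewrite spray_path //.
apply: circ_is_circle; exact: dot_centre.
Qed.

End KappaSphere.

(** * A family of circles determines its curvature function *)

Section Uniqueness.
Variable R : realType.
Implicit Types p v u m x y g U : 'rV[R]_3.

(** U' is proportional to U, being orthogonal to the plane of the circle; the
    norms then leave only a sign. *)
Lemma circ_eq U U' (r r' : R) : dot U U = 1 + r ^+ 2 -> dot U' U' = 1 + r' ^+ 2 ->
  circ U r = circ U' r' -> U = U' /\ r = r' \/ U = - U' /\ r = - r'.
Proof.
move=> UU UU' E.
have r0 := rho_gt0 r.
have uu := dot_rho_unit UU.
have [m F] := exists_frame uu.
have CE := centre_arcpos r F; have FA := frame_arcpos r F.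
set p := arcpos _ _ _ in FA CE; set v := cross _ _ in FA CE.
have CU : centre p v r = U.
  by move: CE => /scalerI; apply; rewrite gt_eqF.
have H t : dot U' (circle_pos p v r t) = r'.
  have : circ U r (im (circle_pos p v r t)).
    split; first by apply/S2_im; exact: circle_pos_unit.
    by rewrite dot_im dotC -CU; exact: circle_pos_center.
  by rewrite E => -[_]; rewrite dot_im dotC.
set q := p - r *: cross p v.
have Hq : dot U' q = 0 /\ dot U' v = 0 /\ rho r ^+ 2 * r * dot U' U = r'.
  have r2 : 0 < rho r ^+ 2 by rewrite exprn_gt0.
  have := H 0; have := H pi; have := H (pi / 2).
  have lin (a b c : R) (X Y Z : 'rV[R]_3) : dot U' (a *: X + b *: Y + c *: Z) =
    a * dot U' X + b * dot U' Y + c * dot U' Z by rewrite !dotDr !dotZr.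
  rewrite /circle_pos CU -/q !lin cos0 sin0 cospi sinpi cos_pihalf sin_pihalf.
  rewrite !(mulr0, mul0r, addr0, mulr1) mulrN1 => A2 A1 A0.
  have q00 : rho r ^+ 2 * dot U' q = 0 by lra.
  have v00 : rho r * dot U' v = 0 by lra.
  split; first by move/eqP: q00; rewrite mulf_eq0 gt_eqF //= => /eqP.
  split; first by move/eqP: v00; rewrite mulf_eq0 gt_eqF //= => /eqP.
  lra.
case: Hq => Uq [Uv Ur].
pose b := rho r ^+ 2 * dot U' U.
have U'E : U' = b *: U.
  rewrite (frame_expand U' FA) Uv scale0r addr0 /b.
  have E1 : dot U' p = r * dot U' (cross p v).
    by move: Uq; rewrite /q dotDr dotNr dotZr => /eqP; rewrite subr_eq0 => /eqP.
  have -> : dot U' U = (1 + r ^+ 2) * dot U' (cross p v).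
    by rewrite -CU /centre dotDr dotZr E1; ring.
  by rewrite mulrA rho_sqM mul1r E1 -CU /centre scalerDr scalerA mulrC.
have r'E : r' = b * r by rewrite -Ur /b; ring.
have b2 : b ^+ 2 = 1.
  have : b ^+ 2 * (1 + r ^+ 2) = 1 + b ^+ 2 * r ^+ 2.
    by rewrite -UU -exprMn -r'E -UU' U'E dotZl dotZr; ring.
  by rewrite mulrDr mulr1 => /addIr.
move/eqP: b2; rewrite -(expr1n _ 2) eqf_sqr => /orP[] /eqP bE.
  by left; rewrite U'E r'E bE scale1r mul1r.
by right; rewrite U'E r'E bE scaleN1r mulN1r !opprK.
Qed.

(** Equal circles have equal centres or, after a change of orientation, opposite
    ones; oddness of kappa' covers the second case. *)
Lemma kappa_unique (kappa kappa' : 'rV[R]_3 -> R) : odd_function kappa' ->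
  engendered_family (graph_f_kappa kappa) = engendered_family (graph_f_kappa kappa') ->
  forall x, S2plus x -> kappa x = kappa' x.
Proof.
move=> odd'; rewrite !engendered_graph => E x xx.
have : [set C | exists2 x, S2plus x & C = kcircle kappa x] (kcircle kappa x) by exists x.
rewrite E => -[y yy CE].
have nrm z (r : R) : S2plus z ->
    dot ((rho r)^-1 *: (Num.sqrt 2 *: z)) ((rho r)^-1 *: (Num.sqrt 2 *: z)) = 1 + r ^+ 2.
  move=> zz; have zz' : dot z z = 2^-1 by exact: zz.
  have u1 : dot (Num.sqrt 2 *: z) (Num.sqrt 2 *: z) = 1.
    by rewrite dotZl dotZr zz' mulrA sqrt2_sq divff.
  by rewrite dotZl dotZr u1 mulr1 -expr2 exprVn rho_sq invrK.
have n0 := @sqrt2_neq0 R.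
have scal z (r : R) (a : 'rV[R]_3) :
    (rho r)^-1 *: (Num.sqrt 2 *: z) = (rho r)^-1 *: (Num.sqrt 2 *: a) -> z = a.
  have rn : (rho r)^-1 != 0 by rewrite invr_eq0 gt_eqF // rho_gt0.
  by move/(scalerI rn)/(scalerI n0).
case: (circ_eq (nrm _ _ xx) (nrm _ _ yy) CE) => -[UE kE].
  by rewrite kE in UE *; rewrite (scal _ _ _ UE).
have rN : rho (- kappa' y) = rho (kappa' y) by rewrite /rho sqrrN.
have -> : x = - y.
  by apply: (scal _ (kappa' y)); rewrite !scalerN -UE kE rN.
by rewrite odd' // -kE; congr kappa; apply: (scal _ (kappa' y)); rewrite !scalerN -UE kE rN.
Qed.

End Uniqueness.

Section Transfer.
Variable R : realType.

(** Gradients are tested on curves in the sphere only. *)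
Lemma eq_on_gradient_norm (kappa kappa' : 'rV[R]_3 -> R) :
  (forall x, S2plus x -> kappa x = kappa' x) ->
  forall x, gradient_norm kappa x = gradient_norm kappa' x.
Proof.
move=> E x; suff GE : is_gradient kappa x = is_gradient kappa' x.
  rewrite /gradient_norm /gradient.
  by have -> : [set g | is_gradient kappa x g] = [set g | is_gradient kappa' x g] by rewrite GE.
apply/funext => g; apply/propext.
have cE c : smooth_curve (@S2plus R) c -> (kappa \o c : R -> R^o) = kappa' \o c.
  by move=> [_ cS]; apply/funext => t /=; exact/E/cS.
by split=> -[gt gP]; split=> // c cc c0; have := gP c cc c0; rewrite cE.
Qed.

End Transfer.

Theorem theoremC (R : realType) :
  (forall kappa : 'rV[R]_3 -> R, smooth_function kappa ->
    (engenders_circular_path_geometry (graph_f_kappa kappa) <->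
     odd_function kappa /\ gradient_bound kappa)) /\
  (forall D : 'rV[R]_4 * 'M[R]_4 -> set ('rV[R]_4 * 'M[R]_4),
    circular_path_geometry D ->
    exists kappa : 'rV[R]_3 -> R,
      [/\ smooth_function kappa, odd_function kappa, gradient_bound kappa &
          paths (@S2 R) D = engendered_family (graph_f_kappa kappa)]).
Proof.
split=> [kappa ks|D Dc]; last exact: path_geometry_kappa.
split=> [[D [Dc DE]]|[odd bd]]; last exact: kappa_path_geometry.
have [kappa' [_ odd' bd' DE']] := path_geometry_kappa Dc.
have E x (xx : S2plus x) : kappa x = kappa' x.
  by apply: (kappa_unique odd') => //; rewrite -DE -DE'.
split=> x xx; last by rewrite (eq_on_gradient_norm E) E //; exact: bd'.
rewrite !E //; first exact: odd'.
by rewrite /S2plus /= dotNl dotNr opprK.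
Qed.
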